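(* Let $0<\alpha<\beta$ be two real numbers and let $f\in\mathcal F$. There exists a continuous homogeneously multifractal (HM) function $Z:[0,1]\to[0,1]$ satisfying: (i) for all $h\in\big(\alpha+(\beta-\alpha)\,\mathrm{Support}^*(f)\big)\setminus\{\beta\}$, $d_Z(h)=\max\left(f\left(\frac{h-\alpha}{\beta-\alpha}\right),0\right)$; (ii) $d_Z(h)=-\infty$ for every real $h\ge0$ with $h\notin\alpha+(\beta-\alpha)\,\mathrm{Support}^*(f)$; (iii) the set $\{x\in[0,1]:h_Z(x)=\beta\}$ has Lebesgue measure $1$.
   Context: For a locally bounded function $Z$ and $\gamma>0$, $Z\in C^\gamma_{x_0}$ means that there are a polynomial $P$ of degree at most $[\gamma]$ (integer part) and a constant $C>0$ such that $|Z(x)-P(x-x_0)|\le C|x-x_0|^\gamma$ for all $x$ (in the domain of $Z$) in a neighborhood of $x_0$. The pointwise H\''older exponent is $h_Z(x_0)=\sup\{\gamma\ge0: Z\in C^\gamma_{x_0}\}$. Let $\dim$ denote Hausdorff dimension with the convention $\dim\emptyset=-\infty$. The multifractal spectrum of $Z:[0,1]\to\mathbb R$ is $d_Z(h)=\dim\{x\in[0,1]:h_Z(x)=h\}$ for real $h\ge0$. The function $Z$ is homogeneously multifractal (HM) if for every non-degenerate subinterval $U\subset[0,1]$ and every $h\ge0$, $\dim\{x\in U:h_Z(x)=h\}=\dim\{x\in[0,1]:h_Z(x)=h\}=d_Z(h)$. For a function $f$ with values in $[0,1]\cup\{-\infty\}$, $\mathrm{Support}(f)=\{x:f(x)>-\infty\}$.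 For $f:[0,1]\to[0,1]\cup\{-\infty\}$, $\mathrm{Support}^*(f)$ is the smallest interval of the form $[h,1]$ containing $\mathrm{Support}(f)$. For a set $A\subset\mathbb R$, $\alpha+(\beta-\alpha)A=\{\alpha+(\beta-\alpha)a:a\in A\}$. The set $\mathcal F$ consists of the functions $f:[0,1]\to[0,1]\cup\{-\infty\}$ for which there is a countable family $(f_n)_{n\ge1}$ of functions $f_n:[0,+\infty]\to[0,1]\cup\{-\infty\}$ such that: for every $n$, $\mathrm{Support}(f_n)$ is a closed, possibly degenerate (one-point), interval $I_n\subset[0,1]$; $\inf_{n\ge1}\min(I_n)>0$; $f_n$ is constant on $I_n$; $f_n(x)\le x$ for every $x\in I_n$; and $f(x)=\sup_{n\ge1}f_n(x)$ for every $x\in[0,1]$ (so $f=-\infty$ off $\bigcup_n I_n$). *)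

(* Defs.v *)
From HB Require Import structures.
From mathcomp Require Import all_boot all_order all_algebra.
From mathcomp Require Import all_classical all_reals all_analysis.
From mathcomp Require Import measurable_realfun lebesgue_measure.

Set Implicit Arguments.
Unset Strict Implicit.
Unset Printing Implicit Defensive.

Import Order.TTheory GRing.Theory Num.Theory.
Import numFieldNormedType.Exports.

Local Open Scope classical_set_scope.
Local Open Scope ring_scope.

(* A function on [0, 1] (resp. on [0, +oo]) is represented by a total function
   on R (resp. on \bar R) together with the domain as an explicit set; values
   outside the domain are never used. *)

Section HausdorffDimension.
Context {R : realType}.
Local Open Scope ereal_scope.

(* -oo for the empty set *)
Definition ediam (U : set R) : \bar R :=
  ereal_sup [set (`|x - y|%R)%:E | x in U & y in U].

(* For s = 0 the empty set weighs 0 and every nonempty set weighs 1. *)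
Definition hausdorff_weight (s : R) (U : set R) : \bar R :=
  if U == set0 then 0 else poweR (ediam U) s.

Definition delta_cover (delta : R) (A : set R) (U : nat -> set R) : Prop :=
  A `<=` \bigcup_k U k /\ forall k, ediam (U k) <= delta%:E.

Definition hausdorff_premeasure (s delta : R) (A : set R) : \bar R :=
  ereal_inf [set \sum_(0 <= k <oo) hausdorff_weight s (U k) |
    U in delta_cover delta A].

Definition hausdorff_measure (s : R) (A : set R) : \bar R :=
  ereal_sup [set hausdorff_premeasure s delta A |
    delta in [set delta | (0 < delta)%R]].

Definition hausdorff_dim (A : set R) : \bar R :=
  if A == set0 then -oo
  else ereal_inf [set s%:E |
    s in [set s | (0 <= s)%R /\ hausdorff_measure s A = 0]].

End HausdorffDimension.

Section Multifractal.
Context {R : realType}.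

(* At gamma = 0 the bound reads `|Z x - P| <= C, since 0 `^ 0 = 1: membership
   is then local boundedness of Z at x0. *)
Definition pointwise_holder (D : set R) (Z : R -> R) (gamma x0 : R) : Prop :=
  exists (P : {poly R}) (C : R),
    [/\ (size P <= (Num.truncn gamma).+1)%N, 0 < C &
        \forall x \near x0, D x ->
          `|Z x - P.[x - x0]| <= C * (`|x - x0| `^ gamma)].

Definition holder_exponent (D : set R) (Z : R -> R) (x0 : R) : \bar R :=
  ereal_sup [set gamma%:E |
    gamma in [set gamma | 0 <= gamma /\ pointwise_holder D Z gamma x0]].

Definition iso_holder (Z : R -> R) (h : R) : set R :=
  [set x | `[0, 1]%classic x /\ holder_exponent `[0, 1] Z x = h%:E].

Definition spectrum (Z : R -> R) (h : R) : \bar R :=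
  hausdorff_dim (iso_holder Z h).

Definition homogeneously_multifractal (Z : R -> R) : Prop :=
  forall U : set R, is_interval U -> U `<=` `[0, 1] ->
    (exists a b, [/\ U a, U b & a < b]) ->
    forall h, 0 <= h -> hausdorff_dim (U `&` iso_holder Z h) = spectrum Z h.

End Multifractal.

Section ClassF.
Context {R : realType}.

Definition unit_or_ninfty (y : \bar R) : Prop :=
  (y = -oo \/ 0 <= y <= 1)%E.

Definition fsupport (T : Type) (D : set T) (f : T -> \bar R) : set T :=
  [set x | D x /\ (-oo < f x)%E].

Definition fsupport_star (f : R -> \bar R) : set R :=
  smallest [set I | exists h : R, I = `[h, 1]%classic]
           (fsupport `[0, 1] f).

Definition affine_image (alpha beta : R) (A : set R) : set R :=
  [set alpha + (beta - alpha) * a | a in A].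

(* The support of fn n is the nonempty interval [a n, b n], with minimum a n. *)
Definition classF (f : R -> \bar R) : Prop :=
  (forall x, 0 <= x <= 1 -> unit_or_ninfty (f x)) /\
  exists (fn : nat -> \bar R -> \bar R) (a b : nat -> R),
    [/\ forall n x, (0 <= x)%E -> unit_or_ninfty (fn n x),
        forall n, [/\ 0 <= a n, a n <= b n, b n <= 1 &
          fsupport [set x | (0 <= x)%E] (fn n) =
            [set x%:E | x in `[a n, b n]]],
        0 < inf (range a),
        forall n, (exists c, forall x, a n <= x <= b n -> fn n x%:E = c) /\
                  (forall x, a n <= x <= b n -> (fn n x%:E <= x%:E)%E) &
        forall x, 0 <= x <= 1 ->
          f x = ereal_sup (range (fun n => fn n x%:E))].

(* A belongs to the Lebesgue (completed Borel) sigma-algebra. *)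
Definition lebesgue_measurable (A : set R) : Prop :=
  (completed_algebra_gen (@lebesgue_measure R)).-sigma.-measurable A.

End ClassF.

(* Main.v *)
Require Import Defs.
From HB Require Import structures.
From mathcomp Require Import all_boot all_order all_algebra.
From mathcomp Require Import all_classical all_reals all_analysis.
From mathcomp Require Import zify ring lra.

Import Order.TTheory GRing.Theory Num.Theory.
Import numFieldNormedType.Exports.

Local Open Scope classical_set_scope.
Local Open Scope ring_scope.

(** [Z] is an affine image of [W + \sum_j S j].  The Weierstrass-type series [W]
has exponent [beta] everywhere.  Each [S j] lives in a tiny neighbourhood of a
Cantor set [K j] of dimension [c]: every gap carries a bump whose height is the
power [h_w] of its width, where [h_w] in [[A, B]] is read off those binary digits
of the address [w] of the gap whose ranks are powers of two.  These digits have
density zero, so prescribing the limit [h] of the exponents costs no dimension: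
every level set of the exponent on [K j] has dimension [c].  The triples
[(A, B, c)] run over the data defining [f], together with triples of dimension
[0] that fill [Support^* f], and each of them is realised inside every rational
interval.  The pieces are chosen inductively so small that they do not interact,
except on the points that belong to infinitely many of the neighbourhoods, which
form a set of dimension [0]. *)

(** * Absolutely summable families and finite differences *)

Section HasSum.
Context {R : realType}.
Implicit Types (u v e : nat -> R) (l E : R).

(** The delicate points are those lying in infinitely many of the neighbourhoods: the exponent is
    not computed there, only confined to [[hmin, beta]]. The lower bound holds because every [S j]
    is uniformly regular up to [hmin]. The upper bound has to come from [W], and it dictates the
    geometry: to the right of the support of [S j] a free window is kept at the scale [d j] of that
    support. There [S j] vanishes, the later pieces are negligible against [d j ^ beta] because
    their heights are [d ^ (beta + 1)], and the earlier ones are smooth at that scale. This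
    confinement is what (ii) requires, and a set of dimension 0 does no harm in (i), where the
    spectrum is at least 0. Irregularity is always read off finite differences of one order
    [m > beta + 1]. They kill Taylor polynomials, so the polynomial in the definition of the
    exponent never has to be identified and integer exponents need no special treatment. *)

Definition has_sum u l := series u @ \oo --> l.

Lemma has_sum_ex u e E :
  (forall n, `|u n| <= e n) -> (forall n, \sum_(0 <= i < n) e i <= E) ->
  exists l, has_sum u l.
Proof.
move=> ue eE; suff cu : cvgn (series u) by exists (limn (series u)).
have e0 n : 0 <= e n by apply: le_trans (ue n).
apply: normed_cvg; apply: (@series_le_cvg _ _ e) => //; first by move=> n /=.
apply: (@nondecreasing_is_cvgn _ (series e)); last by exists E => _ [n _ <-]; exact: eE.
by apply: nondecreasing_series => n _ _.
Qed.

Lemma has_sumD u v l l' :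
  has_sum u l -> has_sum v l' -> has_sum (fun n => u n + v n) (l + l').
Proof.
move=> ul vl; rewrite /has_sum.
have -> : series (fun n => u n + v n) = series u + series v.
  by apply/funext => n; rewrite fctE /series /= -big_split.
exact: cvgD.
Qed.

Lemma has_sumZ u l (c : R) :
  has_sum u l -> has_sum (fun n => c * u n) (c * l).
Proof.
move=> ul; rewrite /has_sum.
have -> : series (fun n => c * u n) = (fun n => c * series u n).
  by apply/funext => n; rewrite /series /= -mulr_sumr.
exact: cvgMr.
Qed.

Lemma has_sumB u v l l' :
  has_sum u l -> has_sum v l' -> has_sum (fun n => u n - v n) (l - l').
Proof.
move=> ul /(has_sumZ _ _ (-1)) vl; have := has_sumD _ _ _ _ ul vl.
by rewrite mulN1r; congr (has_sum _ _); apply/funext => n; rewrite mulN1r.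
Qed.

Lemma has_sum_fin u N : (forall n, (N <= n)%N -> u n = 0) ->
  has_sum u (\sum_(0 <= i < N) u i).
Proof.
move=> u0; apply: cvg_near_cst; exists N => // n /= Nn.
rewrite /series /= (big_cat_nat _ Nn) //= [X in _ + X]big1_seq ?addr0//.
by move=> i /andP[_]; rewrite mem_index_iota => /andP[/u0].
Qed.

Lemma has_sum0 : has_sum (fun=> 0) 0.
Proof. by have := has_sum_fin (fun=> 0) 0 (fun _ _ => erefl); rewrite big_geq. Qed.

Lemma has_sum_unique u l l' : has_sum u l -> has_sum u l' -> l = l'.
Proof. by move=> ul ul'; exact: (cvg_unique _ ul ul'). Qed.

Lemma has_sum_sum (u : nat -> nat -> R) (l : nat -> R) N :
  (forall i, (i < N)%N -> has_sum (u i) (l i)) ->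
  has_sum (fun n => \sum_(i < N) u i n) (\sum_(i < N) l i).
Proof.
elim: N => [|N IH] ul.
  rewrite big_ord0; have -> : (fun n => \sum_(i < 0) u i n) = fun=> 0 :> R.
    by apply/funext => n; rewrite big_ord0.
  exact: has_sum0.
rewrite big_ord_recr /=; have -> : (fun n => \sum_(i < N.+1) u i n) =
    fun n => \sum_(i < N) u i n + u N n.
  by apply/funext => n; rewrite big_ord_recr.
by apply: has_sumD; [apply: IH => i iN; apply: ul; apply: ltnW|exact: ul].
Qed.

Lemma has_sum_bound u e l E : has_sum u l ->
  (forall n, `|u n| <= e n) -> (forall n, \sum_(0 <= i < n) e i <= E) ->
  `|l| <= E.
Proof.
move=> ul ue eE.
have key n : `|series u n| <= E.
  by apply: le_trans (eE n); apply: le_trans (ler_norm_sum _ _ _) _; apply: ler_sum.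
apply: (@closed_cvg _ _ \oo _ (series u) [set x | `|x| <= E]) ul => //.
  have -> : [set x : R | `|x| <= E] = (fun x : R => `|x|) @^-1` [set x | x <= E] by [].
  by apply: closed_comp => [x _|]; [exact: norm_continuous|exact: closed_le].
by exists 0%N => // n _; exact: key.
Qed.

Lemma has_sum_tail u l N : has_sum u l ->
  has_sum (fun n => if (n < N)%N then 0 else u n) (l - \sum_(0 <= i < N) u i).
Proof.
move=> ul; have h := has_sum_fin (fun n => if (n < N)%N then u n else 0) N.
have {h} := has_sumB _ _ _ _ ul (h _).
rewrite (@eq_big_nat _ _ _ 0%N N _ u); last by move=> i /andP[_ ->].
move=> H; suff -> : (fun n => if (n < N)%N then 0 else u n) =
   (fun n => u n - (if (n < N)%N then u n else 0)).
  by apply: H => n; rewrite leqNgt => /negbTE ->.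
by apply/funext => n; case: ifP => _; rewrite ?subrr ?subr0.
Qed.

End HasSum.

Section FiniteDifference.
Context {R : realType}.
Implicit Types (f : R -> R) (y t c : R).

(** The sign is that of [(-1)^m] times the forward difference, so that [f y] itself has coefficient
    1. *)
Fixpoint fdiff (m : nat) t f y : R :=
  if m is n.+1 then fdiff n t f y - fdiff n t f (y + t) else f y.

Lemma stencil_shift y t (i : nat) : y + t + i%:R * t = y + i.+1%:R * t.
Proof. by rewrite -natr1; ring. Qed.

Lemma eq_fdiff m t f f' y :
  (forall i, (i <= m)%N -> f (y + i%:R * t) = f' (y + i%:R * t)) ->
  fdiff m t f y = fdiff m t f' y.
Proof.
elim: m y => [|m IH] y ff /=; first by have := ff 0%N isT; rewrite mul0r addr0.
congr (_ - _); first by apply: IH => i im; apply: ff; apply: ltnW.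
by apply: IH => i im; rewrite stencil_shift; exact: ff.
Qed.

Lemma fdiffD m t f f' y :
  fdiff m t (fun x => f x + f' x) y = fdiff m t f y + fdiff m t f' y.
Proof. by elim: m y => //= m IH y; rewrite !IH; ring. Qed.

Lemma fdiffB m t f f' y :
  fdiff m t (fun x => f x - f' x) y = fdiff m t f y - fdiff m t f' y.
Proof. by elim: m y => //= m IH y; rewrite !IH; ring. Qed.

Lemma fdiff0 m t y : fdiff m t (fun=> 0) y = 0.
Proof. by elim: m y => //= m IH y; rewrite !IH subrr. Qed.

Lemma fdiff_sum m t (f : nat -> R -> R) y N :
  fdiff m t (fun x => \sum_(i < N) f i x) y = \sum_(i < N) fdiff m t (f i) y.
Proof.
elim: N => [|N IH].
  by rewrite big_ord0 -[RHS](fdiff0 m t y); apply: eq_fdiff => i _; rewrite big_ord0.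
rewrite big_ord_recr /= -IH -fdiffD; apply: eq_fdiff => i _.
by rewrite big_ord_recr.
Qed.

Lemma fdiff_bound m t f y B :
  (forall i, (i <= m)%N -> `|f (y + i%:R * t)| <= B) ->
  `|fdiff m t f y| <= 2 ^+ m * B.
Proof.
elim: m y => [|m IH] y fB /=.
  by have := fB 0%N isT; rewrite mul0r addr0 expr0 mul1r.
apply: le_trans (ler_normB _ _) _.
have -> : 2 ^+ m.+1 * B = 2 ^+ m * B + 2 ^+ m * B by rewrite exprS; ring.
apply: lerD; apply: IH => i im; first by apply: fB; apply: ltnW.
by rewrite stencil_shift; exact: fB.
Qed.

(** Meant for a stencil that starts inside a bump and leaves it with its second node: the difference
    then returns the height of the bump, without cancellation. *)
Lemma fdiff_single m t f y :
  (forall i, (0 < i <= m)%N -> f (y + i%:R * t) = 0) -> fdiff m t f y = f y.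
Proof.
elim: m => //= m IH f0; rewrite IH; last first.
  by move=> i /andP[i0 im]; apply: f0; rewrite i0 ltnW.
rewrite (@eq_fdiff _ _ _ (fun=> 0)) ?fdiff0 ?subr0// => i im.
by rewrite stencil_shift; exact: f0.
Qed.

(** [Q] and its translate have the same leading coefficient, so one difference lowers the bound on
    the size by one. *)
Lemma fdiff_poly m t (Q : {poly R}) x y : (size Q <= m)%N ->
  fdiff m t (fun z => Q.[z - x]) y = 0.
Proof.
elim: m Q y => [|m IH] Q y sQ /=.
  by move: sQ; rewrite leqn0 size_poly_eq0 => /eqP ->; rewrite horner0.
set Q' := Q - (Q \Po ('X + t%:P)).
have sQt : size (Q \Po ('X + t%:P)) = size Q by rewrite size_comp_poly2 ?size_XaddC.
have sQ' : (size Q' <= m)%N.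
  apply/leq_sizeP => j mj; rewrite /Q' coefB.
  have [jm|mj'] := ltnP m j; first by rewrite !nth_default ?subr0 ?sQt// (leq_trans sQ).
  have {mj mj'} -> : j = m by apply/eqP; rewrite eqn_leq mj mj'.
  have [sQm|sQm] := leqP (size Q) m; first by rewrite !nth_default ?subr0 ?sQt.
  have szQ : size Q = m.+1 by apply/eqP; rewrite eqn_leq sQ sQm.
  have := @lead_coef_comp _ Q ('X + t%:P); rewrite size_XaddC => /(_ isT).
  by rewrite lead_coefXaddC expr1n mulr1 !lead_coefE sQt szQ /= => ->; rewrite subrr.
have shift (f : R -> R) : fdiff m t f (y + t) = fdiff m t (fun z => f (z + t)) y.
  move: (y) => z; elim: (m) z => //= k IHk z; rewrite !IHk //.
rewrite shift -fdiffB -[RHS](IH Q' y sQ'); apply: eq_fdiff => i _.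
by rewrite /Q' hornerD hornerN horner_comp !hornerE; congr (_ - Q.[_]); ring.
Qed.

End FiniteDifference.

(** * Uniform jets *)

Section UniformHolder.
Context {R : realType}.
Implicit Types (g C E : R) (f F : R -> R) (a : R -> nat -> R) (x y r : R).

(* [a x] is the jet of [f] at [x]; the constant is uniform in [x] and global in [y]. *)
Definition uniform_holder g C f a : Prop := forall x,
  (forall i, (i <= Num.truncn g)%N -> `|a x i| <= C) /\
  forall y, `|f y - \sum_(i < (Num.truncn g).+1) a x i * (y - x) ^+ i| <=
            C * `|y - x| `^ g.

Lemma uniform_holder_le g C C' f a : C <= C' ->
  uniform_holder g C f a -> uniform_holder g C' f a.
Proof.
move=> CC' fa x; have [h1 h2] := fa x; split=> [i ig|y].
  exact: le_trans (h1 i ig) CC'.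
by apply: le_trans (h2 y) _; rewrite ler_wpM2r ?powR_ge0.
Qed.

Lemma uniform_holder_ge0 g C f a : uniform_holder g C f a -> 0 <= C.
Proof. by move=> /(_ 0)[/(_ 0%N isT) h _]; apply: le_trans h. Qed.

Lemma uniform_holder0 g C : 0 <= C -> uniform_holder g C (fun=> 0) (fun=> fun=> 0).
Proof.
move=> C0 x; split=> [i _|y]; first by rewrite normr0.
rewrite big1 => [|i _]; last by rewrite mul0r.
by rewrite subr0 normr0 mulr_ge0 ?powR_ge0.
Qed.

Lemma expr_le_powR g (u : R) k : (0 < k)%N -> 0 <= u <= 1 -> g <= k%:R ->
  u ^+ k <= u `^ g.
Proof.
move=> k0 /andP[u0 u1] gk; move: u0; rewrite le_eqVlt => /predU1P[<-|u0].
  by rewrite expr0n gtn_eqF//= powR_ge0.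
by rewrite -powR_mulrn ?(ltW u0)//; apply: ger_powR => //; rewrite u0.
Qed.

Lemma powR_le_expr g (u : R) k : 1 <= u -> k%:R <= g -> u ^+ k <= u `^ g.
Proof.
move=> u1 kg; rewrite -powR_mulrn; last exact: le_trans u1.
exact: ler_powR.
Qed.

(** The [i]-th jet coefficient is divided by [r ^+ i], and [r ^+ i >= r ^ g] because [r <= 1] and
    [i <= g]; hence the single factor [r ^ (-g)] controls the coefficients and the remainder
    alike. *)
Lemma uniform_holder_scale g C f a (H v r : R) : 0 <= g -> 0 < r <= 1 ->
  uniform_holder g C f a ->
  uniform_holder g (`|H| * r `^ (- g) * C) (fun x => H * f ((x - v) / r))
    (fun x i => H * a ((x - v) / r) i / r ^+ i).
Proof.
move=> g0 /andP[r0 r1] fa x; have [h1 h2] := fa ((x - v) / r); split=> [i ig|y].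
  rewrite !normrM -mulrA -mulrA ler_wpM2l// [r `^ _ * C]mulrC.
  apply: ler_pM => //; first exact: h1.
  rewrite normrV ?unitfE ?expf_neq0 ?gt_eqF// normrX gtr0_norm//.
  rewrite powRN lef_pV2 ?posrE ?exprn_gt0 ?powR_gt0//.
  rewrite -powR_mulrn ?(ltW r0)//; apply: ger_powR; first by rewrite r0.
  by apply: le_trans (_ : (Num.truncn g)%:R <= _); rewrite ?ler_nat// truncn_le.
have -> : H * f ((y - v) / r) - \sum_(i < (Num.truncn g).+1)
    H * a ((x - v) / r) i / r ^+ i * (y - x) ^+ i =
    H * (f ((y - v) / r) - \sum_(i < (Num.truncn g).+1)
    a ((x - v) / r) i * ((y - v) / r - (x - v) / r) ^+ i).
  rewrite mulrBr mulr_sumr; congr (_ - _); apply: eq_bigr => i _.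
  rewrite -mulrBl opprB addrA subrK expr_div_n; ring.
rewrite normrM -!mulrA ler_wpM2l//; apply: le_trans (h2 _) _.
rewrite -mulrBl opprB addrA subrK normrM (ger0_norm (_ : 0 <= r^-1)) ?invr_ge0 ?(ltW r0)//.
rewrite powRM ?invr_ge0 ?(ltW r0)// powRN -powR_inv1 ?(ltW r0)// -powRrM mulN1r powRN.
rewrite le_eqVlt; apply/orP; left; apply/eqP; ring.
Qed.

(** At most one [F K] is active at each point. When [x] and [y] select different functions, the one
    active at [x] vanishes at [y] and the one active at [y] has zero jet at [x], so two remainders
    bound everything: a whole family with disjoint supports costs only a factor 2. *)
Lemma uniform_holder_select (I : Type) (sel : R -> I) g C
    (F : I -> R -> R) (a : I -> R -> nat -> R) :
  (forall K, uniform_holder g C (F K) (a K)) ->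
  (forall x K, K <> sel x -> F K x = 0 /\ forall i, a K x i = 0) ->
  uniform_holder g (2 * C) (fun x => F (sel x) x) (fun x => a (sel x) x).
Proof.
move=> Fa off x; have [h1 h2] := Fa (sel x) x.
have C0 : 0 <= C := uniform_holder_ge0 _ _ _ _ (Fa (sel x)).
split=> [i ig|y]; first by apply: le_trans (h1 i ig) _; lra.
have [->|ne] := pselect (sel y = sel x).
  by apply: le_trans (h2 y) _; rewrite ler_wpM2r ?powR_ge0//; lra.
have := h2 y; have [-> _] := off y (sel x) (fun e => ne (esym e)).
rewrite sub0r normrN => hP.
have := (Fa (sel y) x).2 y; have [_ a0] := off x (sel y) ne.
rewrite big1 ?subr0; last by move=> i _; rewrite a0 mul0r.
move=> hF; apply: le_trans (ler_normB _ _) _.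
by rewrite mulrDl mul1r mulrDl; apply: lerD.
Qed.

(** Jets are summed termwise; only coefficients of degree at most the integer part of [g] are known
    to be summable, and the others are left arbitrary. *)
Lemma uniform_holder_has_sum g (C : nat -> R) E (f : nat -> R -> R)
    (a : nat -> R -> nat -> R) F :
  (forall n, uniform_holder g (C n) (f n) (a n)) ->
  (forall n, \sum_(0 <= i < n) C i <= E) ->
  (forall x, has_sum (fun n => f n x) (F x)) ->
  exists A, uniform_holder g E F A.
Proof.
move=> fa CE fF.
have /choice[A hA] : forall xi : R * nat, exists l, (xi.2 <= Num.truncn g)%N ->
    has_sum (fun n => a n xi.1 xi.2) l.
  case=> x i /=; have [ig|_] := boolP (i <= _)%N; last by exists 0.
  have [l hl] := has_sum_ex (fun n => a n x i) C E (fun n => (fa n x).1 i ig) CE.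
  by exists l.
exists (fun x (i : nat) => A (x, i)) => x; split=> [i ig|y].
  by apply: (has_sum_bound _ C _ _ (hA (x, i) ig)) => // n; exact: (fa n x).1.
have hS : has_sum (fun n => \sum_(i < (Num.truncn g).+1) (y - x) ^+ i * a n x i)
    (\sum_(i < (Num.truncn g).+1) (y - x) ^+ i * A (x, val i)).
  apply: (has_sum_sum (fun i n => (y - x) ^+ i * a n x i)
                      (fun i => (y - x) ^+ i * A (x, i))) => i ig.
  by apply: has_sumZ; apply: (hA (x, i)).
have := has_sumB _ _ _ _ (fF y) hS.
rewrite (eq_bigr (fun i : 'I_ _ => A (x, val i) * (y - x) ^+ i)); last first.
  by move=> i _; rewrite mulrC.
move=> hB; apply: (has_sum_bound _ (fun n => C n * `|y - x| `^ g) _ _ hB).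
  move=> n; have := (fa n x).2 y; congr (`|_ - _| <= _).
  by apply: eq_bigr => i _; rewrite mulrC.
by move=> n; rewrite -mulr_suml ler_wpM2r ?powR_ge0.
Qed.

(** Subtracting the Taylor polynomial at [y] does not change a difference of order larger than its
    degree; what is left is the remainder at distance at most [m * t]. *)
Lemma uniform_holder_fdiff g C f a (m : nat) t y : 0 <= g -> 0 <= t ->
  (Num.truncn g < m)%N -> uniform_holder g C f a ->
  `|fdiff m t f y| <= 2 ^+ m * (C * (m%:R * t) `^ g).
Proof.
move=> g0 t0 gm fa; have [_ h] := fa y; have C0 := uniform_holder_ge0 _ _ _ _ fa.
pose Q := \poly_(i < (Num.truncn g).+1) a y i.
have QE z : Q.[z] = \sum_(i < (Num.truncn g).+1) a y i * z ^+ i.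
  exact: horner_poly.
have -> : fdiff m t f y = fdiff m t (fun z => f z - Q.[z - y]) y.
  by rewrite fdiffB fdiff_poly ?subr0//; apply: leq_trans (size_poly _ _) _.
apply: fdiff_bound => i im; rewrite QE.
apply: le_trans (h _) _; rewrite ler_wpM2l// addrAC subrr add0r.
rewrite ger0_norm ?mulr_ge0// ge0_ler_powR ?nnegrE ?mulr_ge0//.
by rewrite ler_wpM2r// ler_nat.
Qed.

End UniformHolder.

Lemma sumr_const_ord {R : pzRingType} n (u : R) : \sum_(i < n) u = n%:R * u.
Proof. by rewrite sumr_const card_ord mulr_natl. Qed.

(** * Polynomial bumps and their jets *)

Section Bump.
Context {R : realType} (M : nat).
Implicit Types (x y : R).

(** A zero of order [M] at both ends makes the extension by 0 regular of every order [g < M], with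
    polynomial jets. *)
Definition bump_poly : {poly R} := ('X * (1 - 'X)) ^+ M.

Definition bump x : R := if 0 < x < 1 then bump_poly.[x] else 0.

Definition bump_jet x i : R := if 0 < x < 1 then (bump_poly^`N(i)).[x] else 0.

Lemma bump_polyE x : bump_poly.[x] = (x * (1 - x)) ^+ M.
Proof. by rewrite /bump_poly horner_exp !hornerE. Qed.

Lemma bump_off x : ~~ (0 < x < 1) -> bump x = 0.
Proof. by rewrite /bump => /negbTE ->. Qed.

Lemma bump_ge0_le1 x : 0 <= bump x <= 1.
Proof.
rewrite /bump; case: ifP => [/andP[x0 x1]|_]; last by rewrite lexx ler01.
rewrite bump_polyE; have h0 : 0 <= x * (1 - x) by rewrite mulr_ge0 ?ltW// subr_gt0.
by rewrite exprn_ge0//= exprn_ile1//; nra.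
Qed.

Lemma bump_half_gt0 : 0 < bump 2^-1.
Proof.
rewrite /bump bump_polyE; have -> : 0 < (2^-1 : R) < 1 by lra.
by apply: exprn_gt0; lra.
Qed.

Lemma horner_norm_le (p : {poly R}) x : 0 <= x <= 1 ->
  `|p.[x]| <= \sum_(i < size p) `|p`_i|.
Proof.
move=> /andP[x0 x1]; rewrite horner_coef; apply: le_trans (ler_norm_sum _ _ _) _.
apply: ler_sum => i _; rewrite normrM ler_piMr// normrX ger0_norm//.
exact: exprn_ile1.
Qed.

Lemma bump_jet_bound : exists2 C : R, 0 < C & forall i x, 0 <= x <= 1 ->
  `|bump_poly^`N(i).[x]| <= C.
Proof.
pose B i := \sum_(j < size bump_poly^`N(i)) `|(bump_poly^`N(i))`_j|.
have B0 i : 0 <= B i by apply: sumr_ge0.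
exists (1 + \sum_(i < size bump_poly) B i) => [|i x x01].
  by apply: ltr_pwDl => //; apply: sumr_ge0.
have [si|si] := leqP (size bump_poly) i.
  rewrite nderivn_poly0// horner0 normr0; apply: addr_ge0 => //.
  exact: sumr_ge0.
apply: le_trans (horner_norm_le _ _ x01) _; rewrite -/(B i).
rewrite (bigD1 (Ordinal si))//= addrCA lerDl addr_ge0//.
by apply: sumr_ge0.
Qed.

(** The delicate case is a pair of points separated by an end of [[0, 1]] at distance [|h| < 1]:
    there [|y * (1 - y)| <= 2 * |h|], so the polynomial itself is at most [(2 * |h|) ^+ M], which is
    [O(|h| ^ g)]. Otherwise everything vanishes, or Taylor's formula applies, or [|h| >= 1] and each
    term is at most a multiple of [|h| ^ g]. *)
Lemma uniform_holder_bump (g : R) : 0 <= g < M%:R ->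
  exists2 C : R, 0 < C & uniform_holder g C bump bump_jet.
Proof.
move=> /andP[g0 gM]; have [B B0 hB] := bump_jet_bound.
set d := Num.truncn g; set n := size bump_poly.
have gd : g < d.+1%:R by rewrite truncnS_gt.
have dg : d%:R <= g by rewrite truncn_le.
have dM : (d < M)%N by rewrite truncn_lt_nat.
have M0 : (0 < M)%N by apply: leq_trans dM.
have pM0 : 0 <= 2 ^+ M :> R by rewrite exprn_ge0.
have nB0 : 0 <= n%:R * B by rewrite mulr_ge0 ?(ltW B0).
have dB0 : 0 <= d.+1%:R * B by rewrite mulr_ge0 ?(ltW B0).
(* [2 ^+ M] serves separated points, [1] the far ones, [B] the coefficients, [n * B] Taylor's
   remainder and [d.+1 * B] the Taylor polynomial at distance at least 1. *)
exists (2 ^+ M + 1 + (B + n%:R * B + d.+1%:R * B)) => [|x]; first lra.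
split=> [i _|y].
  rewrite /bump_jet; case: ifP => [/andP[x0 x1]|_]; last by rewrite normr0; lra.
  have xI : 0 <= x <= 1 by rewrite !ltW.
  by have h := hB i x xI; lra.
have b01 := bump_ge0_le1 y.
have bn : `|bump y| <= 1 by rewrite ger0_norm; lra.
set h := y - x; have p0 := powR_ge0 `|h| g.
suff [c] : exists c, `|bump y - \sum_(i < d.+1) bump_jet x i * h ^+ i| <=
    c * `|h| `^ g /\ c <= 2 ^+ M + 1 + (n%:R * B + d.+1%:R * B).
  case=> hc cC; apply: le_trans hc _; rewrite ler_wpM2r//; lra.
rewrite /bump_jet; have [/andP[x0 x1]|x01] := boolP (0 < x < 1); last first.
  exists 1; split; last lra.
  rewrite big1 ?subr0 ?mul1r; last by move=> i _; rewrite mul0r.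
  have [h1|h1] := leP 1 `|h|.
    by apply: le_trans bn _; have := powR_le_expr g _ 0 h1 g0; rewrite expr0.
  rewrite /bump; case: ifP => [/andP[y0 y1]|_]; last by rewrite normr0.
  rewrite bump_polyE; apply: le_trans (expr_le_powR g _ _ M0 _ (ltW gM)); last first.
    by rewrite normr_ge0 ltW.
  rewrite normrX lerXn2r ?nnegrE//.
  move: x01; rewrite negb_and -!leNgt => /orP[x0|x1].
    rewrite !ger0_norm ?/h; nra.
  rewrite ger0_norm ?ler0_norm ?/h; nra.
have xI : 0 <= x <= 1 by rewrite !ltW.
set S := \sum_(_ < _) _.
have SB : `|S| <= \sum_(i < d.+1) (B * `|h| ^+ i).
  apply: le_trans (ler_norm_sum _ _ _) _; apply: ler_sum => i _.
  by rewrite normrM normrX ler_wpM2r ?exprn_ge0// hB.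
have [h1|h1] := leP 1 `|h|.
  exists (1 + d.+1%:R * B); split; last lra.
  have h1g : 1 <= `|h| `^ g by have := powR_le_expr g _ 0 h1 g0; rewrite expr0.
  apply: le_trans (ler_normB _ _) _; rewrite mulrDl mul1r; apply: lerD; first lra.
  apply: le_trans SB _; rewrite -mulr_sumr [d.+1%:R * _]mulrC -mulrA ler_pM2l//.
  rewrite -sumr_const_ord; apply: ler_sum => i _.
  apply: powR_le_expr => //; apply: le_trans dg; rewrite ler_nat -ltnS; exact: ltn_ord.
have hle : 0 <= `|h| <= 1 by rewrite normr_ge0 ltW.
have hd : `|h| ^+ d.+1 <= `|h| `^ g by apply: expr_le_powR => //; apply: ltW.
have qE : bump_poly.[y] = \sum_(i < n + d.+1) bump_poly^`N(i).[x] * h ^+ i.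
  rewrite -nderiv_taylor_wide ?leq_addr//; last exact: mulrC.
  by rewrite /h addrCA subrr addr0.
have qS : `|bump_poly.[y] - S| <= n%:R * B * `|h| `^ g.
  rewrite qE addnC big_split_ord /= addrAC subrr add0r.
  apply: le_trans (ler_norm_sum _ _ _) _.
  rewrite -mulrA -sumr_const_ord; apply: ler_sum => i _.
  rewrite normrM normrX ler_pM ?exprn_ge0//; first by rewrite hB.
  by apply: le_trans hd; rewrite ler_wiXn2l//; [case/andP: hle|rewrite leq_addr].
rewrite {1}/bump; case: ifP => [/andP[y0 y1]|/negbT y01].
  exists (n%:R * B); split; first exact: qS.
  lra.
exists (2 ^+ M + n%:R * B); split; last lra.
have -> : 0 - S = (bump_poly.[y] - S) - bump_poly.[y] by ring.
apply: le_trans (ler_normB _ _) _; rewrite addrC mulrDl; apply: lerD => //.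
rewrite bump_polyE normrX; apply: le_trans (_ : (2 * `|h|) ^+ M <= _).
  rewrite lerXn2r ?nnegrE ?mulr_ge0// normrM.
  move: y01; rewrite negb_and -!leNgt => /orP[y0|y1].
    have h0 : h <= 0 by rewrite /h; lra.
    have y1 : 0 <= 1 - y by lra.
    have yx : - (y - x) < 1 by move: h1; rewrite (ler0_norm h0).
    by rewrite (ler0_norm y0) (ler0_norm h0) (ger0_norm y1) /h; nra.
  have h0 : 0 <= h by rewrite /h; lra.
  have y0 : 0 <= y by lra.
  have y1' : 1 - y <= 0 by lra.
  have yx : y - x < 1 by move: h1; rewrite (ger0_norm h0).
  by rewrite (ger0_norm y0) (ger0_norm h0) (ler0_norm y1') /h; nra.
rewrite exprMn ler_wpM2l//; apply: expr_le_powR => //; exact: ltW.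
Qed.

End Bump.

(** * Pointwise Hölder regularity *)

Section PointwiseHolder.
Context {R : realType}.
Implicit Types (D : set R) (f : R -> R) (g b x y t c r L : R).

Lemma powRD_gt0 x b c : 0 < x -> x `^ (b + c) = x `^ b * x `^ c.
Proof. by move=> x0; apply: powRD; apply/implyP => _; rewrite gt_eqF. Qed.

Lemma near_normP x (P : R -> Prop) :
  (\forall y \near x, P y) <-> exists2 r, 0 < r & forall y, `|y - x| < r -> P y.
Proof.
split=> [/nbhs_ballP[r /= r0 rP]|[r r0 rP]].
  by exists r => // y yr; apply: rP; rewrite /ball/= distrC.
by apply/nbhs_ballP; exists r => //= y; rewrite /ball/= distrC => /rP.
Qed.

(** The terms of [P] of degree at least [[g'] + 1 > g'] are absorbed in the error, so the truncation
    of [P] is admissible for [g']. *)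
Lemma pointwise_holder_le D f g g' x : 0 <= g' <= g ->
  pointwise_holder D f g x -> pointwise_holder D f g' x.
Proof.
move=> /andP[g'0 g'g] [P [C [sP C0 fP]]].
pose n := (Num.truncn g').+1; pose Q := take_poly n P.
pose B : R := \sum_(i < size P) `|P`_i|; have B0 : 0 <= B by apply: sumr_ge0.
exists Q, (C + B); split; rewrite ?ltr_pwDl ?size_take_poly//.
have /near_normP[r r0 fr] := fP.
apply/near_normP; exists (Num.min r 1); first by rewrite lt_min r0 ltr01.
move=> y; rewrite lt_min => /andP[yr y1] Dy; set h := y - x.
have hle : 0 <= `|h| <= 1 by rewrite normr_ge0 ltW.
have -> : f y - Q.[h] = (f y - P.[h]) + (P.[h] - Q.[h]) by ring.
apply: le_trans (ler_normD _ _) _; rewrite mulrDl; apply: lerD.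
  apply: le_trans (fr y yr Dy) _; rewrite ler_pM2l//.
  (* At [y = x] the powers are [0 ^ g] and [0 ^ g'], each equal to 1 for the exponent 0 and to 0
     otherwise. *)
  have := normr_ge0 h; rewrite le_eqVlt => /predU1P[<-|h0].
    rewrite /powR eqxx ler_nat; have [/eqP g0|//] := boolP (g == 0).
    by have -> : g' == 0 by lra.
  by apply: ger_powR => //; rewrite h0 ltW.
rewrite -[P in P.[_] - _](poly_take_drop n) hornerD addrAC subrr add0r.
rewrite hornerM hornerXn normrM.
have hn : `|h ^+ n| <= `|h| `^ g'.
  by rewrite normrX; apply: expr_le_powR => //; apply/ltW/truncnS_gt.
apply: ler_pM => //; rewrite horner_coef; apply: le_trans (ler_norm_sum _ _ _) _.
apply: le_trans (_ : \sum_(i < size (drop_poly n P)) `|P`_(i + n)| <= _).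
  apply: ler_sum => i _; rewrite coef_drop_poly normrM ler_piMr// normrX exprn_ile1//.
  by case/andP: hle.
rewrite size_drop_poly; have [Pn|nP] := leqP (size P) n.
  by move: Pn; rewrite -subn_eq0 => /eqP ->; rewrite big_ord0.
rewrite /B -(big_mkord xpredT (fun i => `|P`_i|)) (big_cat_nat _ (ltnW nP))//=.
have -> : \sum_(n <= i < size P) `|P`_i| = \sum_(i < size P - n) `|P`_(i + n)|.
  by rewrite -{1}(add0n n) big_addn big_mkord.
by rewrite lerDr sumr_ge0.
Qed.

Lemma pointwise_holderD D f f' g x : pointwise_holder D f g x ->
  pointwise_holder D f' g x -> pointwise_holder D (fun y => f y + f' y) g x.
Proof.
move=> [P [C [sP C0 fP]]] [P' [C' [sP' C0' fP']]].
exists (P + P'), (C + C'); split; rewrite ?addr_gt0//.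
  by rewrite (leq_trans (size_polyD _ _))// geq_max sP.
near=> y => Dy; rewrite hornerD mulrDl.
have -> : f y + f' y - (P.[y - x] + P'.[y - x]) =
   (f y - P.[y - x]) + (f' y - P'.[y - x]) by ring.
apply: le_trans (ler_normD _ _) _; apply: lerD; move: Dy; near: y => //.
Unshelve. all: by end_near. Qed.

Lemma pointwise_holderZ D f g x c :
  pointwise_holder D f g x -> pointwise_holder D (fun y => c * f y) g x.
Proof.
move=> [P [C [sP C0 fP]]].
exists (c *: P), (`|c| * C + 1); split; rewrite ?ltr_pwDr ?mulr_ge0 ?(ltW C0)//.
  by rewrite (leq_trans (size_scale_leq _ _)).
near=> y => Dy; rewrite hornerZ -mulrBr normrM.
apply: le_trans (_ : `|c| * (C * `|y - x| `^ g) <= _).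
  by apply: ler_wpM2l => //; move: Dy; near: y.
by rewrite mulrA ler_wpM2r ?powR_ge0// lerDl.
Unshelve. all: by end_near. Qed.

Lemma pointwise_holderB D f f' g x : pointwise_holder D f g x ->
  pointwise_holder D f' g x -> pointwise_holder D (fun y => f y - f' y) g x.
Proof.
move=> ff /(pointwise_holderZ _ _ _ _ (-1)) ff'.
have := pointwise_holderD _ _ _ _ _ ff ff'.
by congr pointwise_holder; apply/funext => y; rewrite mulN1r.
Qed.

Lemma pointwise_holder_cst D g x c : pointwise_holder D (fun=> c) g x.
Proof.
exists c%:P, 1; split; rewrite ?(leq_trans (size_polyC_leq1 _))//.
by near=> y => _; rewrite hornerC subrr normr0 mul1r powR_ge0.
Unshelve. all: by end_near. Qed.

Lemma pointwise_holder_sum D (f : nat -> R -> R) g x N :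
  (forall i, (i < N)%N -> pointwise_holder D (f i) g x) ->
  pointwise_holder D (fun y => \sum_(i < N) f i y) g x.
Proof.
elim: N => [|N IH] fN.
  have -> : (fun y => \sum_(i < 0) f i y) = fun=> 0 :> R.
    by apply/funext => y; rewrite big_ord0.
  exact: pointwise_holder_cst.
have -> : (fun y => \sum_(i < N.+1) f i y) = fun y => \sum_(i < N) f i y + f N y.
  by apply/funext => y; rewrite big_ord_recr.
apply: pointwise_holderD; last exact: fN.
by apply: IH => i iN; apply: fN; apply: ltnW.
Qed.

Lemma pointwise_holder_near D f f' g x r : 0 < r ->
  (forall y, `|y - x| < r -> f y = f' y) ->
  pointwise_holder D f g x -> pointwise_holder D f' g x.
Proof.
move=> r0 ff [P [C [sP C0 fP]]]; exists P, C; split=> //.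
have nf : \forall y \near x, f y = f' y by apply/near_normP; exists r.
near=> y => Dy; have <- : f y = f' y by near: y.
by move: Dy; near: y.
Unshelve. all: by end_near. Qed.

Lemma uniform_holder_pointwise D g C f a x :
  uniform_holder g C f a -> pointwise_holder D f g x.
Proof.
move=> fa; have C0 := uniform_holder_ge0 _ _ _ _ fa; have [_ h] := fa x.
exists (\poly_(i < (Num.truncn g).+1) a x i), (C + 1); split.
- exact: size_poly.
- exact: ltr_wpDl.
near=> y => _; rewrite horner_poly; apply: le_trans (h y) _.
by rewrite ler_wpM2r ?powR_ge0// lerDl.
Unshelve. all: by end_near. Qed.

Lemma pointwise_holder_bound D f g x C r : 0 < r ->
  (forall y, D y -> `|y - x| < r -> `|f y| <= C * `|y - x| `^ g) ->
  pointwise_holder D f g x.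
Proof.
move=> r0 fC; exists 0, (Num.max C 1); split; first by rewrite size_poly0.
  by rewrite lt_max ltr01 orbT.
apply/near_normP; exists r => // y yr Dy; rewrite horner0 subr0.
by apply: le_trans (fC y Dy yr) _; rewrite ler_wpM2r ?powR_ge0// le_max lexx.
Qed.

(** The difference of order [m] does not see the polynomial [P], so regularity [g] would force
    [c * t ^ b <= K * t ^ g] for arbitrarily small [t], which fails since [b < g]. *)
Lemma not_pointwise_holder_small D f g b x (m : nat) L c :
  0 <= b < g -> (Num.truncn g < m)%N -> 0 < c -> 0 < L ->
  (forall r, 0 < r -> exists t y, [/\ 0 < t <= r,
     forall i, (i <= m)%N -> D (y + i%:R * t) /\ `|y + i%:R * t - x| <= L * t &
     c * t `^ b <= `|fdiff m t f y|]) ->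
  ~ pointwise_holder D f g x.
Proof.
move=> /andP[b0 bg] gm c0 L0 irr [P [C [sP C0 /near_normP[r r0 fP]]]].
have g0 : 0 <= g by rewrite ltW// (le_lt_trans b0).
pose K := 2 ^+ m * (C * L `^ g); have K0 : 0 < K.
  by rewrite /K !mulr_gt0// ?exprn_gt0 ?powR_gt0.
have gb0 : 0 < g - b by lra.
(* For [t <= s] one has [K * t ^ (g - b) <= c / 2]. *)
pose s := (c / (2 * K)) `^ (g - b)^-1.
have s0 : 0 < s by apply: powR_gt0; apply: divr_gt0 => //; exact: mulr_gt0.
have rs0 : 0 < Num.min (r / (2 * L)) s.
  by rewrite lt_min s0 andbT; apply: divr_gt0 => //; exact: mulr_gt0.
have [t [y [/andP[t0 tr] st fd]]] := irr _ rs0.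
move: tr; rewrite le_min => /andP[tr ts].
have : `|fdiff m t f y| <= 2 ^+ m * (C * (L * t) `^ g).
  have -> : fdiff m t f y = fdiff m t (fun z => f z - P.[z - x]) y.
    by rewrite fdiffB fdiff_poly ?subr0//; apply: leq_trans sP gm.
  apply: fdiff_bound => i im; have [Di yi] := st i im.
  apply: le_trans (fP _ _ Di) _.
    apply: le_lt_trans yi _; apply: le_lt_trans (_ : L * (r / (2 * L)) < _).
      by rewrite ler_pM2l.
    have -> : L * (r / (2 * L)) = r / 2 by field; rewrite gt_eqF.
    by lra.
  by rewrite ler_pM2l// ge0_ler_powR ?nnegrE ?mulr_ge0 ?(ltW L0) ?(ltW t0).
move/(le_trans fd); rewrite powRM ?(ltW L0) ?(ltW t0)// => bad.
have tg : t `^ g = t `^ b * t `^ (g - b).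
  by rewrite -powRD_gt0// addrC subrK.
have tgb : t `^ (g - b) <= c / (2 * K).
  apply: le_trans (_ : s `^ (g - b) <= _).
    by rewrite ge0_ler_powR ?nnegrE ?(ltW t0) ?(ltW s0) ?(ltW gb0).
  have cK : 0 <= c / (2 * K) by rewrite divr_ge0 ?(ltW c0)// mulr_ge0// ltW.
  by rewrite /s -powRrM mulVf ?gt_eqF// powRr1.
have bd := bad; move: bd; have -> : 2 ^+ m * (C * (L `^ g * t `^ g)) = t `^ b * (K * t `^ (g - b)).
  by rewrite tg /K; ring.
rewrite [c * _]mulrC ler_pM2l ?powR_gt0//; apply/negP; rewrite -ltNge.
apply: le_lt_trans (_ : K * (c / (2 * K)) < _); first by rewrite ler_pM2l.
have -> : K * (c / (2 * K)) = c / 2 by field; rewrite gt_eqF.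
by lra.
Qed.

(* Finite differences of order [m] detect a lack of regularity [b < m]; larger
   exponents are excluded by truncating the Taylor polynomial. *)
Lemma not_pointwise_holder D f g b x (m : nat) L c :
  0 <= b < g -> (Num.truncn b < m)%N -> 0 < c -> 0 < L ->
  (forall r, 0 < r -> exists t y, [/\ 0 < t <= r,
     forall i, (i <= m)%N -> D (y + i%:R * t) /\ `|y + i%:R * t - x| <= L * t &
     c * t `^ b <= `|fdiff m t f y|]) ->
  ~ pointwise_holder D f g x.
Proof.
move=> /andP[b0 bg] bm c0 L0 irr fg.
have /andP[tb1 tb2] := truncn_itv b0.
pose g' := Num.min g ((b + (Num.truncn b).+1%:R) / 2).
have bg' : b < g' by rewrite lt_min bg; lra.
have g'u : g' < (Num.truncn b).+1%:R by rewrite gt_min; apply/orP; right; lra.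
apply: (@not_pointwise_holder_small D f g' b x m L c) => //.
- by rewrite b0.
- apply: leq_ltn_trans bm; rewrite -ltnS truncn_lt_nat//.
  by rewrite (le_trans b0)// ltW.
- apply: pointwise_holder_le fg; rewrite ge_min lexx andbT.
  by rewrite (le_trans b0)// ltW.
Qed.

Lemma holder_exponent_ge D f h x : 0 <= h ->
  (forall g, 0 <= g < h -> pointwise_holder D f g x) -> 0 < h ->
  (h%:E <= holder_exponent D f x)%E.
Proof.
move=> h0 fh hp; apply/lee_subgt0Pr => e e0.
pose g := Num.max (h - e) (h / 2).
apply: le_trans (_ : g%:E <= _)%E; first by rewrite -EFinB lee_fin le_max lexx.
apply: ereal_sup_ubound; exists g => //=; split.
  by rewrite le_max; apply/orP; right; lra.
apply: fh; rewrite le_max gt_max; apply/andP; split; first by apply/orP; right; lra.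
by apply/andP; split; lra.
Qed.

Lemma holder_exponent_le D f h x :
  (forall g, h < g -> ~ pointwise_holder D f g x) ->
  (holder_exponent D f x <= h%:E)%E.
Proof.
move=> fh; apply: ge_ereal_sup => _ [g [g0 fg] <-]; rewrite lee_fin leNgt.
by apply/negP => /fh.
Qed.

Lemma holder_exponent_eq D f h x : 0 < h ->
  (forall g, 0 <= g < h -> pointwise_holder D f g x) ->
  (forall g, h < g -> ~ pointwise_holder D f g x) ->
  holder_exponent D f x = h%:E.
Proof.
move=> h0 h1 h2; apply/eqP; rewrite eq_le holder_exponent_le//=.
by rewrite holder_exponent_ge// ltW.
Qed.

Lemma holder_exponent_affine D f x c k : k != 0 ->
  holder_exponent D (fun y => c + k * f y) x = holder_exponent D f x.
Proof.
move=> k0; congr ereal_sup; congr image; apply/funext => g; apply/propext.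
split=> -[g0 fg]; split=> //; last first.
  by apply: pointwise_holderD; [exact: pointwise_holder_cst|exact: pointwise_holderZ].
have := pointwise_holderZ _ _ _ _ k^-1 (pointwise_holderB _ _ _ _ _ fg
  (pointwise_holder_cst D g x c)).
by congr pointwise_holder; apply/funext => y; field.
Qed.

Lemma uniform_holder_continuous g C f a : 0 < g ->
  uniform_holder g C f a -> continuous f.
Proof.
move=> g0 fa x; have [_ h] := fa x.
pose P := \poly_(i < (Num.truncn g).+1) a x i.
have {}h y : `|f y - P.[y - x]| <= C * `|y - x| `^ g by rewrite horner_poly.
have fx : f x = P.[0].
  have := h x; rewrite subrr normr0 powR0 ?gt_eqF// mulr0 normr_le0 subr_eq0.
  by move=> /eqP.
have cP : P.[y - x] @[y --> x] --> P.[0].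
  rewrite -[0](subrr x); apply: (continuous_comp (f := fun y => y - x) (g := horner P)).
    by apply: cvgB; [exact: cvg_id|exact: cvg_cst].
  exact: continuous_horner.
have cE : (f y - P.[y - x]) @[y --> x] --> (0 : R).
  apply/cvgrPdist_lt => e e0; have C0 := uniform_holder_ge0 _ _ _ _ fa.
  have K0 : 0 < e / (C + 1) by rewrite divr_gt0// ltr_wpDl.
  apply/near_normP; exists ((e / (C + 1)) `^ g^-1); first exact: powR_gt0.
  move=> y yr; rewrite sub0r normrN; apply: le_lt_trans (h y) _.
  apply: le_lt_trans (_ : C * (e / (C + 1)) < e); last first.
    by rewrite mulrCA gtr_pMr// ltr_pdivrMr; lra.
  rewrite ler_wpM2l//; apply: le_trans (_ : ((e / (C + 1)) `^ g^-1) `^ g <= _).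
    by rewrite ge0_ler_powR ?nnegrE ?(ltW g0) ?powR_ge0// ltW.
  by rewrite -powRrM mulVf ?gt_eqF// powRr1// ltW.
rewrite /continuous_at fx -[X in _ --> X]add0r.
rewrite (_ : f = fun y => (f y - P.[y - x]) + P.[y - x]); last first.
  by apply/funext => y; rewrite subrK.
exact: cvgD.
Unshelve. all: by end_near. Qed.

End PointwiseHolder.

(** * Hausdorff null sets and dimension *)

Section HausdorffNull.
Context {R : realType}.
Implicit Types (s c C : R) (A B E : set R) (U V : nat -> set R).

Definition hausdorff_null s A : Prop := hausdorff_measure s A = 0%E.

Lemma ediam_le A (d : R) : (forall x y, A x -> A y -> `|x - y| <= d) ->
  (ediam A <= d%:E)%E.
Proof.
by move=> Ad; apply: ge_ereal_sup => _ [x Ax [y Ay <-]]; rewrite lee_fin; exact: Ad.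
Qed.

Lemma ediam_ge A x y : A x -> A y -> (`|x - y|%:E <= ediam A)%E.
Proof. by move=> Ax Ay; apply: ereal_sup_ubound; exists x => //; exists y. Qed.

Lemma ediam_fin A (d : R) : A !=set0 -> (ediam A <= d%:E)%E ->
  exists2 r, 0 <= r <= d & ediam A = r%:E.
Proof.
move=> [x Ax] Ad; have := ediam_ge _ _ _ Ax Ax; rewrite subrr normr0.
move: Ad; case: (ediam A) => [r| |]//.
by rewrite !lee_fin => rd r0; exists r; rewrite ?r0.
Qed.

Lemma hausdorff_weight_ge0 s A : (0 <= hausdorff_weight s A)%E.
Proof. by rewrite /hausdorff_weight; case: ifP => // _; exact: poweR_ge0. Qed.

Lemma hausdorff_weight_le s A (d : R) : 0 <= s -> 0 <= d -> (ediam A <= d%:E)%E ->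
  (hausdorff_weight s A <= (d `^ s)%:E)%E.
Proof.
move=> s0 d0 Ad; rewrite /hausdorff_weight; case: ifPn => [_|/set0P An0].
  by rewrite lee_fin powR_ge0.
have [r /andP[r0 rd] ->] := ediam_fin _ _ An0 Ad.
by rewrite lee_fin ge0_ler_powR ?nnegrE.
Qed.

Lemma hausdorff_nullP s A : hausdorff_null s A <->
  forall d e : R, 0 < d -> 0 < e -> exists2 U, delta_cover d A U &
    (\sum_(0 <= k <oo) hausdorff_weight s (U k) <= e%:E)%E.
Proof.
split=> [A0 d e d0 e0|H].
  have : (hausdorff_premeasure s d A < e%:E)%E.
    apply: le_lt_trans (_ : 0 < e%:E)%E; last by rewrite lte_fin.
    by rewrite -A0; apply: ereal_sup_ubound; exists d.
  by move=> /ereal_inf_lt[_ [U cU <-]] /ltW ?; exists U.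
apply/eqP; rewrite eq_le; apply/andP; split.
  apply: ge_ereal_sup => _ [d /= d0 <-].
  apply/lee_addgt0Pr => e e0; rewrite add0e; have [U cU Ue] := H _ _ d0 e0.
  by apply: le_trans Ue; apply: ereal_inf_lbound; exists U.
apply: le_trans (_ : hausdorff_premeasure s 1 A <= _)%E; last first.
  by apply: ereal_sup_ubound; exists 1 => //=; exact: ltr01.
apply: le_ereal_inf_tmp => _ [U _ <-]; apply: nneseries_ge0 => n _ _.
exact: hausdorff_weight_ge0.
Qed.

Lemma hausdorff_null_sub s A B : A `<=` B -> hausdorff_null s B -> hausdorff_null s A.
Proof.
move=> AB /hausdorff_nullP B0; apply/hausdorff_nullP => d e d0 e0.
have [U [BU Ud] Ue] := B0 _ _ d0 e0; exists U => //; split=> //.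
exact: subset_trans BU.
Qed.

(** One tolerance [e] bounds both the diameters and the sum. The numbers [d k] stand in for the
    diameters, so a finite cover can be padded with empty sets and [d k = 0], whose power is 0 as
    [s > 0]. *)
Lemma hausdorff_null_cover s A : 0 < s ->
  (forall e : R, 0 < e -> exists U (d : nat -> R), [/\ A `<=` \bigcup_k U k,
     forall k, 0 <= d k <= e, forall k, (ediam (U k) <= (d k)%:E)%E &
     forall n, \sum_(0 <= k < n) d k `^ s <= e]) ->
  hausdorff_null s A.
Proof.
move=> s0 H; apply/hausdorff_nullP => d e d0 e0.
have m0 : 0 < Num.min d e by rewrite lt_min d0.
have [U [r [AU rm Ur re]]] := H _ m0; exists U.
  split=> // k; apply: le_trans (Ur k) _; rewrite lee_fin.
  by have /andP[_] := rm k; rewrite le_min => /andP[].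
have w0 k : (0 <= hausdorff_weight s (U k))%E by exact: hausdorff_weight_ge0.
apply: lime_le; first by apply: is_cvg_nneseries => n _ _.
apply: nearW => n; apply: le_trans (_ : (\sum_(0 <= k < n) (r k `^ s)%:E <= _)%E).
  apply: lee_sum => k _; apply: hausdorff_weight_le => //; first exact: ltW.
  by have /andP[] := rm k.
by rewrite sumEFin lee_fin; apply: le_trans (re n) _; rewrite ge_min lexx orbT.
Qed.

(** The cover of [A n] gets the budget [e / 2 ^ n.+1]; a bijection between [nat] and [nat * nat]
    turns the double family into one cover. *)
Lemma hausdorff_null_bigcup s (A : nat -> set R) :
  (forall n, hausdorff_null s (A n)) -> hausdorff_null s (\bigcup_n A n).
Proof.
move=> A0; apply/hausdorff_nullP => d e d0 e0.
have en0 n : 0 < e / (2 ^ n.+1)%:R by rewrite divr_gt0// ltr0n expn_gt0.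
have /choice[U HU] : forall n, exists U, delta_cover d (A n) U /\
    (\sum_(0 <= k <oo) hausdorff_weight s (U k) <= (e / (2 ^ n.+1)%:R)%:E)%E.
  by move=> n; have /hausdorff_nullP/(_ d _ d0 (en0 n))[U cU Ue] := A0 n; exists U.
have : ([set: nat] #= [set: nat * nat])%card by rewrite card_eq_sym; exact: card_nat2.
move=> /card_set_bijP[b bb].
pose V k := U (b k).1 (b k).2; exists V.
  split=> [x [n _]|k]; last by have [[_ Ud] _] := HU (b k).1; exact: Ud.
  have [[AU _] _] := HU n => /AU[m _ Ux].
  have [k _ bk] : exists2 k, [set: nat] k & b k = (n, m) by have [_ _ /(_ (n, m) I)] := bb.
  by exists k => //; rewrite /V bk.
have w0 n m : (0 <= hausdorff_weight s (U n m))%E by exact: hausdorff_weight_ge0.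
rewrite nneseries_esum; last by move=> n _; exact: w0.
have -> : [set x : nat | true] = [set: nat] by apply/seteqP; split.
rewrite /V -(reindex_esum _ _ _ (fun k => hausdorff_weight s (U k.1 k.2)) bb).
have -> : [set: nat * nat] = [set: nat] `*`` (fun=> [set: nat]) by apply/seteqP; split.
rewrite -(esum_esum (a := fun n m => hausdorff_weight s (U n m)));
  last by move=> *; exact: w0.
apply: le_trans (epsilon_trick0 xpredT (ltW e0)).
rewrite nneseries_esum; last by move=> n _; rewrite lee_fin ltW.
have -> : [set x : nat | xpredT x] = [set: nat] by apply/seteqP; split.
apply: le_esum => n _.
have := (HU n).2; rewrite nneseries_esum; last by move=> m _; exact: w0.
by have -> : [set x : nat | true] = [set: nat] by apply/seteqP; split.
Qed.

Lemma hausdorff_null0 s : 0 < s -> hausdorff_null s set0.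
Proof.
move=> s0; apply: hausdorff_null_cover => // e e0; exists (fun=> set0), (fun=> 0).
split => // [_|_|n]; first by rewrite lexx ltW.
  by apply: ediam_le => x y.
by rewrite big1 ?ltW// => i _; rewrite powR0// gt_eqF.
Qed.

Lemma hausdorff_nullU s A B : 0 < s ->
  hausdorff_null s A -> hausdorff_null s B -> hausdorff_null s (A `|` B).
Proof.
move=> s0 A0 B0; rewrite -bigcup2E; apply: hausdorff_null_bigcup => -[|[|n]] //=.
exact: hausdorff_null0.
Qed.

(* The inverse of the parametrization [x] maps a cover of [E] to intervals whose
   lengths are the weights of the cover. *)
Lemma hausdorff_null_negligible s C E (T : set R) (x : R -> R) : 0 <= s ->
  hausdorff_null s E ->
  (forall t, T t -> E (x t)) ->
  (forall t t', T t -> T t' -> `|t - t'| <= C * `|x t - x t'| `^ s) ->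
  (@lebesgue_measure R).-negligible T.
Proof.
move=> s0 /hausdorff_nullP E0 TE xC.
wlog C0 : C xC / 0 < C => [wl|].
  apply: (wl (Num.max C 1)); last by rewrite lt_max ltr01 orbT.
  move=> t t' Tt Tt'; apply: le_trans (xC _ _ Tt Tt') _.
  by rewrite ler_wpM2r ?powR_ge0// le_max lexx.
(* [T] need not be measurable, so it is enclosed in measurable sets of arbitrarily small measure. *)
have key (e : R) : 0 < e -> exists B, [/\ measurable B, T `<=` B &
    (lebesgue_measure B <= e%:E)%E].
  move=> e0; have e'0 : 0 < e / (2 * C) by rewrite divr_gt0// mulr_gt0.
  have [U [EU Ud] Ue] := E0 1 _ ltr01 e'0.
  have /choice[I hI] : forall k, exists I, [/\ measurable I,
      (fun t => T t /\ U k (x t)) `<=` I &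
      (lebesgue_measure I <= (2 * C)%:E * hausdorff_weight s (U k))%E].
    (* The interval is centred at any parameter whose image lies in [U k]; without one, the empty
       set will do. *)
    move=> k; have [[t [Tt Ut]]|nt] := pselect (exists t, T t /\ U k (x t)); last first.
      exists set0; split=> //; first by move=> t Ht; apply: nt; exists t.
      by rewrite measure0 mule_ge0 ?hausdorff_weight_ge0// lee_fin mulr_ge0// ltW.
    have Un0 : U k !=set0 by exists (x t).
    have [r /andP[r0 r1] Ur] := ediam_fin _ _ Un0 (Ud k).
    exists `[t - C * r `^ s, t + C * r `^ s]%classic; split=> //.
      move=> t' [Tt' Ut']; rewrite /= in_itv/= -ler_distl.
      apply: le_trans (xC _ _ Tt' Tt) _; rewrite ler_pM2l//.
      rewrite ge0_ler_powR ?nnegrE//.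
      by have := ediam_ge _ _ _ Ut' Ut; rewrite Ur lee_fin.
    rewrite lebesgue_measure_itv /hausdorff_weight; have /set0P/negbTE -> := Un0.
    rewrite Ur poweR_EFin -EFinM /= -EFinB; case: ifP => _; rewrite lee_fin.
      by rewrite le_eqVlt; apply/orP; left; apply/eqP; ring.
    by rewrite !mulr_ge0// ?powR_ge0// ltW.
  have mI : measurable (\bigcup_k I k).
    by apply: bigcup_measurable => k _; have [] := hI k.
  exists (\bigcup_k I k); split=> //.
    move=> t Tt; have [k _ Uk] := EU _ (TE _ Tt).
    by exists k => //; have [_ sI _] := hI k; exact: sI.
  have mIk k : measurable (I k) by have [] := hI k.
  apply: le_trans (measure_sigma_subadditive lebesgue_measure mIk mI (@subset_refl _ _)) _.
  apply: le_trans (_ : \sum_(0 <= k <oo) (2 * C)%:E * hausdorff_weight s (U k) <= _)%E.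
    by apply: lee_nneseries => [k _ _|k _]; [exact: measure_ge0|have [_ _] := hI k].
  rewrite nneseriesZl; last by move=> k _; exact: hausdorff_weight_ge0.
  apply: le_trans (_ : (2 * C)%:E * (e / (2 * C))%:E <= _)%E.
    by apply: lee_wpmul2l => //; rewrite lee_fin mulr_ge0// ltW.
  by rewrite -EFinM lee_fin mulrC divfK// gt_eqF// mulr_gt0.
have /choice[B hB] : forall n : nat, exists B, [/\ measurable B, T `<=` B &
    (lebesgue_measure B <= (n.+1%:R^-1)%:E)%E].
  by move=> n; apply: key; rewrite invr_gt0.
have mB : measurable (\bigcap_n B n) by apply: bigcapT_measurable => n; have [] := hB n.
exists (\bigcap_n B n); split=> //; last by move=> t Tt n _; have [_ sB _] := hB n; exact: sB.
apply/eqP; rewrite eq_le measure_ge0 andbT; apply/lee_addgt0Pr => e e0; rewrite add0e.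
have [n ne] : exists n : nat, n.+1%:R^-1 < e.
  exists (Num.truncn e^-1); rewrite invf_plt ?posrE//; exact: truncnS_gt.
have [mBn _ Bn] := hB n; apply: le_trans (_ : lebesgue_measure (B n) <= _)%E.
  by apply: le_measure; rewrite ?inE//; exact: bigcap_inf.
by apply: le_trans Bn _; rewrite lee_fin ltW.
Qed.

Lemma itv_not_negligible (a b : R) : a < b ->
  ~ (@lebesgue_measure R).-negligible `[a, b].
Proof.
move=> ab N0; have : lebesgue_measure (`[a, b]%classic : set R) = 0%E.
  by apply: (measure_negligible _ N0); exact: measurable_itv.
rewrite lebesgue_measure_itv /= lte_fin ab -EFinB => -[] /eqP.
by rewrite subr_eq0 gt_eqF.
Qed.

Lemma hausdorff_dim_ge c A : A !=set0 ->
  (forall s, 0 <= s < c -> ~ hausdorff_null s A) -> (c%:E <= hausdorff_dim A)%E.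
Proof.
move=> /set0P/negbTE A0 Ac; rewrite /hausdorff_dim A0.
apply: le_ereal_inf_tmp => _ [s [s0 sA] <-]; rewrite lee_fin leNgt; apply/negP => sc.
by apply: (Ac s) => //; rewrite s0.
Qed.

Lemma hausdorff_dim_le c A : 0 <= c ->
  (forall s, c < s -> hausdorff_null s A) -> (hausdorff_dim A <= c%:E)%E.
Proof.
move=> c0 Ac; rewrite /hausdorff_dim; case: ifP => _.
  exact: leNye.
apply/lee_addgt0Pr => e e0; apply: ereal_inf_lbound; exists (c + e) => //=.
by split; [rewrite addr_ge0// ltW|apply: Ac; rewrite ltrDl].
Qed.

Lemma hausdorff_dim_set0 : hausdorff_dim (@set0 R) = -oo%E.
Proof. by rewrite /hausdorff_dim eqxx. Qed.

End HausdorffNull.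

(** * Binary digits *)

Section Digits.
Context {R : realType}.
Implicit Types (x t th : R).

Lemma nested_point (u e : nat -> R) :
  (forall k k', (k <= k')%N -> u k <= u k' <= u k + e k) ->
  exists x, forall k, u k <= x <= u k + e k.
Proof.
move=> H; exists (sup (range u)) => k.
have ub : has_sup (range u).
  split; first by exists (u 0%N); exists 0%N.
  by exists (u 0%N + e 0%N) => _ [n _ <-]; have /andP[] := H 0%N n (leq0n n).
apply/andP; split; first by apply: ub_le_sup; [exact: ub.2|exists k].
apply: ge_sup; first exact: ub.1.
move=> _ [n _ <-]; have [kn|/ltnW nk] := leqP k n; first by have /andP[] := H _ _ kn.
have /andP[h1 _] := H _ _ nk; have /andP[h2 h3] := H _ _ (leqnn k).
by apply: le_trans h1 h3.
Qed.

Definition dyadic_sum (c : nat -> bool) k : R :=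
  \sum_(j < k) (c j)%:R * 2^-1 ^+ j.+1.

Lemma dyadic_sumS c k :
  dyadic_sum c k.+1 = dyadic_sum c k + (c k)%:R * 2^-1 ^+ k.+1.
Proof. by rewrite /dyadic_sum big_ord_recr. Qed.

Lemma dyadic_sum_mono c k k' : (k <= k')%N ->
  dyadic_sum c k <= dyadic_sum c k' <= dyadic_sum c k + (2^-1 ^+ k - 2^-1 ^+ k').
Proof.
move=> kk'; rewrite -(subnK kk'); elim: (k' - k)%N => [|n IH].
  by rewrite add0n subrr addr0 lexx.
rewrite addSn dyadic_sumS exprS; move: IH.
have p0 : 0 <= 2^-1 ^+ (n + k) :> R by rewrite exprn_ge0// invr_ge0.
by case: (c _); rewrite ?mul1r ?mul0r; lra.
Qed.

Lemma dyadic_sum_itv c k : 0 <= dyadic_sum c k <= 1.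
Proof.
have := dyadic_sum_mono c 0 k (leq0n k).
have -> : dyadic_sum c 0 = 0 by rewrite /dyadic_sum big_ord0.
rewrite expr0; have : 0 <= 2^-1 ^+ k :> R by rewrite exprn_ge0// invr_ge0.
by lra.
Qed.

(* Greedy binary digits: unlike those of the floor function they also expand [1]. *)
Fixpoint greedy th k : R := if k is j.+1 then
  if greedy th j + 2^-1 ^+ j.+1 <= th then greedy th j + 2^-1 ^+ j.+1
  else greedy th j else 0.

Definition bit th k : bool := greedy th k + 2^-1 ^+ k.+1 <= th.

Lemma dyadic_sum_bit th k : dyadic_sum (bit th) k = greedy th k.
Proof.
elim: k => [|k IH]; first by rewrite /dyadic_sum big_ord0.
by rewrite dyadic_sumS IH /= /bit; case: ifP; rewrite ?mul1r ?mul0r ?addr0.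
Qed.

Lemma greedy_bound th k : 0 <= th <= 1 ->
  greedy th k <= th <= greedy th k + 2^-1 ^+ k.
Proof.
move=> th01; elim: k => [|k IH] /=; first by rewrite expr0 add0r.
have e : 2^-1 ^+ k = 2^-1 ^+ k.+1 + 2^-1 ^+ k.+1 :> R by rewrite exprS; field.
case: ifP => h; first by rewrite h -addrA -e; case/andP: IH.
by move: h => /negbT; rewrite -ltNge; case/andP: IH => -> _ /ltW.
Qed.

Lemma bits_close t t' k : 0 <= t <= 1 -> 0 <= t' <= 1 ->
  (forall j, (j < k)%N -> bit t j = bit t' j) -> `|t - t'| <= 2^-1 ^+ k.
Proof.
move=> t01 t'01 tt'; have := greedy_bound t k t01; have := greedy_bound t' k t'01.
have -> : greedy t k = greedy t' k.
  by rewrite -!dyadic_sum_bit; apply: eq_bigr => j _; rewrite tt'.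
by rewrite ler_norml => /andP[h1 h2] /andP[h3 h4]; apply/andP; split; lra.
Qed.

(* [code_count p] is the number of powers of two below [p]; the digits of rank a
   power of two encode the exponent, a set of digits of density zero. *)
Fixpoint code_count p : nat := if p is i.+1 then
  (code_count i + (i == 2 ^ code_count i))%N else 0%N.

Definition is_code p : bool := p == (2 ^ code_count p)%N.

Definition free_rank p : nat := (p - code_count p)%N.

(** The invariant says that [2 ^ code_count p] is the first power of two not below [p], which is why
    the equality test in the recursion detects every power of two. *)
Lemma code_countP p : (p <= 2 ^ code_count p)%N /\
  ((0 < p)%N -> (2 ^ code_count p < p.*2)%N) /\ (code_count p <= p)%N.
Proof.
elim: p => [//|p [h1 [h2 h3]]] /=; case: eqP => [e|ne].
  rewrite addn1 expnS -e; case: p h1 h2 h3 e => [|p] h1 h2 h3 e; first by [].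
  by split; [lia|split; [lia|lia]].
rewrite addn0; split; first by rewrite ltn_neqAle h1 andbT; apply/eqP.
split; last exact: leqW.
by move=> _; case: p h1 h2 h3 ne => [//|p] h1 h2 h3 ne; have := h2 isT; lia.
Qed.

Lemma code_count_pow k : code_count (2 ^ k) = k.
Proof.
have [h1 [h2 _]] := code_countP (2 ^ k).
have p0 : (0 < 2 ^ k)%N by rewrite expn_gt0.
move: h1 (h2 p0); rewrite leq_exp2l// -mul2n -expnS ltn_exp2l// ltnS => h h'.
by apply/eqP; rewrite eqn_leq h h'.
Qed.

Lemma code_count_mono p p' : (p <= p')%N -> (code_count p <= code_count p')%N.
Proof.
move=> pp'; rewrite -(subnK pp'); elim: (p' - p)%N => //= n IH.
exact: leq_trans IH (leq_addr _ _).
Qed.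

Lemma code_count_lt k p : (k < code_count p)%N -> (2 ^ k < p)%N.
Proof.
move=> kp; rewrite ltnNge; apply/negP => /code_count_mono.
by rewrite code_count_pow leqNgt kp.
Qed.

Lemma is_code_pow k : is_code (2 ^ k)%N.
Proof. by rewrite /is_code code_count_pow. Qed.

Lemma free_rankS p : free_rank p.+1 = (free_rank p + ~~ is_code p)%N.
Proof.
have [_ [_ h]] := code_countP p; rewrite /free_rank /is_code /=.
by case: eqP => _ /=; lia.
Qed.

Lemma free_rank_surj p r : (r < free_rank p)%N ->
  exists i, [/\ (i < p)%N, ~~ is_code i & free_rank i = r].
Proof.
elim: p => [//|p IH]; rewrite free_rankS.
have [lt _|ge] := ltnP r (free_rank p).
  by have [i [ip ni ri]] := IH lt; exists i; split => //; exact: leqW.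
case: (boolP (is_code p)) => np /=; first by rewrite addn0 ltnNge ge.
rewrite addn1 ltnS => le; exists p; split => //.
by apply/eqP; rewrite eqn_leq ge le.
Qed.

Lemma code_count_unbounded n : exists p, (n <= code_count p)%N.
Proof. by exists (2 ^ n)%N; rewrite code_count_pow. Qed.

Lemma free_rank_unbounded j : exists k, (j < free_rank k)%N.
Proof.
exists (2 ^ j.+2)%N; rewrite /free_rank code_count_pow ltn_subRL !expnS.
by move: (2 ^ j)%N (ltn_expl j (isT : (1 < 2)%N)) => x; lia.
Qed.

(** With [th] fixed, [t] in [[0, 1]] parametrizes points that share the same limit exponent. *)
Definition mixed_digits th t i : bool :=
  if is_code i then bit th (code_count i) else bit t (free_rank i).

Lemma mixed_digits_code th t k : mixed_digits th t (2 ^ k)%N = bit th k.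
Proof. by rewrite /mixed_digits is_code_pow code_count_pow. Qed.

Lemma mixed_digits_close th t t' p : 0 <= t <= 1 -> 0 <= t' <= 1 ->
  (forall i, (i < p)%N -> mixed_digits th t i = mixed_digits th t' i) ->
  `|t - t'| <= 2^-1 ^+ free_rank p.
Proof.
move=> t01 t'01 tt'; apply: bits_close => // r /free_rank_surj[i [ip ni <-]].
by have := tt' i ip; rewrite /mixed_digits (negbTE ni).
Qed.

Lemma geometric_small x e : 0 <= x < 1 -> 0 < e -> exists n, x ^+ n <= e.
Proof.
move=> /andP[x0 x1] e0.
have /cvgrPdist_lt/(_ _ e0)[n _ hn] : x ^+ n @[n --> \oo] --> 0.
  by apply: cvg_expr; rewrite ger0_norm.
exists n; have := hn n (leqnn n).
by rewrite sub0r normrN ger0_norm ?exprn_ge0// => /ltW.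
Qed.

(** Each of the [n.+1] terms of the geometric sum is at least [x ^+ n]. *)
Lemma geometric_poly_bound x n : 0 <= x < 1 -> n.+1%:R * x ^+ n <= (1 - x)^-1.
Proof.
move=> /andP[x0 x1]; have h : 0 < 1 - x by rewrite subr_gt0.
apply: le_trans (_ : \sum_(i < n.+1) x ^+ i <= _).
  rewrite -sumr_const_ord; apply: ler_sum => i _.
  by rewrite ler_wiXn2l ?(ltW x1)// -ltnS.
rewrite -[_^-1]mul1r ler_pdivlMr// mulrC -opprB mulNr -subrX1 opprB.
by rewrite lerBlDr lerDl exprn_ge0.
Qed.

Lemma powRX x s n : 0 <= x -> (x ^+ n) `^ s = (x `^ s) ^+ n.
Proof.
move=> x0; elim: n => [|n IH]; first by rewrite !expr0 powR1.
by rewrite !exprS powRM ?exprn_ge0// IH.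
Qed.

(** Reserving the ranks that are powers of two costs the factor [2 ^ code_count n], at most linear
    in [n]; a geometric gain absorbs it through [geometric_poly_bound]. *)
Lemma free_rank_bound n : 2^-1 ^+ free_rank n <= 2 * (n.+1%:R * 2^-1 ^+ n) :> R.
Proof.
have [_ [h2 h3]] := code_countP n; rewrite /free_rank.
have e : 2^-1 ^+ (n - code_count n) = (2 ^ code_count n)%:R * 2^-1 ^+ n :> R.
  have en : n = (n - code_count n + code_count n)%N by rewrite subnK.
  rewrite [X in _ = _ * 2^-1 ^+ X]en exprD mulrCA natrX -exprMn mulfV//.
  by rewrite expr1n mulr1.
rewrite e mulrA ler_wpM2r ?exprn_ge0 ?invr_ge0// -natrM ler_nat.
case: n h2 {h3 e} => [|n] h2; first by [].
by have := h2 isT; lia.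
Qed.

(* Lengths of the basic intervals of a Cantor set with two children per interval
   and dimension [c]; [c = 0] needs super-exponential decay. *)
Lemma cantor_lengths (c d : R) : 0 <= c < 1 -> 0 < d <= 1 ->
  exists (rho : R) (ell : nat -> R),
  [/\ 0 < rho < 2^-1, ell 0%N = d, forall l, 0 < ell l.+1 <= rho * ell l,
      forall s e, c < s -> 0 < e -> exists l, 2 ^+ l * ell l `^ s <= e /\ ell l <= e &
      forall s, 0 <= s < c -> exists2 C, 0 < C &
        forall p, 2^-1 ^+ free_rank p <= C * ell p `^ s].
Proof.
move=> /andP[c0 c1] /andP[d0 d1].
have [cz|cnz] := eqVneq c 0.
  (* The exponent is quadratic in [l], so [2 ^+ l * ell l ^ s] tends to 0 for every [s > 0]; the
     last condition is void for [c = 0]. *)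
  exists (4^-1), (fun l => d * 4^-1 ^+ (l * l)); split.
  - by lra.
  - by rewrite muln0 expr0 mulr1.
  - move=> l; rewrite mulr_gt0 ?exprn_gt0 ?invr_gt0//= mulrCA ler_pM2l//.
    rewrite -exprS ler_wiXn2l ?invr_ge0//; first lra.
    by rewrite mulSn mulnS; lia.
  - move=> s e; rewrite cz => s0 e0.
    have [n hn] := geometric_small (2^-1) e ltac:(lra) e0.
    pose l := (n + (Num.truncn s^-1).+1)%N.
    have ls : 1 <= l%:R * s.
      rewrite -ler_pdivrMr// mul1r; apply/ltW/(lt_le_trans (truncnS_gt _)).
      by rewrite ler_nat leq_addl.
    have le : 2^-1 ^+ l <= e :> R.
      by apply: le_trans hn; rewrite ler_wiXn2l ?leq_addr//; lra.
    have q0 : 0 <= 4^-1 :> R by lra.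
    exists l; split.
      apply: le_trans le; rewrite powRM ?exprn_ge0 ?(ltW d0)//.
      apply: le_trans (_ : 2 ^+ l * 4^-1 ^+ l <= _); last first.
        by rewrite -exprMn; apply: lerXn2r; rewrite ?nnegrE; lra.
      rewrite ler_wpM2l ?exprn_ge0//.
      apply: le_trans (_ : (4^-1 ^+ (l * l)) `^ s <= _).
        rewrite ler_piMl ?powR_ge0//; apply: le_trans (_ : 1 `^ s <= _).
          by rewrite ge0_ler_powR ?nnegrE ?(ltW s0) ?(ltW d0).
        by rewrite powR1.
      rewrite exprM powRX ?exprn_ge0// lerXn2r ?nnegrE ?powR_ge0//.
      rewrite -powR_mulrn// -powRrM -[leRHS]powRr1//.
      by apply: ger_powR => //; lra.
    apply: (@le_trans _ _ (4^-1 ^+ (l * l))).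
      by rewrite ler_piMl// exprn_ge0.
    apply: le_trans le; apply: (@le_trans _ _ (4^-1 ^+ l)).
      rewrite ler_wiXn2l//; first lra.
      by rewrite leq_pmull// /l addnS.
    by rewrite lerXn2r ?nnegrE//; lra.
  - by move=> s; rewrite cz => /andP[s0]; rewrite ltNge s0.
have cp : 0 < c by rewrite lt_def cnz.
(* The similarity ratio: [2 * rho ^ c = 1], and [c < 1] gives [rho < 1/2], so the two children are
   disjoint. *)
pose rho : R := 2^-1 `^ c^-1.
have h0 : 0 < 2^-1 :> R by lra.
have rho0 : 0 < rho by apply: powR_gt0.
have ci : 1 < c^-1 by rewrite invf_gt1.
have rhoc : rho `^ c = 2^-1 by rewrite /rho -powRrM mulVf// powRr1// ltW.
have rhoh : rho < 2^-1.
  rewrite -[X in _ < X](@powRr1 R)//.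
  rewrite /rho /powR gt_eqF// ltr_expR ltr_nM2r// ln_lt0// h0; lra.
have mono s s' : s < s' -> rho `^ s' < rho `^ s.
  move=> ss; rewrite /powR gt_eqF// ltr_expR ltr_nM2r// ln_lt0// rho0; lra.
have ellp l s : 0 <= s -> (d * rho ^+ l) `^ s = d `^ s * (rho `^ s) ^+ l.
  by move=> s0; rewrite powRM ?exprn_ge0 ?(ltW d0) ?(ltW rho0)// powRX// ltW.
exists rho, (fun l => d * rho ^+ l); split.
- by rewrite rho0.
- by rewrite expr0 mulr1.
- by move=> l; rewrite mulr_gt0 ?exprn_gt0//= exprS mulrCA.
- move=> s e cs e0; have s0 : 0 < s by apply: lt_trans cs.
  have u0 : 0 <= 2 * rho `^ s < 1.
    rewrite mulr_ge0 ?powR_ge0//=; have := mono _ _ cs; rewrite rhoc; lra.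
  have [n1 hn1] := geometric_small _ e u0 e0.
  have [n2 hn2] : exists n, rho ^+ n <= e.
    by apply: geometric_small => //; rewrite (ltW rho0); lra.
  exists (n1 + n2)%N; split.
    rewrite ellp ?(ltW s0)// mulrCA -exprMn.
    apply: le_trans (_ : 1 * (2 * rho `^ s) ^+ n1 <= _); last by rewrite mul1r.
    apply: ler_pM; rewrite ?powR_ge0 ?exprn_ge0//; first by case/andP: u0.
      apply: le_trans (_ : 1 `^ s <= _); last by rewrite powR1.
      by rewrite ge0_ler_powR ?nnegrE ?(ltW s0) ?(ltW d0).
    by case/andP: u0 => a1 a2; rewrite ler_wiXn2l ?leq_addr// ltW.
  apply: le_trans (_ : 1 * rho ^+ n2 <= _); last by rewrite mul1r.
  apply: ler_pM; rewrite ?(ltW d0) ?exprn_ge0 ?(ltW rho0)//.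
  by rewrite ler_wiXn2l ?leq_addl ?(ltW rho0)//; lra.
- move=> s /andP[s0 sc]; set u := rho `^ s.
  have u2 : 2^-1 < u by rewrite -rhoc; exact: mono.
  have up : 0 < u by lra.
  have ds0 : 0 < d `^ s by apply: powR_gt0.
  (* [s < c] gives [2 * rho ^ s > 1]; this surplus pays for the linear factor of
     [free_rank_bound]. *)
  have x01 : 0 <= (2 * u)^-1 < 1.
    by rewrite invr_ge0 mulr_ge0 ?(ltW up)//= invf_lt1; lra.
  have y0 : 0 < 1 - (2 * u)^-1 by case/andP: x01; lra.
  exists (2 * (1 - (2 * u)^-1)^-1 / d `^ s).
    by rewrite divr_gt0// mulr_gt0// invr_gt0.
  move=> p; apply: le_trans (free_rank_bound p) _.
  rewrite ellp// -/u [leRHS]mulrA divfK ?gt_eqF// -mulrA ler_pM2l//.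
  have -> : 2^-1 ^+ p = (2 * u)^-1 ^+ p * u ^+ p.
    by rewrite -exprMn; congr (_ ^+ p); field; rewrite gt_eqF.
  by rewrite mulrA ler_pM2r ?exprn_gt0//; exact: geometric_poly_bound.
Qed.

End Digits.

(** * Bumps on the gaps of a Cantor set *)

Section CantorBumps.
Context {R : realType} (m : nat) (beta A B q d eps rho : R) (ell : nat -> R).
Hypotheses (rho_itv : 0 < rho < 2^-1) (ell0 : ell 0%N = d) (d_itv : 0 < d <= 1)
  (ellS : forall l, 0 < ell l.+1 <= rho * ell l)
  (A0 : 0 <= A) (AB : A <= B) (beta0 : 0 <= beta) (eps0 : 0 < eps).
Implicit Types (w u p : seq bool) (x y : R) (b : bool) (l : nat).

Let rho0 : 0 < rho. Proof. by case/andP: rho_itv. Qed.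
Let rho_half : rho < 2^-1. Proof. by case/andP: rho_itv. Qed.

Lemma ell_gt0 l : 0 < ell l.
Proof. by case: l => [|l]; [rewrite ell0; case/andP: d_itv|case/andP: (ellS l)]. Qed.

Lemma ell_contract l : ell l.+1 <= rho * ell l.
Proof. by case/andP: (ellS l). Qed.

Lemma ell_mono l l' : (l <= l')%N -> ell l' <= ell l.
Proof.
have rp := rho0; have rh := rho_half.
move=> ll'; rewrite -(subnK ll'); elim: (l' - l)%N => // n IH.
apply: le_trans IH; rewrite addSn; apply: le_trans (ell_contract _) _.
by rewrite ler_piMl ?(ltW (ell_gt0 _))//; lra.
Qed.

Lemma ell_le1 l : ell l <= 1.
Proof. by apply: le_trans (ell_mono 0 l _) _ => //; rewrite ell0; case/andP: d_itv. Qed.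

(** The two children are flush with the ends of their parent, so a digit [true] at depth [i] moves
    the left end by [ell i - ell i.+1]. *)
Definition left_end w : R :=
  q + \sum_(i < size w) (nth false w i)%:R * (ell i - ell i.+1).

Definition cell w x : Prop := left_end w <= x <= left_end w + ell (size w).

Lemma left_end_rcons w b : left_end (rcons w b) =
  left_end w + b%:R * (ell (size w) - ell (size w).+1).
Proof.
rewrite /left_end size_rcons big_ord_recr /= addrA; congr (_ + _ + _).
  by apply: eq_bigr => i _; rewrite nth_rcons ltn_ord.
by rewrite nth_rcons ltnn eqxx.
Qed.

Lemma cell_rcons w b x : cell (rcons w b) x ->
  left_end w + b%:R * (ell (size w) - ell (size w).+1) <= x <=
  left_end w + b%:R * (ell (size w) - ell (size w).+1) + ell (size w).+1.
Proof. by rewrite /cell size_rcons left_end_rcons. Qed.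

Lemma cell_cat w u x : cell (w ++ u) x -> cell w x.
Proof.
elim/last_ind: u => [|u b IH]; first by rewrite cats0.
rewrite -rcons_cat => /cell_rcons h; apply: IH; rewrite /cell.
have := ell_mono _ _ (leqnSn (size (w ++ u))).
by move: h; case: b; rewrite ?mul1r ?mul0r; lra.
Qed.

Lemma words_cmp w w' : [\/ exists u, w' = w ++ u, exists u, w = w' ++ u |
  exists p b u u', w = p ++ b :: u /\ w' = p ++ ~~ b :: u'].
Proof.
elim: w w' => [|b w IH] [|b' w'].
- by constructor 1; exists [::].
- by constructor 1; exists (b' :: w').
- by constructor 2; exists (b :: w).
have [<-|ne] := eqVneq b b'; last first.
  constructor 3; exists [::], b, w, w'; split=> //=; congr (_ :: _).
  by case: b b' ne => -[].
have [[u ->]|[u ->]|[p [b1 [u [u' [-> ->]]]]]] := IH w'.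
- by constructor 1; exists u.
- by constructor 2; exists u.
- by constructor 3; exists (b :: p), b1, u, u'.
Qed.

Lemma cell_sep p b u u' x y : cell (p ++ b :: u) x -> cell (p ++ ~~ b :: u') y ->
  (1 - 2 * rho) * ell (size p) <= `|x - y|.
Proof.
have rp := rho0; have rh := rho_half.
rewrite -!cat_rcons => /cell_cat/cell_rcons hx /cell_cat/cell_rcons hy.
have h2 : rho * ell (size p) < 2^-1 * ell (size p) by rewrite ltr_pM2r ?ell_gt0.
have := ell_contract (size p).
case: b hx hy => /=; rewrite ?mul1r ?mul0r => hx hy h.
  by rewrite ger0_norm; lra.
by rewrite ler0_norm; lra.
Qed.

Lemma cell_disjoint p b u u' x :
  cell (p ++ b :: u) x -> cell (p ++ ~~ b :: u') x -> False.
Proof.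
move=> c c'; have := cell_sep _ _ _ _ _ _ c c'; rewrite subrr normr0.
have rh := rho_half; have r2 : 0 < 1 - 2 * rho by lra.
by rewrite leNgt mulr_gt0 ?ell_gt0.
Qed.

Definition gap w x : Prop :=
  left_end w + ell (size w).+1 < x < left_end w + ell (size w) - ell (size w).+1.

Lemma gap_cell w x : gap w x -> cell w x.
Proof. by rewrite /gap /cell; have := ell_gt0 (size w).+1; lra. Qed.

Lemma gap_child w b u x : gap w x -> ~ cell (w ++ b :: u) x.
Proof.
rewrite -cat_rcons => g /cell_cat/cell_rcons; move: g; rewrite /gap.
by case: b; rewrite ?mul1r ?mul0r; lra.
Qed.

Lemma gap_inj w w' x : gap w x -> gap w' x -> w = w'.
Proof.
have rp := rho0; have rh := rho_half.
move=> g g'; have [[[|b u] e]|[[|b u] e]|[p [b [u [u' [e e']]]]]] := words_cmp w w'.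
- by rewrite e cats0.
- by case: (gap_child w b u x g); rewrite -e; exact: gap_cell.
- by rewrite e cats0.
- by case: (gap_child w' b u x g'); rewrite -e; exact: gap_cell.
- have := gap_cell _ _ g; have := gap_cell _ _ g'; rewrite e e' => c' c.
  by case: (cell_disjoint _ _ _ _ _ c c').
Qed.

(** [m.+1] radii make up a quarter of [(1 - 2 * rho) * ell], a lower bound for the length of the
    gap: a stencil starting at the centre covers at most half of the right half of the gap and stays
    at least a radius away from the child. *)
Definition eta : R := (1 - 2 * rho) / (4 * m.+1%:R).

Lemma eta_itv : 0 < eta <= 1.
Proof.
have rp := rho0; have rh := rho_half.
have m1 : 1 <= m.+1%:R :> R by rewrite ler1n.
rewrite divr_gt0 ?mulr_gt0//=; last lra.
by rewrite ler_pdivrMr; lra.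
Qed.

Let eta0 : 0 < eta. Proof. by case/andP: eta_itv. Qed.
Let eta1 : eta <= 1. Proof. by case/andP: eta_itv. Qed.

Lemma eta_mul : m.+1%:R * eta = (1 - 2 * rho) / 4.
Proof. by rewrite /eta; field; rewrite nat1r pnatr_eq0. Qed.

(** The bump starts at the centre of the gap and extends to the right by [radius w], so the further
    nodes of a stencil of step [radius w] stay in the same gap. *)
Definition spot w : R := left_end w + ell (size w) / 2.

Definition radius w : R := eta * ell (size w).

Lemma radius_itv w : 0 < radius w <= 1.
Proof. by rewrite mulr_gt0 ?ell_gt0//= mulr_ile1// ?ell_le1 ?(ltW (ell_gt0 _)) ?(ltW eta0). Qed.

Lemma spot_shift w s : 0 <= s <= m.+1%:R ->
  spot w <= spot w + s * radius w <= spot w + (1 - 2 * rho) / 4 * ell (size w).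
Proof.
have rp := rho0; have rh := rho_half.
move=> /andP[s0 sm]; have e0 := ell_gt0 (size w).
have r0 : 0 < radius w by case/andP: (radius_itv w).
rewrite lerDl mulr_ge0 ?(ltW r0)//= lerD2l -eta_mul -mulrA.
by rewrite ler_pM2r.
Qed.

Lemma spot_gap w s : 0 <= s <= m.+1%:R -> gap w (spot w + s * radius w).
Proof.
have rp := rho0; have rh := rho_half.
move=> /(spot_shift w); rewrite /gap /spot.
have := ell_contract (size w); have := ell_gt0 (size w); nra.
Qed.

(** Turns lengths into distances: points in the children of [w] see the bump of [w] from a distance
    of at least [eta * ell (size w)]. *)
Lemma spot_far w b u s x : 0 <= s <= m.+1%:R -> cell (w ++ b :: u) x ->
  radius w <= `|spot w + s * radius w - x|.
Proof.
have rp := rho0; have rh := rho_half.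
move=> hs; have := spot_shift w s hs.
set y := _ + s * _; rewrite {1 2}/spot -cat_rcons => h /cell_cat/cell_rcons c.
have e0 := ell_gt0 (size w).
have hr : radius w <= (1 - 2 * rho) / 4 * ell (size w).
  by rewrite -eta_mul ler_pM2r// ler_peMl ?(ltW eta0)// ler1n.
have := ell_contract (size w).
have h2 : rho * ell (size w) < 2^-1 * ell (size w) by rewrite ltr_pM2r.
case: b c => /=; rewrite ?mul1r ?mul0r => c hc.
  by rewrite ler0_norm; lra.
by rewrite ger0_norm; lra.
Qed.

(** The code digits of [w] form a truncated binary expansion, so [expo] increases along words and
    converges from below to the exponent at the limit point. *)
Definition expo w : R := A + (B - A) *
  dyadic_sum (fun k => nth false w (2 ^ k)%N) (code_count (size w)).

Lemma expo_itv w : A <= expo w <= B.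
Proof.
have AB' := AB; have A0' := A0.
rewrite /expo; have := @dyadic_sum_itv R (fun k => nth false w (2 ^ k)%N)
  (code_count (size w)).
set z := dyadic_sum _ _ => /andP[z0 z1].
by apply/andP; split; nra.
Qed.

Lemma expo_cat w u : expo w <= expo (w ++ u).
Proof.
rewrite /expo lerD2l ler_wpM2l ?subr_ge0//.
have sle : (code_count (size w) <= code_count (size (w ++ u)))%N.
  by apply: code_count_mono; rewrite size_cat leq_addr.
have /andP[h _] := @dyadic_sum_mono R (fun k => nth false (w ++ u) (2 ^ k)%N) _ _ sle.
apply: le_trans h; rewrite le_eqVlt; apply/orP; left; apply/eqP.
by apply: eq_bigr => i _; rewrite nth_cat code_count_lt.
Qed.

(** The factor [eta ^ beta] offsets the [eta ^ (-g)] contained in [radius w ^ (-g)] for [g <= beta],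
    so the Hölder constants of the piece do not depend on [eta], hence not on [rho]. *)
Definition amplitude w : R := eps * eta `^ beta * ell (size w) `^ expo w.

Lemma amplitude_gt0 w : 0 < amplitude w.
Proof. by rewrite !mulr_gt0 ?powR_gt0 ?ell_gt0. Qed.

Lemma eta_powR_le1 : eta `^ beta <= 1.
Proof.
apply: le_trans (_ : 1 `^ beta <= _); last by rewrite powR1.
by rewrite ge0_ler_powR ?nnegrE ?(ltW eta0).
Qed.

Lemma amplitude_le w s : s <= expo w -> amplitude w <= eps * ell (size w) `^ s.
Proof.
move=> se; rewrite /amplitude -mulrA ler_pM2l//.
apply: le_trans (_ : 1 * ell (size w) `^ expo w <= _).
  by rewrite ler_wpM2r ?powR_ge0 ?eta_powR_le1.
by rewrite mul1r; apply: ger_powR => //; rewrite ell_gt0 ell_le1.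
Qed.

Definition cbump w x : R := amplitude w * bump m ((x - spot w) / radius w).

Lemma cbump_spot w s : cbump w (spot w + s * radius w) = amplitude w * bump m s.
Proof.
have r0 : radius w != 0 by case/andP: (radius_itv w) => /gt_eqF ->.
by rewrite /cbump; congr (_ * bump m _); field.
Qed.

Definition cbump_jet w x i : R :=
  amplitude w * bump_jet m ((x - spot w) / radius w) i / radius w ^+ i.

Lemma cbump_off w x : ~ gap w x -> cbump w x = 0 /\ forall i, cbump_jet w x i = 0.
Proof.
have rp := rho0; have rh := rho_half.
move=> ng; rewrite /cbump /cbump_jet /bump /bump_jet.
case: ifPn => [/andP[s0 s1]|_]; last by split=> [|i]; rewrite mulr0 ?mul0r.
case: ng; have r0 : radius w != 0 by case/andP: (radius_itv w) => /gt_eqF ->.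
have -> : x = spot w + ((x - spot w) / radius w) * radius w by field.
apply: spot_gap; rewrite (ltW s0)/=; apply: le_trans (ltW s1) _.
by rewrite ler1n.
Qed.

Lemma cbump_le w x : `|cbump w x| <= amplitude w.
Proof.
have a0 := amplitude_gt0 w; have := bump_ge0_le1 m ((x - spot w) / radius w).
move=> /andP[b0 b1]; rewrite normrM (gtr0_norm a0) ger0_norm//.
by rewrite ler_piMr// ltW.
Qed.

(** Gaps are disjoint, so the sum of all [cbump w] has at most one nonzero term, found by [sel]. Off
    every gap the default word is harmless: its bump vanishes there. *)
Definition sel x : seq bool := xget [::] [set w | gap w x].

Definition cantor_sum x : R := cbump (sel x) x.

Lemma sel_gap w x : gap w x -> sel x = w.
Proof.
move=> g; have /(xgetPex [::])/= g' : exists w, [set w | gap w x] w by exists w.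
exact: gap_inj g' g.
Qed.

Lemma cantor_sum_gap w x : gap w x -> cantor_sum x = cbump w x.
Proof. by rewrite /cantor_sum => /sel_gap ->. Qed.

Lemma cantor_sum_nogap x : (forall w, ~ gap w x) -> cantor_sum x = 0.
Proof. by move=> h; have [] := cbump_off (sel x) x (h _). Qed.

Lemma cantor_sum_ex x : cantor_sum x <> 0 -> exists2 w, gap w x & cantor_sum x = cbump w x.
Proof.
move=> S0; have [[w g]|ng] := pselect (exists w, gap w x).
  by exists w => //; exact: cantor_sum_gap.
by case: S0; apply: cantor_sum_nogap => w g; apply: ng; exists w.
Qed.

Lemma cell_nil x : cell [::] x <-> q <= x <= q + d.
Proof. by rewrite /cell /left_end big_ord0 addr0 /= ell0. Qed.

Lemma cantor_sum_supp x : ~ (q <= x <= q + d) -> cantor_sum x = 0.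
Proof.
move=> nx; apply: cantor_sum_nogap => w /gap_cell c; apply: nx.
by apply/cell_nil; exact: (@cell_cat [::] w).
Qed.

Lemma cantor_sum_le x : `|cantor_sum x| <= eps.
Proof.
have AB' := AB; have A0' := A0.
apply: le_trans (cbump_le _ _) _.
have /andP[ea _] := expo_itv (sel x).
apply: le_trans (amplitude_le _ 0 (le_trans A0 ea)) _.
by rewrite powRr0 mulr1.
Qed.

(** [amplitude w * radius w ^ (-g)] is at most [eps], since [eta] and [ell] are left with the
    nonnegative exponents [beta - g] and [expo w - g]. *)
Lemma cbump_holder g C w : 0 <= g <= A -> g <= beta ->
  uniform_holder g C (bump m) (bump_jet m) ->
  uniform_holder g (eps * C) (cbump w) (cbump_jet w).
Proof.
have AB' := AB; have A0' := A0.
move=> /andP[g0 gA] gb hC; have C0 := uniform_holder_ge0 _ _ _ _ hC.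
have := uniform_holder_scale g C _ _ (amplitude w) (spot w) (radius w) g0
  (radius_itv w) hC.
apply: uniform_holder_le; rewrite ler_wpM2r//.
rewrite gtr0_norm ?amplitude_gt0// /amplitude -!mulrA ler_piMr ?(ltW eps0)//.
have e0 := ell_gt0 (size w).
rewrite /radius powRM ?(ltW eta0) ?(ltW e0)//.
have -> : eta `^ beta * (ell (size w) `^ expo w * (eta `^ (- g) * ell (size w) `^ (- g)))
   = (eta `^ beta * eta `^ (- g)) * (ell (size w) `^ expo w * ell (size w) `^ (- g)).
  by ring.
rewrite -!powRD_gt0//; have /andP[ea _] := expo_itv w.
have le1 (z s : R) : 0 < z <= 1 -> 0 <= s -> z `^ s <= 1.
  move=> /andP[z0 z1] s0; apply: le_trans (_ : 1 `^ s <= _); last by rewrite powR1.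
  by rewrite ge0_ler_powR ?nnegrE ?(ltW z0).
by rewrite mulr_ile1 ?powR_ge0 ?le1 ?eta0 ?e0 ?ell_le1 ?subr_ge0//; lra.
Qed.

Lemma cantor_sum_holder g C : 0 <= g <= A -> g <= beta ->
  uniform_holder g C (bump m) (bump_jet m) ->
  exists a, uniform_holder g (2 * (eps * C)) cantor_sum a.
Proof.
move=> gA gb hC; exists (fun x => cbump_jet (sel x) x).
apply: uniform_holder_select => [w|x w nw]; first exact: cbump_holder.
by apply: cbump_off => g'; apply: nw; rewrite (sel_gap w).
Qed.

Definition cantor_set x : Prop := forall l, exists2 w, size w = l & cell w x.

Definition address x (om : nat -> bool) : Prop := forall l, cell (mkseq om l) x.

(** Words whose cells contain [x] extend one another, since distinct branches are disjoint; the
    digit of rank [i] is read off a word of length [i.+1]. *)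
Lemma cantor_set_address x : cantor_set x <-> exists om, address x om.
Proof.
split=> [Kx|[om ax] l]; last by exists (mkseq om l); rewrite ?size_mkseq.
have /choice[W hW] : forall l, exists w, size w = l /\ cell w x.
  by move=> l; have [w sw cw] := Kx l; exists w.
exists (fun i => nth false (W i.+1) i) => l.
suff -> : mkseq (fun i => nth false (W i.+1) i) l = W l by have [] := hW l.
apply: (@eq_from_nth _ false); rewrite size_mkseq; first by have [->] := hW l.
move=> i il; rewrite nth_mkseq//.
have [sl cl] := hW l; have [si ci] := hW i.+1.
have [[u e]|[u e]|[p [b [u [u' [e e']]]]]] := words_cmp (W i.+1) (W l).
- by rewrite e nth_cat si ltnSn.
- have := congr1 size e; rewrite size_cat si sl => sz.
  have u0 : u = [::] by apply: size0nil; lia.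
  by rewrite e u0 cats0.
- rewrite e in ci; rewrite e' in cl.
  by case: (cell_disjoint _ _ _ _ _ ci cl).
Qed.

Lemma mkseq_prefix (om : nat -> bool) l p u :
  mkseq om l = p ++ u -> mkseq om (size p) = p.
Proof.
move=> e; have pl : (size p <= l)%N.
  by rewrite -(size_mkseq om l) e size_cat leq_addr.
apply: (@eq_from_nth _ false); rewrite size_mkseq// => i ip.
rewrite nth_mkseq// -(nth_mkseq false om (leq_trans ip pl)) e nth_cat.
by rewrite ip.
Qed.

(** Says that [expo] converges to [h] from below along an address of [x], at the rate of a truncated
    binary expansion. *)
Definition expo_set (h x : R) : Prop := exists2 om, address x om &
  forall l, expo (mkseq om l) <= h <=
            expo (mkseq om l) + (B - A) * 2^-1 ^+ code_count l.

Lemma expo_mkseq om l :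
  expo (mkseq om l) = A + (B - A) * dyadic_sum (fun k => om (2 ^ k)%N) (code_count l).
Proof.
rewrite /expo size_mkseq; congr (_ + _ * _); apply: eq_bigr => k _.
by rewrite nth_mkseq// code_count_lt.
Qed.

Lemma address_ex om : exists x, address x om.
Proof.
suff H k k' : (k <= k')%N ->
    left_end (mkseq om k) <= left_end (mkseq om k') <= left_end (mkseq om k) + ell k.
  have [x hx] := nested_point (fun l => left_end (mkseq om l)) ell H.
  by exists x => l; rewrite /cell size_mkseq.
move=> kk'; rewrite -(subnK kk').
suff: left_end (mkseq om k) <= left_end (mkseq om (k' - k + k)) <=
      left_end (mkseq om k) + ell k - ell (k' - k + k)%N.
  by have := ell_gt0 (k' - k + k); lra.
elim: (k' - k)%N => [|n IH]; first by rewrite add0n addrK lexx.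
rewrite addSn mkseqS left_end_rcons size_mkseq.
have := ell_mono _ _ (leqnSn (n + k)).
by case: (om _); rewrite ?mul1r ?mul0r; lra.
Qed.

Lemma cantor_setE x : cantor_set x <-> exists h, expo_set h x.
Proof.
have AB' := AB; have A0' := A0.
rewrite cantor_set_address; split=> [[om ax]|[h [om ax _]]]; last by exists om.
have H k k' : (k <= k')%N -> let s := @dyadic_sum R (fun k => om (2 ^ k)%N) in
    s k <= s k' <= s k + 2^-1 ^+ k.
  move=> /(@dyadic_sum_mono R (fun k => om (2 ^ k)%N)) /=.
  have : 0 <= 2^-1 ^+ k' :> R by rewrite exprn_ge0// invr_ge0.
  lra.
have [th hth] := nested_point _ (fun k => 2^-1 ^+ k) H.
exists (A + (B - A) * th), om => // l; rewrite expo_mkseq.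
have BA : 0 <= B - A by rewrite subr_ge0.
by have /andP[h1 h2] := hth (code_count l); apply/andP; split; nra.
Qed.

Lemma expo_set_itv h x : expo_set h x -> A <= h <= B.
Proof.
have AB' := AB; have A0' := A0.
move=> [om _ hom]; have := hom 0%N; rewrite expo_mkseq expr0 mulr1.
rewrite /dyadic_sum big_ord0 mulr0 addr0; lra.
Qed.

Lemma cantor_set_itv x : cantor_set x -> q <= x <= q + d.
Proof. by move=> /(_ 0%N)[w /size0nil ->] /cell_nil. Qed.

(** Let [k] be the length of the common prefix of the address of [x] and the word of the gap
    containing [y]. Separation gives [eta * ell k <= |y - x|], and since [expo] increases along
    words, the height at [y] is at most [eps * ell k ^ expo] with the exponent of the prefix. Near
    [x] the prefix is long and this exponent is at least [g]. *)
Lemma expo_set_lower h x g : expo_set h x -> 0 <= g < h ->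
  exists C r, 0 < r /\ forall y, `|y - x| < r -> `|cantor_sum y| <= C * `|y - x| `^ g.
Proof.
have rp := rho0; have rh := rho_half.
move=> [om ax hom] /andP[g0 gh].
have key y : cantor_sum y <> 0 -> exists k, eta * ell k <= `|y - x| /\
    `|cantor_sum y| <= eps * ell k `^ expo (mkseq om k).
  move=> S0; have [w gw Sy] := cantor_sum_ex _ S0; rewrite Sy in S0 *.
  have hs : 0 <= (y - spot w) / radius w <= m.+1%:R.
    have [/andP[s0 s1]|ns] := boolP (0 < (y - spot w) / radius w < 1); last first.
      by case: S0; rewrite /cbump bump_off// mulr0.
    by rewrite (ltW s0)/= (le_trans (ltW s1))// ler1n.
  have le_amp k : expo (mkseq om k) <= expo w -> ell (size w) <= ell k ->
      `|cbump w y| <= eps * ell k `^ expo (mkseq om k).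
    move=> ew lw; apply: le_trans (cbump_le _ _) _.
    apply: le_trans (amplitude_le _ _ ew) _; rewrite ler_pM2l//.
    rewrite ge0_ler_powR ?nnegrE ?(ltW (ell_gt0 _))//.
    by case/andP: (expo_itv (mkseq om k)) => a1 _; apply: le_trans A0 a1.
  (* One digit more than [w], so that this word cannot be a prefix of [w]. *)
  have cx := ax (size w).+1.
  have [[u e]|[u e]|[p [b [u [u' [e e']]]]]] := words_cmp w (mkseq om (size w).+1).
  - have ew : mkseq om (size w) = w := mkseq_prefix _ _ _ _ e.
    exists (size w); split; last by apply: le_amp; rewrite ?ew.
    case: u e => [|b u] e.
      by have := congr1 size e; rewrite size_mkseq cats0 => /eqP; rewrite gtn_eqF.
    have r0 : radius w != 0 by case/andP: (radius_itv w) => /gt_eqF ->.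
    have -> : y = spot w + ((y - spot w) / radius w) * radius w by field.
    by apply: (spot_far w b u) => //; rewrite -e.
  - by have := congr1 size e; rewrite size_cat size_mkseq => /eqP; rewrite ltn_eqF// leq_addr.
  - have pw : (size p < (size w).+1)%N.
      by have := congr1 size e'; rewrite size_mkseq size_cat /= => ->; rewrite addnS ltnS leq_addr.
    have ep : mkseq om (size p) = p := mkseq_prefix _ _ _ _ e'.
    exists (size p); split.
      rewrite e' in cx; have cw := gap_cell _ _ gw; rewrite e in cw.
      apply: le_trans (cell_sep _ _ _ _ _ _ cw cx).
      rewrite ler_pM2r ?ell_gt0// /eta ler_pdivrMr ?mulr_gt0// ler_peMr//; first lra.
      by have m1 : 1 <= m.+1%:R :> R by [rewrite ler1n]; lra.
    apply: le_amp; first by rewrite ep e; exact: expo_cat.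
    by apply: ell_mono; rewrite e size_cat leq_addr.
have D0 : 0 <= B - A by rewrite subr_ge0.
(* The summand 1 allows for [A = B]. *)
have [n hn] : exists n, (B - A + 1) * 2^-1 ^+ n <= h - g.
  have [n hn] := geometric_small (2^-1) ((h - g) / (B - A + 1)) ltac:(lra)
    ltac:(apply: divr_gt0; lra).
  by exists n; rewrite mulrC -ler_pdivlMr//; lra.
have [p hp] := code_count_unbounded n.
exists (eps * (eta^-1 `^ g)), (eta * ell p); split; first by rewrite mulr_gt0 ?ell_gt0.
move=> y yp; have [->|S0] := pselect (cantor_sum y = 0).
  by rewrite normr0 !mulr_ge0 ?powR_ge0 ?(ltW eps0).
have [k [yk Sk]] := key y S0.
have pk : (p <= k)%N.
  rewrite leqNgt; apply/negP => /ltnW/ell_mono; rewrite leNgt => /negP; apply.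
  by rewrite -(ltr_pM2l eta0); apply: le_lt_trans yk yp.
have ek : g <= expo (mkseq om k).
  have := hom k; have : (2^-1 : R) ^+ code_count k <= 2^-1 ^+ n.
    by rewrite ler_wiXn2l ?(leq_trans hp (code_count_mono _ _ pk))//; lra.
  have : 0 <= 2^-1 ^+ code_count k :> R by rewrite exprn_ge0// invr_ge0.
  have : 0 <= 2^-1 ^+ n :> R by rewrite exprn_ge0// invr_ge0.
  move: hn D0; nra.
apply: le_trans Sk _; rewrite -mulrA ler_pM2l//.
apply: le_trans (_ : ell k `^ g <= _).
  by apply: ger_powR => //; rewrite ell_gt0 ell_le1.
rewrite -powRM ?invr_ge0 ?(ltW eta0)//.
rewrite ge0_ler_powR ?nnegrE ?(ltW (ell_gt0 _)) ?mulr_ge0 ?invr_ge0 ?(ltW eta0)//.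
by rewrite mulrC ler_pdivlMr// mulrC.
Qed.

Lemma near_not_cell w x : ~ cell w x -> \forall y \near x, ~ cell w y.
Proof.
move=> nc; apply/near_normP.
have [xl|xl] := ltP x (left_end w).
  exists (left_end w - x); first by rewrite subr_gt0.
  by move=> y; rewrite ltr_norml => /andP[_ h] /andP[h1 _]; lra.
have [xr|xr] := ltP (left_end w + ell (size w)) x; last first.
  by case: nc; rewrite /cell xl.
exists (x - (left_end w + ell (size w))); first by rewrite subr_gt0.
by move=> y; rewrite ltr_norml => /andP[h _] /andP[_ h1]; lra.
Qed.

(** Cells are closed, so a neighbourhood of [x] misses all cells of some depth [l]. Only bumps of
    depth less than [l] are met there; their radii are at least [eta * ell l], which bounds their
    jets of order [beta + 1] uniformly. *)
Lemma cantor_sum_smooth C x : 0 <= C ->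
  uniform_holder (beta + 1) C (bump m) (bump_jet m) -> ~ cantor_set x ->
  exists r C' f a, [/\ 0 < r, uniform_holder (beta + 1) C' f a &
    forall y, `|y - x| < r -> cantor_sum y = f y /\ ~ cantor_set y].
Proof.
move=> C0 hC nK.
have [l hl] : exists l, forall w, size w = l -> ~ cell w x.
  apply: contrapT => H; apply: nK => l; apply: contrapT => H'; apply: H; exists l.
  by move=> w sw cw; apply: H'; exists w.
have : \forall y \near x, forall w : l.-tuple bool, ~ cell w y.
  have nc (w : l.-tuple bool) : \forall y \near x, ~ cell w y.
    by apply: near_not_cell; apply: hl; exact: size_tuple.
  exact: (@filter_forall _ _ (fun (w : l.-tuple bool) y => ~ cell w y) (nbhs x) _ nc).
move=> /near_normP[r r0 hr].
have b10 : 0 <= beta + 1 by rewrite addr_ge0.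
pose F w := if (size w < l)%N then cbump w else fun=> 0.
pose J w := if (size w < l)%N then cbump_jet w else fun=> fun=> 0.
pose C' := eps * (eta * ell l) `^ (- (beta + 1)) * C.
have p0 : 0 < eta * ell l by rewrite mulr_gt0 ?ell_gt0.
have C'0 : 0 <= C' by rewrite !mulr_ge0 ?powR_ge0// ltW.
exists r, (2 * C'), (fun y => F (sel y) y), (fun y => J (sel y) y); split=> //.
  apply: uniform_holder_select => [w|y w nw].
    rewrite /F /J; case: ifP => sw; last first.
      exact: uniform_holder0.
    have := uniform_holder_scale _ C _ _ (amplitude w) (spot w) (radius w) b10
      (radius_itv w) hC.
    apply: uniform_holder_le; rewrite ler_wpM2r//.
    rewrite gtr0_norm ?amplitude_gt0//; apply: ler_pM.
    - by rewrite ltW ?amplitude_gt0.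
    - exact: powR_ge0.
    - have /andP[ea _] := expo_itv w.
      by apply: le_trans (amplitude_le _ 0 (le_trans A0 ea)) _; rewrite powRr0 mulr1.
    - rewrite !powRN lef_pV2 ?posrE ?powR_gt0//; last by case/andP: (radius_itv w).
      rewrite ge0_ler_powR ?nnegrE ?(ltW p0)//; first by case/andP: (radius_itv w) => /ltW.
      by rewrite ler_pM2l// ell_mono// ltnW.
  have [h1 h2] := cbump_off w y (fun g => nw (esym (sel_gap _ _ g))).
  by rewrite /F /J; case: ifP.
move=> y yr; split; last first.
  move=> Ky; have [w sw cw] := Ky l; have st : size w == l by rewrite sw.
  exact: (hr y yr (Tuple st) cw).
rewrite /F; case: ifP => [//|/negbT]; rewrite -leqNgt => ls.
apply: contrapT => S0; have [w gw _] := cantor_sum_ex _ S0.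
rewrite (sel_gap _ _ gw) in ls; have := gap_cell _ _ gw.
rewrite -(cat_take_drop l w) => /cell_cat.
have st : size (take l w) == l by rewrite size_take_min; apply/eqP/minn_idPl.
by have := hr y yr (Tuple st).
Qed.

(** The cell of [x] at depth [l] has a bump in its gap. A stencil of step [radius w] starting in the
    middle of that bump has its other nodes in the same gap, beyond the bump. The difference is thus
    the value of the bump there, at least of order [t ^ h'] because [expo] stays below [h]. *)
Lemma expo_set_upper h x h' r : expo_set h x -> h < h' -> 0 < r ->
  exists t y, [/\ 0 < t <= r,
    forall i, (i <= m)%N -> q <= y + i%:R * t <= q + d /\
       `|y + i%:R * t - x| <= eta^-1 * t &
    eps * eta `^ beta * bump m 2^-1 * t `^ h' <= `|fdiff m t cantor_sum y|].
Proof.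
move=> [om ax hom] hb r0; have rp := rho0; have rh := rho_half.
have [l hl] : exists l, ell l <= r.
  have rho1 : 0 <= rho < 1 by rewrite (ltW rho0)/=; lra.
  have [l hl] := geometric_small _ _ rho1 r0; exists l; apply: le_trans hl.
  elim: l => [|l IH]; first by rewrite ell0 expr0; case/andP: d_itv.
  by apply: le_trans (ell_contract l) _; rewrite exprS ler_pM2l.
pose w := mkseq om l; have sw : size w = l by rewrite size_mkseq.
have r1 : 0 < radius w by case/andP: (radius_itv w).
have pt i : (i <= m)%N -> spot w + radius w / 2 + i%:R * radius w =
    spot w + (i%:R + 2^-1) * radius w /\ 0 <= (i%:R + 2^-1 : R) <= m.+1%:R.
  move=> im; split; first by field.
  have : i%:R <= m%:R :> R by rewrite ler_nat.
  by rewrite -(natr1 m); have : 0 <= i%:R :> R by []; lra.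
exists (radius w), (spot w + radius w / 2); split.
- rewrite r1 /radius sw; apply: le_trans hl.
  by rewrite ler_piMl// ltW ?ell_gt0.
- move=> i /pt[-> hs]; have g := spot_gap w _ hs.
  have c := gap_cell _ _ g; split.
    by apply/cell_nil; exact: (@cell_cat [::] w).
  have cx : cell w x by exact: ax.
  have -> : eta^-1 * radius w = ell (size w) by rewrite mulKf ?gt_eqF.
  by move: c cx; rewrite /cell ler_norml; lra.
- rewrite fdiff_single; last first.
    move=> i /andP[i0 im]; have [e hs] := pt i im.
    rewrite e (cantor_sum_gap _ _ (spot_gap w _ hs)) cbump_spot.
    rewrite bump_off ?mulr0//; apply/negP => /andP[_].
    by have : 1 <= i%:R :> R by [rewrite ler1n]; lra.
  have [e hs] := pt 0%N (leq0n _); rewrite mul0r addr0 in e.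
  rewrite e (cantor_sum_gap _ _ (spot_gap w _ hs)) cbump_spot add0r.
  have b0 := @bump_half_gt0 R m; have a0 := amplitude_gt0 w.
  have ab0 : 0 < amplitude w * bump m 2^-1 by apply: mulr_gt0.
  rewrite (gtr0_norm ab0) mulrAC ler_pM2r//.
  rewrite /amplitude ler_pM2l ?mulr_gt0 ?powR_gt0//.
  have h1 : expo w <= h' by have /andP[h1 _] := hom l; apply: le_trans h1 (ltW hb).
  have h'0 : 0 <= h' by apply: le_trans h1; case/andP: (expo_itv w) => e1 _; apply: le_trans A0 e1.
  apply: le_trans (_ : ell (size w) `^ h' <= _).
    rewrite ge0_ler_powR ?nnegrE ?(ltW r1) ?(ltW (ell_gt0 _))//.
    by rewrite ler_piMl// ltW ?ell_gt0.
  by apply: ger_powR => //; rewrite ell_gt0 ell_le1.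
Qed.

Lemma cantor_set_null s : 0 < s ->
  (forall e, 0 < e -> exists l, 2 ^+ l * ell l `^ s <= e /\ ell l <= e) ->
  hausdorff_null s cantor_set.
Proof.
move=> s0 H; apply: hausdorff_null_cover => // e e0; have [l [h1 h2]] := H e e0.
pose W := enum {: l.-tuple bool}.
have sW : size W = (2 ^ l)%N by rewrite -cardE card_tuple card_bool.
exists (fun k => if (k < 2 ^ l)%N then cell (nth [::] (map val W) k) else set0).
exists (fun k => if (k < 2 ^ l)%N then ell l else 0); split.
- move=> x Kx; have [w sw cw] := Kx l.
  have st : size w == l by rewrite sw.
  exists (index (Tuple st) W) => //=.
  have iW : (index (Tuple st) W < size W)%N by rewrite index_mem mem_enum.
  rewrite -sW iW (nth_map (Tuple st))// nth_index ?mem_enum//.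
- by move=> k; case: ifP => _; rewrite ?lexx ?(ltW e0)// (ltW (ell_gt0 _)).
- move=> k; case: ifP => kl; apply: ediam_le => // x y.
  have sz : size (nth [::] (map val W) k) = l.
    by rewrite (nth_map (nseq_tuple l false))// ?sW// size_tuple.
  by rewrite /cell sz ler_norml; lra.
move=> n; apply: le_trans h1; have p0 := powR_ge0 (ell l) s.
suff -> : \sum_(0 <= k < n) (if (k < 2 ^ l)%N then ell l else 0) `^ s =
    (minn n (2 ^ l))%:R * ell l `^ s.
  by rewrite ler_wpM2r// -natrX ler_nat geq_minr.
elim: n => [|n IH]; first by rewrite big_geq// min0n mul0r.
rewrite big_nat_recr//= IH; case: ifP => [nl|/negbT].
  by rewrite (minn_idPl (ltnW nl)) (minn_idPl nl) -natr1 mulrDl mul1r.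
rewrite -leqNgt => ln; rewrite powR0 ?gt_eqF// addr0 (minn_idPr ln).
by rewrite (minn_idPr (leqW ln)).
Qed.

Lemma expo_set_ex h t : A <= h <= B ->
  exists2 x, expo_set h x & address x (mixed_digits ((h - A) / (B - A)) t).
Proof.
move=> /andP[Ah hB]; set th := (h - A) / (B - A).
have [x ax] := address_ex (mixed_digits th t); exists x => //.
exists (mixed_digits th t) => // l; rewrite expo_mkseq.
have -> : dyadic_sum (fun k => mixed_digits th t (2 ^ k)%N) (code_count l) =
    greedy th (code_count l).
  rewrite -dyadic_sum_bit; apply: eq_bigr => i _.
  by rewrite mixed_digits_code.
(* For [A = B] the quotient [th] is a division by 0, but its coefficient [B - A] vanishes. *)
have [e|ne] := eqVneq B A.
  by rewrite e subrr !mul0r addr0; move: Ah hB; rewrite e; lra.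
have BA : 0 < B - A by rewrite subr_gt0 lt_def ne AB.
have hth : h = A + (B - A) * th by rewrite /th mulrC divfK ?gt_eqF// addrC subrK.
have th01 : 0 <= th <= 1.
  rewrite /th divr_ge0 ?subr_ge0 ?(ltW BA)//= ler_pdivrMr// mul1r.
  by rewrite lerD2r.
have /andP[g1 g2] := greedy_bound _ (code_count l) th01.
by rewrite {1 2}hth -addrA -mulrDr !lerD2l !ler_pM2l// g1.
Qed.

(** If the mixed digits of [t] and [t'] first differ at rank [p], then [|t - t'| <= 2^-(free_rank p)
    <= C * ell p ^ s], while the points [X t] and [X t'] are at least [(1 - 2 * rho) * ell p] apart.
    So a null level set would make [[0, 1]] Lebesgue negligible. *)
Lemma expo_set_not_null h s C : A <= h <= B -> 0 <= s -> 0 < C ->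
  (forall l, 2^-1 ^+ free_rank l <= C * ell l `^ s) ->
  ~ hausdorff_null s (expo_set h).
Proof.
move=> hAB s0 C0 hC null; have rp := rho0; have rh := rho_half.
have /choice[X hX] : forall t, exists x, expo_set h x /\
    address x (mixed_digits ((h - A) / (B - A)) t).
  by move=> t; have [x] := expo_set_ex h t hAB; exists x.
set th := (h - A) / (B - A) in hX.
apply: (@itv_not_negligible R 0 1 ltr01).
apply: (hausdorff_null_negligible s (C * ((1 - 2 * rho)^-1 `^ s)) _ _ X s0 null).
  by move=> t _; have [] := hX t.
move=> t t'; rewrite /= !in_itv /= => t01 t'01.
have r2 : 0 < 1 - 2 * rho by lra.
have [all_eq|/existsNP[p0 np0]] := pselect
    (forall i, mixed_digits th t i = mixed_digits th t' i).
  suff -> : t = t'.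
    rewrite subrr normr0; apply: mulr_ge0; last exact: powR_ge0.
    by apply: mulr_ge0; [exact: ltW|exact: powR_ge0].
  apply/eqP; rewrite -subr_eq0 -normr_le0; apply/ler_addgt0Pr => e e0; rewrite add0r.
  have [n hn] := geometric_small (2^-1) e ltac:(lra) e0.
  apply: le_trans hn; apply: bits_close => // j _.
  have [k kj] := free_rank_unbounded j.
  have [i [_ ni ri]] := free_rank_surj _ _ kj.
  by have := all_eq i; rewrite /mixed_digits (negbTE ni) ri.
have ex : exists p : nat, mixed_digits th t p != mixed_digits th t' p.
  by exists p0; apply/eqP.
case: (ex_minnP ex) => p np minp.
have agree i : (i < p)%N -> mixed_digits th t i = mixed_digits th t' i.
  by move=> ip; apply/eqP; apply: contraLR ip => /minp; rewrite -leqNgt.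
apply: le_trans (mixed_digits_close _ _ _ _ t01 t'01 agree) _.
apply: le_trans (hC p) _; rewrite -mulrA ler_pM2l// -powRM ?invr_ge0 ?(ltW r2)//.
rewrite ge0_ler_powR ?nnegrE ?(ltW (ell_gt0 _)) ?mulr_ge0 ?invr_ge0 ?(ltW r2)//.
rewrite mulrC ler_pdivlMr// mulrC.
have [_ cx] := hX t; have [_ cx'] := hX t'.
have := cx' p.+1; have := cx p.+1; rewrite !mkseqS.
have -> : mkseq (mixed_digits th t') p = mkseq (mixed_digits th t) p.
  apply: (@eq_from_nth _ false); rewrite !size_mkseq// => i ip.
  by rewrite !nth_mkseq// agree.
set pre := mkseq _ p; rewrite -!cats1 => c c'.
have := cell_sep pre (mixed_digits th t p) [::] [::] (X t) (X t') c.
rewrite size_mkseq; apply.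
by have -> : ~~ mixed_digits th t p = mixed_digits th t' p by move: np; do 2 case: mixed_digits.
Qed.

End CantorBumps.

(** * Singular pieces, seen through the properties that the superposition uses *)

Section SingularPiece.
Context {R : realType}.
Implicit Types (beta A B c q d eps g h x : R).

(* [K] carries the singularities of [S], and [E h] is the set of points of [K]
   where the exponent is exactly [h]. *)
Record singular_piece (m : nat) beta A B c q d eps
    (K : set R) (E : R -> set R) (S : R -> R) : Prop := SingularPiece {
  piece_supp : forall x, ~ (q <= x <= q + d) -> S x = 0;
  piece_le : forall x, `|S x| <= eps;
  piece_holder : forall g C, 0 <= g <= A -> g <= beta ->
    uniform_holder g C (bump m) (bump_jet m) ->
    exists a, uniform_holder g (2 * (eps * C)) S a;
  piece_smooth : forall x, ~ K x -> exists r C f a,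
    [/\ 0 < r, uniform_holder (beta + 1) C f a &
        forall y, `|y - x| < r -> S y = f y /\ ~ K y];
  piece_KE : forall x, K x <-> exists h, E h x;
  piece_itv : forall x, K x -> q <= x <= q + d;
  piece_range : forall h x, E h x -> A <= h <= B;
  piece_lower : forall h x g, E h x -> 0 <= g < h -> pointwise_holder `[0, 1] S g x;
  piece_upper : forall h x g, E h x -> h < g -> ~ pointwise_holder `[0, 1] S g x;
  piece_null : forall s, c < s -> 0 < s -> hausdorff_null s K;
  piece_big : forall h, A <= h <= B -> E h !=set0 /\
    forall s, 0 <= s < c -> ~ hausdorff_null s (E h) }.

(** One order of regularity beyond [beta] is worth a factor [t], so such a part is negligible
    against [t ^ beta] at small scales. *)
Lemma smooth_fdiff m beta (C : R) (f : R -> R) a (S : R -> R) x (r : R) :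
  m = (Num.truncn (beta + 1)).+1 -> 0 < beta ->
  uniform_holder (beta + 1) C f a -> (forall y, `|y - x| < r -> S y = f y) ->
  exists2 D : R, 0 <= D & forall t y : R, 0 < t ->
    (forall i, (i <= m)%N -> `|y + i%:R * t - x| < r) ->
    `|fdiff m t S y| <= D * t * t `^ beta.
Proof.
move=> mE beta0 hf Sf; have C0 := uniform_holder_ge0 _ _ _ _ hf.
have b10 : 0 <= beta + 1 by rewrite addr_ge0 ?(ltW beta0).
exists (2 ^+ m * (C * m%:R `^ (beta + 1))); first by rewrite !mulr_ge0 ?exprn_ge0 ?powR_ge0.
move=> t y t0 st; rewrite (eq_fdiff m t S f y); last by move=> i im; exact: Sf (st i im).
have tm : (Num.truncn (beta + 1) < m)%N by rewrite mE.
apply: le_trans (uniform_holder_fdiff _ _ _ _ m t y b10 (ltW t0) tm hf) _.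
rewrite powRM ?(ltW t0)// (powRD_gt0 _ _ _ t0) powRr1 ?(ltW t0)//.
by rewrite le_eqVlt; apply/orP; left; apply/eqP; ring.
Qed.

Lemma singular_piece_ex (m : nat) beta A B c q d eps :
  m = (Num.truncn (beta + 1)).+1 -> 0 < beta -> 0 <= A ->
  (A <= B -> B < beta /\ 0 <= c < 1) -> 0 < d <= 1 -> 0 < eps -> 0 <= q -> q + d <= 1 ->
  exists K E S, singular_piece m beta A B c q d eps K E S.
Proof.
move=> mE beta0 A0 ABc d01 eps0 q0 qd1.
have b10 : 0 <= beta + 1 by rewrite addr_ge0 ?ler01 ?(ltW beta0).
have [AB|BA] := leP A B; last first.
  exists set0, (fun=> set0), (fun=> 0); split=> //.
  - by move=> x; rewrite normr0 ltW.
  - move=> g C _ _ hC; exists (fun=> fun=> 0); apply: uniform_holder0.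
    by rewrite !mulr_ge0 ?(ltW eps0) ?(uniform_holder_ge0 _ _ _ _ hC).
  - move=> x _; exists 1, 0, (fun=> 0), (fun=> fun=> 0); split=> //.
      exact: uniform_holder0.
    by move=> y _; split => // -[].
  - by move=> x; split=> // -[].
  - by move=> s _ s0; exact: hausdorff_null0.
  - by move=> h /andP[h1 h2]; move: BA; rewrite ltNge (le_trans h1 h2).
have [Bb c01] := ABc AB; have b0 := ltW beta0.
have [rho [ell [rho01 ell0 ellS hU hL]]] := cantor_lengths c d c01 d01.
pose E := expo_set A B q ell.
have Eitv h x : E h x -> 0 <= h < beta.
  move=> Ex; have /andP[h1 h2] : A <= h <= B by apply: (@expo_set_itv R A B q ell) Ex.
  by rewrite (le_trans A0 h1) (le_lt_trans h2).
have [C0 C00 hC0] : exists2 C, 0 < C & uniform_holder (beta + 1) C (bump m) (@bump_jet R m).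
  by apply: uniform_holder_bump; rewrite b10 mE truncnS_gt.
exists (cantor_set q ell), E, (cantor_sum m beta A B q eps rho ell).
split.
- by move=> x; apply: (@cantor_sum_supp R m beta A B q d eps rho ell).
- by move=> x; apply: (@cantor_sum_le R m beta A B q d eps rho ell).
- by move=> g C gA gb hC; apply: (@cantor_sum_holder R m beta A B q d eps rho ell).
- by move=> x nK; apply: (@cantor_sum_smooth R m beta A B q d eps rho ell) (ltW C00) hC0 nK.
- by move=> x; apply: (@cantor_setE R m beta A B q d eps rho ell).
- by move=> x; apply: (@cantor_set_itv R q d ell).
- by move=> h x; apply: (@expo_set_itv R A B q ell).
- move=> h x g Ex gh.
  have [C [r [r0 hr]]] : exists C r, 0 < r /\ forall y, `|y - x| < r ->
      `|cantor_sum m beta A B q eps rho ell y| <= C * `|y - x| `^ g.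
    by apply: (@expo_set_lower R m beta A B q d eps rho ell) Ex gh.
  by apply: (pointwise_holder_bound _ _ _ _ C r r0) => y _; exact: hr.
- move=> h x g Ex hg; have /andP[h0 hb] := Eitv _ _ Ex.
  (* Strictly between [h] and [g], and at most [beta + 1] so that differences of order [m]
     suffice. *)
  pose h' := Num.min ((h + g) / 2) (beta + 1).
  have hh' : h < h' by rewrite lt_min; apply/andP; split; lra.
  have h'g : h' < g by rewrite gt_min; apply/orP; left; lra.
  apply: (@not_pointwise_holder R _ _ _ h' _ m (eta m rho)^-1
    (eps * eta m rho `^ beta * bump m 2^-1)).
  + by rewrite h'g andbT (le_trans h0)// ltW.
  + by rewrite mE ltnS le_truncn// ge_min lexx orbT.
  + have e0 : 0 < eta m rho by case/andP: (eta_itv m rho rho01).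
    by rewrite !mulr_gt0 ?powR_gt0// bump_half_gt0.
  + by rewrite invr_gt0; case/andP: (eta_itv m rho rho01).
  move=> r r0.
  have [t [y [t0 st fd]]] : exists t y, [/\ 0 < t <= r,
      forall i, (i <= m)%N -> q <= y + i%:R * t <= q + d /\
                              `|y + i%:R * t - x| <= (eta m rho)^-1 * t &
      eps * eta m rho `^ beta * bump m 2^-1 * t `^ h' <=
      `|fdiff m t (cantor_sum m beta A B q eps rho ell) y|].
    by apply: (@expo_set_upper R m beta A B q d eps rho ell) Ex hh' r0.
  exists t, y; split=> // i im; have [yi xi] := st i im; split=> //=.
  by rewrite in_itv/=; lra.
- move=> s cs s0; apply: (@cantor_set_null R q d rho ell) => // e e0.
  exact: hU.
move=> h hAB; split.
  by have [x Ex _] : exists2 x, E h x & address q ell x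
       (mixed_digits ((h - A) / (B - A)) 0) by [apply: (@expo_set_ex R A B q d rho ell) hAB]; exists x.
move=> s sc; have [C Cp hC] := hL s sc.
have /andP[s0 _] := sc.
by apply: (@expo_set_not_null R A B q d rho ell) hC.
Qed.

End SingularPiece.

(** * A monofractal background *)

Section Weierstrass.
Context {R : realType}.
Implicit Types (x y t u g beta : R).

Lemma geometric_sum_le u n : 0 <= u < 1 -> \sum_(0 <= i < n) u ^+ i <= (1 - u)^-1.
Proof.
move=> /andP[u0 u1]; have h : 0 < 1 - u by rewrite subr_gt0.
rewrite big_mkord -[_^-1]mul1r ler_pdivlMr// mulrC -opprB mulNr -subrX1 opprB.
by rewrite lerBlDr lerDl exprn_ge0.
Qed.

Lemma has_sum_fdiff m t y (f : nat -> R -> R) F :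
  (forall x, has_sum (fun n => f n x) (F x)) ->
  has_sum (fun n => fdiff m t (f n) y) (fdiff m t F y).
Proof.
move=> fF; elim: m y => [|m IH] y /=; first exact: fF.
exact: has_sumB.
Qed.

Lemma fdiff_periodic m t y (f : R -> R) : (0 < m)%N ->
  (forall x, f (x + t) = f x) -> fdiff m t f y = 0.
Proof.
case: m => // m _ ft /=; apply/eqP; rewrite subr_eq0; apply/eqP.
elim: m y => [|m IH] y /=; first by rewrite ft.
by rewrite IH (IH (y + t)).
Qed.

(** Each period carries one bump, on its first [m.+1]-th part: [m.+1] nodes of step [1 / m.+1]
    starting in the middle of the bump meet no other bump. *)
Definition wave (m : nat) x : R := bump m ((x - (Num.floor x)%:~R) / m.+1%:R^-1).

Lemma wave_period m x (n : nat) : wave m (x + n%:R) = wave m x.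
Proof.
rewrite /wave; congr (bump m (_ / _)).
have -> : Num.floor (x + n%:R) = (Num.floor x + n%:Z)%R.
  apply: floor_def; have /andP[f1 f2] := floor_itv x.
  rewrite addrAC !(intrD _ _ n%:Z) -[n%:~R]pmulrn lerD2r f1 /=.
  by rewrite ltrD2r.
by rewrite intrD -pmulrn; ring.
Qed.

Lemma wave_holder m g C : 0 <= g -> uniform_holder g C (bump m) (bump_jet m) ->
  exists C' a, uniform_holder g C' (wave m) a.
Proof.
move=> g0 hC; have p0 : 0 < m.+1%:R :> R by [].
have r01 : 0 < (m.+1%:R^-1 : R) <= 1 by rewrite invr_gt0 p0 invf_le1// ler1n.
have H K := uniform_holder_scale g C _ _ 1 K%:~R (m.+1%:R^-1) g0 r01 hC.
have S := uniform_holder_select _ (fun x => Num.floor x) _ _ _ _ H.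
eexists; eexists.
rewrite (_ : wave m = fun x => 1 * bump m ((x - (Num.floor x)%:~R) / m.+1%:R^-1));
  last by apply/funext => x; rewrite mul1r.
apply: S => x K nK.
rewrite /bump /bump_jet; case: ifP => [/andP[k0 k1]|_]; last first.
  by split=> [|i]; rewrite mulr0 ?mul0r.
case: nK; apply/esym/floor_def.
move: k0 k1; rewrite invrK pmulr_lgt0// subr_gt0 => k0 k1.
rewrite (ltW k0)/= intrD addrC -ltrBlDr.
apply: le_lt_trans k1; rewrite ler_peMr ?subr_ge0 ?(ltW k0)//.
by rewrite ler1n.
Qed.

Lemma wave_spot m (n : int) (j : nat) : (j <= m)%N ->
  wave m (n%:~R + (2^-1 + j%:R) / m.+1%:R) = bump m (2^-1 + j%:R).
Proof.
move=> jm; have p0 : 0 < m.+1%:R :> R by [].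
have jm' : j%:R <= m%:R :> R by rewrite ler_nat.
have j0 : 0 <= j%:R :> R by [].
have e : Num.floor (n%:~R + (2^-1 + j%:R) / m.+1%:R : R) = n.
  apply: floor_def; rewrite intrD lerDl ltrD2l divr_ge0//=.
  by rewrite ltr_pdivrMr// mul1r -(natr1 m); lra.
by rewrite /wave e addrAC subrr add0r invrK divfK ?gt_eqF.
Qed.

Lemma wave_le1 m x : `|wave m x| <= 1.
Proof. by have /andP[h1 h2] := bump_ge0_le1 m ((x - (Num.floor x)%:~R) / m.+1%:R^-1); rewrite ger0_norm. Qed.

(** [W] is the sum of [lam k ^ beta * wave (x / lam k)] with [lam k = b^-k]. At step
    [t = lam k / m.+1] the terms finer than [k] are [t]-periodic and cancel, the [k]-th one shows a
    bump, and the coarser ones, regular of order [beta + 1], contribute a geometric sum of ratio [b]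
    that a large [b] keeps below half of the main term. *)
Lemma weierstrass_ex (m : nat) beta : 0 < beta -> m = (Num.truncn (beta + 1)).+1 ->
  exists (b : nat) (W : R -> R) (c B : R), [/\ (1 < b)%N, 0 < c,
    forall x, `|W x| <= B,
    forall g, 0 <= g < beta -> exists C a, uniform_holder g C W a &
    forall k a, exists y,
      (forall i, (i <= m)%N -> a <= y + i%:R * (b%:R^-1 ^+ k / m.+1%:R) <=
                               a + 2 * b%:R^-1 ^+ k) /\
      c * (b%:R^-1 ^+ k / m.+1%:R) `^ beta <=
      `|fdiff m (b%:R^-1 ^+ k / m.+1%:R) W y|].
Proof.
move=> beta0 mE; have b10 : 0 <= beta + 1 by rewrite addr_ge0 ?ler01 ?(ltW beta0).
have bm : beta + 1 < m%:R by rewrite mE truncnS_gt.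
have bumpH g : 0 <= g <= beta + 1 -> exists C a, uniform_holder g C (wave m) a.
  move=> /andP[g0 gb]; have gm : 0 <= g < m%:R by rewrite g0 (le_lt_trans gb).
  by have [C _ hC] := uniform_holder_bump m g gm; apply: wave_holder hC.
have [C1 [a1 hC1]] : exists C a, uniform_holder (beta + 1) C (wave m) a.
  by apply: bumpH; rewrite b10 lexx.
have C10 := uniform_holder_ge0 _ _ _ _ hC1.
pose C2 : R := 2 ^+ m * (C1 * m%:R `^ (beta + 1)).
have C20 : 0 <= C2 by rewrite !mulr_ge0 ?exprn_ge0 ?powR_ge0.
have ph0 := @bump_half_gt0 R m; set phi := bump m 2^-1 in ph0.
(* [N] makes [C2 / (b - 1)] at most [phi / 2]; the factor [m.+1] of [b] makes [t / lam j] an integer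
   for [j > k]. *)
pose N := (Num.truncn (2 * C2 / phi)).+2.
pose b := (m.+1 * N)%N; pose p : R := m.+1%:R; have p0 : 0 < p by [].
have p1 : 1 <= p by rewrite ler1n.
have bN : (N <= b)%N by rewrite leq_pmull.
have b1 : (1 < b)%N by apply: leq_trans bN.
have bR1 : 1 < b%:R :> R by rewrite ltr1n.
have bR0 : 0 < b%:R :> R by apply: lt_trans bR1.
have hb : C2 / (b%:R - 1) <= phi / 2.
  rewrite ler_pdivrMr ?subr_gt0// mulrC -ler_pdivrMr ?divr_gt0// lerBrDr.
  apply: le_trans (_ : N%:R <= _); last by rewrite ler_nat.
  rewrite /N -(natr1 (Num.truncn (2 * C2 / phi)).+1) lerD2r; apply/ltW.
  by have -> : C2 / (phi / 2) = 2 * C2 / phi by [field; rewrite gt_eqF]; exact: truncnS_gt.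
pose lam k : R := b%:R^-1 ^+ k.
have lam0 k : 0 < lam k by rewrite exprn_gt0// invr_gt0.
have lam1 k : lam k <= 1 by rewrite exprn_ile1 ?invr_ge0 ?invf_le1// ltW.
pose f k x := lam k `^ beta * wave m ((x - 0) / lam k).
have u01 s : 0 < s -> 0 <= (b%:R^-1 : R) `^ s < 1.
  move=> s0; rewrite powR_ge0/= /powR gt_eqF ?invr_gt0//.
  by rewrite expR_lt1 pmulr_rlt0// ln_lt0// invr_gt0 bR0 invf_lt1.
have lamX s k : lam k `^ s = ((b%:R^-1 : R) `^ s) ^+ k.
  by rewrite /lam powRX// invr_ge0 ltW.
have fle k x : `|f k x| <= ((b%:R^-1 : R) `^ beta) ^+ k.
  rewrite normrM -lamX ger0_norm ?powR_ge0// ler_piMr ?powR_ge0//.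
  exact: wave_le1.
have hB n := geometric_sum_le _ n (u01 _ beta0).
have /choice[W hW] : forall x, exists l, has_sum (fun k => f k x) l.
  by move=> x; apply: (has_sum_ex _ _ _ (fun k => fle k x) hB).
exists b, W, (phi / 2), ((1 - (b%:R^-1 : R) `^ beta)^-1); split=> //.
- by rewrite divr_gt0.
- by move=> x; apply: (has_sum_bound _ _ _ _ (hW x) (fun k => fle k x) hB).
- move=> g /andP[g0 gb]; have [|C [a hC]] := bumpH g.
    by rewrite g0 (le_trans (ltW gb))// lerDl.
  have C0 := uniform_holder_ge0 _ _ _ _ hC.
  exists (C * (1 - (b%:R^-1 : R) `^ (beta - g))^-1).
  have hf k : uniform_holder g (C * ((b%:R^-1 : R) `^ (beta - g)) ^+ k) (f k)
      (fun x i => lam k `^ beta * a ((x - 0) / lam k) i / lam k ^+ i).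
    have l01 : 0 < lam k <= 1 by rewrite lam0 lam1.
    have := uniform_holder_scale g C (wave m) a (lam k `^ beta) 0 (lam k) g0 l01 hC.
    rewrite ger0_norm ?powR_ge0// -powRD_gt0// lamX mulrC.
    exact.
  apply: (uniform_holder_has_sum _ _ _ _ _ _ hf) hW.
  move=> n; rewrite -mulr_sumr ler_wpM2l//; apply: geometric_sum_le.
  by apply: u01; rewrite subr_gt0.
move=> k a; set t := b%:R^-1 ^+ k / _.
have t0 : 0 < t by rewrite divr_gt0// lam0.
have tl : lam k = p * t by rewrite mulrC divfK// gt_eqF.
(* The stencil fills one period from the grid point [n * lam k], which lies in [[a, a + lam k]]. *)
pose n : int := Num.floor (a / lam k) + 1.
have an : a / lam k <= n%:~R <= a / lam k + 1.
  have := floor_le (a / lam k); have := floorD1_gt (a / lam k).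
  by rewrite /n intrD; lra.
pose y := lam k * (n%:~R + 2^-1 / p).
have ypt j : y + j%:R * t = lam k * (n%:~R + (2^-1 + j%:R) / p).
  by rewrite /y /t -/(lam k) /p; field; rewrite gt_eqF.
exists y; split.
  move=> i im; rewrite ypt -/(lam k).
  have q0 : 0 <= (2^-1 + i%:R) / p <= 1.
    have i0 : 0 <= i%:R :> R by [].
    have im' : i%:R <= m%:R :> R by rewrite ler_nat.
    apply/andP; split; first by apply: divr_ge0; lra.
    by rewrite ler_pdivrMr// mul1r /p -(natr1 m); lra.
  have -> : a = lam k * (a / lam k) by rewrite mulrC divfK// gt_eqF.
  have -> : lam k * (a / lam k) + 2 * lam k = lam k * (a / lam k + 2) by ring.
  rewrite !ler_pM2l//; move: q0 an.
  by move: (_ / p) (a / lam k) (n%:~R : R) => q1 z n'; lra.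
have tail j : (k.+1 <= j)%N -> fdiff m t (f j) y = 0.
  move=> kj; apply: fdiff_periodic => [|x]; first by rewrite mE.
  rewrite /f; congr (_ * _); have [i ji] : exists i, j = (k + i.+1)%N.
    by exists (j - k.+1)%N; rewrite -addSnnS subnKC.
  have -> : (x + t - 0) / lam j = (x - 0) / lam j + (N * b ^ i)%:R.
    have lj : lam j = lam k * lam i.+1 by rewrite ji /lam exprD.
    have li : lam i.+1 * (N * b ^ i)%:R = p^-1.
      rewrite /lam exprS natrM natrX exprVn [_ * b%:R ^+ i]mulrC.
      rewrite mulrA divfK ?expf_neq0 ?gt_eqF//.
      by rewrite /b natrM invfM -mulrA mulVf ?mulr1// pnatr_eq0.
    have -> : (N * b ^ i)%:R = t / lam j.
      rewrite lj /t -/(lam k) -/p -li; field.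
      by rewrite !gt_eqF.
    by field; rewrite gt_eqF.
  exact: wave_period.
have hS := has_sum_fin _ _ tail.
have -> : fdiff m t W y = \sum_(0 <= j < k.+1) fdiff m t (f j) y.
  by apply: has_sum_unique (has_sum_fdiff m t y f W hW) hS.
rewrite big_nat_recr//=; set head := \sum_(_ <= _ < _) _.
have main : fdiff m t (f k) y = lam k `^ beta * phi.
  have fk j : (j <= m)%N -> f k (y + j%:R * t) = lam k `^ beta * bump m (2^-1 + j%:R).
    move=> jm; rewrite ypt /f subr0 [lam k * _]mulrC mulfK ?gt_eqF//.
    by rewrite wave_spot.
  rewrite fdiff_single; first by have := fk 0%N isT; rewrite mul0r !addr0.
  move=> j /andP[j0 jm]; rewrite fk// bump_off ?mulr0//; apply/negP => /andP[_].
  by have : 1 <= j%:R :> R by [rewrite ler1n]; lra.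
have headle : `|head| <= C2 / (b%:R - 1) * t `^ beta.
  apply: le_trans (ler_norm_sum _ _ _) _.
  apply: le_trans (_ : \sum_(0 <= j < k) (C2 * t `^ (beta + 1)) * b%:R ^+ j <= _).
    apply: ler_sum => j _; have l01 : 0 < lam j <= 1 by rewrite lam0 lam1.
    have hj := uniform_holder_scale _ C1 (wave m) a1 (lam j `^ beta) 0 (lam j) b10 l01 hC1.
    have tm : (Num.truncn (beta + 1) < m)%N by rewrite mE.
    have := uniform_holder_fdiff _ _ _ _ m t y b10 (ltW t0) tm hj.
    rewrite -/(f j) => /le_trans; apply.
    rewrite ger0_norm ?powR_ge0// -powRD_gt0// opprD addrA subrr add0r.
    rewrite powRN powRr1 ?(ltW (lam0 _))// powRM ?(ltW t0)//.
    rewrite /lam exprVn invrK /C2 le_eqVlt; apply/orP; left; apply/eqP; ring.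
  rewrite -mulr_sumr powRD_gt0// powRr1 ?(ltW t0)//.
  have -> : C2 * (t `^ beta * t) * (\sum_(0 <= j < k) b%:R ^+ j) =
     (C2 * t `^ beta) * (t * \sum_(0 <= j < k) b%:R ^+ j) by ring.
  have -> : C2 / (b%:R - 1) * t `^ beta = (C2 * t `^ beta) * (b%:R - 1)^-1 by ring.
  rewrite ler_wpM2l ?mulr_ge0 ?powR_ge0//.
  rewrite -[_^-1]mul1r ler_pdivlMr ?subr_gt0// -mulrA [_ * (b%:R - 1)]mulrC.
  rewrite big_mkord -subrX1 mulrBr mulr1.
  apply: le_trans (_ : t * b%:R ^+ k <= _); first by rewrite gerBl ltW.
  have lb : lam k * b%:R ^+ k = 1 by rewrite /lam exprVn mulVf ?expf_neq0 ?gt_eqF.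
  by rewrite /t -/(lam k) mulrAC lb mul1r invf_le1.
have bt0 : 0 <= t `^ beta by apply: powR_ge0.
have tp : t `^ beta <= lam k `^ beta.
  rewrite ge0_ler_powR ?nnegrE ?(ltW beta0) ?(ltW t0) ?(ltW (lam0 _))//.
  by rewrite tl ler_peMl// ltW.
have h1 : `|lam k `^ beta * phi| <= `|head + lam k `^ beta * phi| + `|head|.
  by rewrite -[X in `|X| <= _](addrK head) [_ * phi + _]addrC ler_normB.
rewrite main; rewrite ger0_norm ?mulr_ge0 ?powR_ge0 ?(ltW ph0)// in h1.
have h2 : C2 / (b%:R - 1) * t `^ beta <= phi / 2 * t `^ beta by rewrite ler_wpM2r.
have h3 : t `^ beta * phi <= lam k `^ beta * phi by rewrite ler_wpM2r// ltW.
by lra.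
Qed.

End Weierstrass.

(** * Superposition of singular pieces *)

Section Assembly.
Context {R : realType} (m : nat) (b : nat) (beta hmin cW : R) (W : R -> R).
Context (A B c q : nat -> R) (k : nat -> nat).
Context (K : nat -> set R) (E : nat -> R -> set R) (S : nat -> R -> R).
Implicit Types (x y t g h r : R) (i j : nat).

Let d j : R := b%:R^-1 ^+ k j.
Let p : R := m.+1%:R.
Let D01 : set R := `[0, 1]%classic.

(** [S j] lives on [[q, q + d]]. Points off the zone are at distance at least [d] from it, and
    [[q + 2 * d, q + 4 * d]] is the free window in which the irregularity of [W] is tested. *)
Definition zone (q d : R) x : Prop := q - d <= x <= q + 4 * d.

Hypotheses (mE : m = (Num.truncn (beta + 1)).+1) (beta_gt0 : 0 < beta)
  (hmin_itv : 0 < hmin <= beta) (b_gt1 : (1 < b)%N) (cW_gt0 : 0 < cW).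
Hypothesis W_holder : forall g, 0 <= g < beta -> exists C a, uniform_holder g C W a.
Hypothesis W_irregular : forall n a, exists y,
  (forall i, (i <= m)%N -> a <= y + i%:R * (b%:R^-1 ^+ n / p) <= a + 2 * b%:R^-1 ^+ n) /\
  cW * (b%:R^-1 ^+ n / p) `^ beta <= `|fdiff m (b%:R^-1 ^+ n / p) W y|.
Hypothesis A_ge : forall j, hmin <= A j.
Hypothesis B_lt : forall j, A j <= B j -> B j < beta.
Hypothesis pieces : forall j,
  singular_piece m beta (A j) (B j) (c j) (q j) (d j) (d j `^ (beta + 1))
    (K j) (E j) (S j).
Hypothesis zone_itv : forall j x, zone (q j) (d j) x -> 0 < x < 1.
Hypothesis d_small : forall j, 5 * d j <= 2^-1 ^+ (j * j).
Hypothesis d_mono : forall i j, (i <= j)%N -> d j <= d i.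
Hypothesis zone_free : forall i j y, (i < j)%N -> zone (q j) (d j) y -> ~ K i y.
Hypothesis zone_smooth : forall i j y, (i < j)%N ->
  (forall l, (l <= m)%N -> zone (q j) (d j) (y + l%:R * (d j / p))) ->
  `|fdiff m (d j / p) (S i) y| <= cW / (4 * j.+1%:R) * (d j / p) `^ beta.

Let b_gt0 : 0 < b%:R :> R. Proof. by rewrite ltr0n ltnW. Qed.

Let d_gt0 j : 0 < d j. Proof. by rewrite exprn_gt0// invr_gt0. Qed.

Let d_le j : d j <= 2^-1 ^+ j.
Proof.
have h := d_small j; have dj := d_gt0 j.
apply: le_trans (_ : 2^-1 ^+ (j * j) <= _); first by lra.
rewrite ler_wiXn2l//; first lra.
by case: j {h dj} => // j; rewrite leq_pmulr.
Qed.

Let d_le1 j : d j <= 1.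
Proof. by apply: le_trans (d_le j) _; rewrite exprn_ile1//; lra. Qed.

Let eps_split j : d j `^ (beta + 1) = d j `^ beta * d j.
Proof. by rewrite powRD_gt0// powRr1// ltW. Qed.

Let eps_le j : d j `^ (beta + 1) <= d j.
Proof.
rewrite eps_split ler_piMl ?(ltW (d_gt0 j))//.
apply: le_trans (_ : 1 `^ beta <= _); last by rewrite powR1.
by rewrite ge0_ler_powR ?nnegrE ?(ltW beta_gt0) ?(ltW (d_gt0 j)).
Qed.

Lemma half_tail_le N n :
  \sum_(0 <= i < n) (if (i < N)%N then 0 else 2^-1 ^+ i) <= 2 * 2^-1 ^+ N :> R.
Proof.
suff -> : \sum_(0 <= i < n) (if (i < N)%N then 0 else 2^-1 ^+ i) =
    2 * (2^-1 ^+ N - 2^-1 ^+ maxn n N) :> R.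
  by rewrite ler_pM2l// gerBl exprn_ge0// invr_ge0.
elim: n => [|n IH]; first by rewrite big_geq// max0n subrr mulr0.
rewrite big_nat_recr//= IH; case: ltnP => nN.
  by rewrite addr0 (maxn_idPr nN).
by rewrite (maxn_idPl (leqW nN)) exprS; field.
Qed.

Lemma piece_sum_ex : exists T : R -> R, forall x, has_sum (fun j => S j x) (T x).
Proof.
suff /choice[T hT] : forall x, exists l, has_sum (fun j => S j x) l by exists T.
move=> x; apply: (has_sum_ex _ (fun j => 2^-1 ^+ j) (2 * 2^-1 ^+ 0)) => [j|n].
  by apply: le_trans (piece_le _ _ _ _ _ _ _ _ _ _ _ (pieces j) x) _;
     apply: le_trans (eps_le j) (d_le j).
by have := half_tail_le 0 n.
Qed.

Context (T : R -> R).
Hypothesis T_sum : forall x, has_sum (fun j => S j x) (T x).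

Let Z x : R := W x + T x.

Let S_le j x : `|S j x| <= d j `^ (beta + 1).
Proof. exact: piece_le (pieces j) x. Qed.

Let S_supp j x : ~ (q j <= x <= q j + d j) -> S j x = 0.
Proof. exact: piece_supp (pieces j) x. Qed.

Let bump_holder g : 0 <= g <= beta + 1 ->
  exists2 C, 0 < C & uniform_holder g C (bump m) (@bump_jet R m).
Proof.
move=> /andP[g0 gb]; apply: uniform_holder_bump; rewrite g0 mE.
by apply: le_lt_trans gb _; exact: truncnS_gt.
Qed.

Lemma T_holder g : 0 <= g <= hmin -> exists C a, uniform_holder g C T a.
Proof.
move=> /andP[g0 gh]; have /andP[hm0 hmb] := hmin_itv.
have gb : g <= beta by apply: le_trans hmb.
have [|C C0 hC] := bump_holder g; first by rewrite g0 (le_trans gb)// lerDl.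
have /choice[a ha] : forall j, exists a,
    uniform_holder g (2 * (d j `^ (beta + 1) * C)) (S j) a.
  move=> j; apply: (piece_holder _ _ _ _ _ _ _ _ _ _ _ (pieces j)) => //.
  by rewrite g0 (le_trans gh (A_ge j)).
exists (2 * C * (2 * 2^-1 ^+ 0)).
apply: (uniform_holder_has_sum _ _ _ _ _ _ ha) => // n.
apply: le_trans (_ : \sum_(0 <= i < n) (2 * C) * 2^-1 ^+ i <= _).
  apply: ler_sum => i _; rewrite mulrCA [leLHS]mulrC ler_wpM2l//.
    by rewrite mulr_ge0 ?(ltW C0).
  by rewrite (le_trans (eps_le i))// d_le.
rewrite -mulr_sumr ler_wpM2l ?mulr_ge0 ?(ltW C0)//.
by have := half_tail_le 0 n.
Qed.

Lemma Z_holder_hmin g x : 0 <= g < beta -> g <= hmin -> pointwise_holder D01 Z g x.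
Proof.
move=> /andP[g0 gb] gh; apply: pointwise_holderD.
  have [C [a hC]] := W_holder g ltac:(by rewrite g0).
  exact: uniform_holder_pointwise hC.
have [C [a hC]] := T_holder g ltac:(by rewrite g0).
exact: uniform_holder_pointwise hC.
Qed.

Lemma Z_continuous : continuous Z.
Proof.
have /andP[hm0 hmb] := hmin_itv; pose g := hmin / 2.
have gp : 0 < g by rewrite divr_gt0.
have gb : 0 <= g < beta by rewrite ltW//= /g; lra.
have gh : 0 <= g <= hmin by rewrite ltW//= /g; lra.
have [C [a hC]] := W_holder g gb; have [C' [a' hC']] := T_holder g gh.
move=> x; apply: cvgD; first exact: (uniform_holder_continuous _ _ _ _ gp hC).
exact: (uniform_holder_continuous _ _ _ _ gp hC').
Qed.

Lemma T_le2 x : `|T x| <= 2.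
Proof.
apply: (has_sum_bound _ _ _ _ (T_sum x)) (_ : forall j, _ <= 2^-1 ^+ j) _ => [j|n].
  by apply: le_trans (S_le j x) _; apply: le_trans (eps_le j) (d_le j).
by have := half_tail_le 0 n; rewrite expr0 mulr1.
Qed.

Definition zones_limsup : set R :=
  [set x | forall N, exists2 j, (N <= j)%N & zone (q j) (d j) x].

(** Once [j * s >= 1], the bound [5 * d j <= 2^-(j * j)] makes the [s]-th power of the diameter at
    most [2^-j]; the quadratic exponent in [d_small] serves all [s > 0] at once. *)
Lemma zones_limsup_null s : 0 < s -> hausdorff_null s zones_limsup.
Proof.
move=> s0; apply: hausdorff_null_cover => // e e0.
have [n1 hn1] := geometric_small (2^-1 : R) (e / 2) ltac:(lra) ltac:(lra).
pose N := (n1 + (Num.truncn s^-1).+1)%N.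
have Ns j : (N <= j)%N -> 1 <= j%:R * s.
  move=> Nj; rewrite -ler_pdivrMr// mul1r; apply/ltW/(lt_le_trans (truncnS_gt _)).
  by rewrite ler_nat (leq_trans _ Nj)// leq_addl.
have N1 : 2 * 2^-1 ^+ N <= e :> R.
  have : 2^-1 ^+ N <= 2^-1 ^+ n1 :> R by rewrite ler_wiXn2l ?leq_addr//; lra.
  by lra.
exists (fun i => if (i < N)%N then set0 else zone (q i) (d i)).
exists (fun i => if (i < N)%N then 0 else 5 * d i); split.
- by move=> x /(_ N)[j Nj zj]; exists j => //=; rewrite ltnNge Nj.
- move=> i; case: ltnP => iN; first by rewrite lexx ltW.
  rewrite mulr_ge0 ?(ltW (d_gt0 i))//=; apply: le_trans (d_small i) _.
  apply: le_trans (_ : 2^-1 ^+ N <= _).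
    rewrite ler_wiXn2l//; first lra.
    by apply: (leq_trans iN); rewrite leq_pmulr// (leq_trans _ iN)// /N addnS.
  by have : 0 <= 2^-1 ^+ N :> R by [rewrite exprn_ge0// invr_ge0]; lra.
- move=> i; case: ifP => _; apply: ediam_le => // x y.
  by rewrite /zone ler_norml; have := d_gt0 i; lra.
move=> n; apply: le_trans N1; apply: le_trans (half_tail_le N n).
apply: ler_sum => i _; case: ltnP => iN; first by rewrite powR0 ?gt_eqF.
have q0 : 0 <= 2^-1 :> R by lra.
apply: le_trans (_ : (2^-1 ^+ (i * i)) `^ s <= _).
  by rewrite ge0_ler_powR ?nnegrE ?(ltW s0) ?mulr_ge0 ?(ltW (d_gt0 i)) ?exprn_ge0.
rewrite exprM powRX ?exprn_ge0// lerXn2r ?nnegrE ?powR_ge0//.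
rewrite -powR_mulrn// -powRrM -[leRHS]powRr1//.
by apply: ger_powR; [lra|exact: Ns].
Qed.

Lemma piece_zone j x : K j x -> zone (q j) (d j) x.
Proof.
by move=> /(piece_itv _ _ _ _ _ _ _ _ _ _ _ (pieces j)); rewrite /zone; have := d_gt0 j; lra.
Qed.

Lemma piece_limsup j x : K j x -> ~ zones_limsup x.
Proof. by move=> Kx /(_ j.+1)[i ji zi]; exact: (zone_free _ _ _ ji zi). Qed.

Lemma piece_disjoint i j x : K i x -> K j x -> i = j.
Proof.
move=> Ki Kj; case: (ltngtP i j) => // ij.
  by case: (zone_free _ _ _ ij (piece_zone _ _ Kj)).
by case: (zone_free _ _ _ ij (piece_zone _ _ Ki)).
Qed.

Lemma piece_local j x : ~ K j x -> exists r C, [/\ 0 < r, 0 <= C,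
  forall g, 0 <= g <= beta + 1 -> pointwise_holder D01 (S j) g x &
  forall t y, 0 < t -> (forall i, (i <= m)%N -> `|y + i%:R * t - x| < r) ->
    `|fdiff m t (S j) y| <= C * t * t `^ beta].
Proof.
move=> nK; have [r [C [f [a [r0 hf Sf]]]]] :=
  piece_smooth _ _ _ _ _ _ _ _ _ _ _ (pieces j) x nK.
have [D D0 hD] := smooth_fdiff _ _ _ _ _ (S j) x r mE beta_gt0 hf
  (fun y yr => (Sf y yr).1).
exists r, D; split => // g gb; apply: pointwise_holder_le gb _.
apply: (pointwise_holder_near D01 f (S j) (beta + 1) x r r0).
  by move=> y yr; have [->] := Sf y yr.
exact: uniform_holder_pointwise hf.
Qed.

Lemma not_limsup x : ~ zones_limsup x ->
  exists N, forall j, (N <= j)%N -> ~ zone (q j) (d j) x.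
Proof.
move=> /existsNP[N HN]; exists N => j Nj zj; apply: HN; by exists j.
Qed.

(** The height [d ^ (beta + 1)] splits as [d ^ beta * d]. On the support [|y - x| >= d], so the
    first factor gives flatness of order [beta] at [x], and the second is summable over [j]. *)
Lemma piece_flat j x y : ~ zone (q j) (d j) x ->
  `|S j y| <= `|y - x| `^ beta * d j.
Proof.
move=> nz; have dj := d_gt0 j.
have [h|h] := pselect (q j <= y <= q j + d j); last first.
  by rewrite S_supp// normr0 mulr_ge0 ?powR_ge0// ltW.
apply: le_trans (S_le j y) _; rewrite eps_split ler_pM2r//.
rewrite ge0_ler_powR ?nnegrE ?(ltW beta_gt0) ?(ltW dj)//.
rewrite leNgt; apply/negP; rewrite ltr_norml => h'; apply: nz.
by rewrite /zone; lra.
Qed.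

Definition T_tail N x : R := T x - \sum_(0 <= j < N) S j x.

Lemma T_tail_sum N x : has_sum (fun j => if (j < N)%N then 0 else S j x) (T_tail N x).
Proof. exact: has_sum_tail. Qed.

Lemma T_tail_flat N x y : (forall j, (N <= j)%N -> ~ zone (q j) (d j) x) ->
  `|T_tail N y| <= 2 * 2^-1 ^+ N * `|y - x| `^ beta.
Proof.
move=> nz; rewrite mulrC.
apply: (has_sum_bound _ (fun j => `|y - x| `^ beta * (if (j < N)%N then 0 else 2^-1 ^+ j))
  _ _ (T_tail_sum N y)) => [j|n].
  case: ltnP => jN; first by rewrite normr0 mulr0.
  apply: le_trans (piece_flat _ _ y (nz _ jN)) _.
  by rewrite ler_wpM2l ?powR_ge0.
by rewrite -mulr_sumr ler_wpM2l ?powR_ge0// half_tail_le.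
Qed.

Lemma T_tail_holder N x g : (forall j, (N <= j)%N -> ~ zone (q j) (d j) x) ->
  0 <= g <= beta -> pointwise_holder D01 (T_tail N) g x.
Proof.
move=> nz gb; apply: pointwise_holder_le gb _.
apply: (pointwise_holder_bound _ _ _ _ (2 * 2^-1 ^+ N) 1 ltr01) => y _ _.
exact: T_tail_flat.
Qed.

Lemma T_holder_off x g : ~ zones_limsup x -> (forall j, ~ K j x) -> 0 <= g <= beta ->
  pointwise_holder D01 T g x.
Proof.
move=> /not_limsup[N nz] nK gb.
have -> : T = fun y => T_tail N y + \sum_(j < N) S j y.
  by apply/funext => y; rewrite /T_tail big_mkord subrK.
apply: pointwise_holderD; first exact: T_tail_holder.
apply: pointwise_holder_sum => j _; have [r [C [_ _ h _]]] := piece_local _ _ (nK j).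
by apply: h; case/andP: gb => -> h; rewrite (le_trans h)// lerDl.
Qed.

(** Finitely many of the other pieces are smooth near [x], because the [K j] are disjoint; the rest
    are flat at [x], which lies in finitely many zones. *)
Lemma T_minus_holder i x g : K i x -> 0 <= g <= beta ->
  pointwise_holder D01 (fun y => T y - S i y) g x.
Proof.
move=> Ki gb; have [N nz] := not_limsup _ (piece_limsup _ _ Ki).
pose M := maxn N i.+1.
have nz' j : (M <= j)%N -> ~ zone (q j) (d j) x.
  by move=> Mj; apply: nz; apply: leq_trans Mj; exact: leq_maxl.
have iM : (i < M)%N by exact: leq_maxr.
have -> : (fun y => T y - S i y) =
    fun y => T_tail M y + \sum_(j < M) (if j == i :> nat then 0 else S j y).
  apply/funext => y; rewrite /T_tail big_mkord.
  have -> : \sum_(j < M) S j y =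
      S i y + \sum_(j < M) (if j == i :> nat then 0 else S j y).
    rewrite (bigD1 (Ordinal iM))//=; congr (_ + _).
    by rewrite big_mkcond; apply: eq_bigr => j _; rewrite -val_eqE /=; case: eqP.
  by ring.
apply: pointwise_holderD; first exact: T_tail_holder.
apply: (pointwise_holder_sum D01 (fun j y => if j == i then 0 else S j y)) => j _.
case: eqP => [_|ne]; first exact: pointwise_holder_cst.
have nK : ~ K j x by move=> Kj; apply: ne; exact: piece_disjoint Kj Ki.
have [r [C [_ _ h _]]] := piece_local _ _ nK.
by apply: h; case/andP: gb => -> h; rewrite (le_trans h)// lerDl.
Qed.

Lemma W_pointwise g x : 0 <= g < beta -> pointwise_holder D01 W g x.
Proof. by move=> /W_holder[C [a hC]]; exact: uniform_holder_pointwise hC. Qed.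

(** Since [h < beta], the background and the other pieces are regular beyond [h] and affect neither
    bound on the exponent of [S i]. *)
Lemma exponent_piece i h x : E i h x -> holder_exponent D01 Z x = h%:E.
Proof.
move=> Ex; have /andP[Ah hB] := piece_range _ _ _ _ _ _ _ _ _ _ _ (pieces i) _ _ Ex.
have Kx : K i x by apply/(piece_KE _ _ _ _ _ _ _ _ _ _ _ (pieces i)); exists h.
have hb : h < beta by apply: le_lt_trans hB (B_lt _ (le_trans Ah hB)).
have h0 : 0 < h.
  by case/andP: hmin_itv => h1 _; apply: lt_le_trans h1 (le_trans (A_ge i) Ah).
have ZE : Z = fun y => W y + (T y - S i y) + S i y.
  by apply/funext => y; rewrite /Z -addrA subrK.
apply: holder_exponent_eq => // g.
  move=> /andP[g0 gh]; have gb : 0 <= g < beta by rewrite g0 (lt_trans gh).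
  rewrite ZE; apply: pointwise_holderD.
    apply: pointwise_holderD; first exact: W_pointwise.
    by apply: T_minus_holder => //; case/andP: gb => -> /ltW.
  by apply: (piece_lower _ _ _ _ _ _ _ _ _ _ _ (pieces i) _ _ _ Ex); rewrite g0.
(* [g] is lowered below [beta], where the remaining terms are known to be regular. *)
move=> hg; have bt := beta_gt0; pose g' := Num.min g ((h + beta) / 2).
have hg' : h < g' by rewrite lt_min hg; lra.
have g'b : g' < beta by rewrite gt_min; apply/orP; right; lra.
have g'0 : 0 <= g' by rewrite ltW// (lt_trans h0).
move=> Zg; apply: (piece_upper _ _ _ _ _ _ _ _ _ _ _ (pieces i) _ _ _ Ex hg').
have Zg' : pointwise_holder D01 Z g' x.
  by apply: pointwise_holder_le Zg; rewrite g'0 ge_min lexx.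
have -> : S i = fun y => Z y - (W y + (T y - S i y)).
  by apply/funext => y; rewrite /Z; ring.
apply: pointwise_holderB => //; apply: pointwise_holderD.
  by apply: W_pointwise; rewrite g'0.
by apply: T_minus_holder => //; rewrite g'0 ltW.
Qed.

Let lam n : R := b%:R^-1 ^+ n.

Let lam_gt0 n : 0 < lam n. Proof. by rewrite exprn_gt0// invr_gt0. Qed.

Lemma lam_small e : 0 < e -> exists n, lam n <= e.
Proof.
move=> e0; apply: geometric_small => //; rewrite invr_ge0 ler0n /=.
by rewrite invf_lt1// ltr1n.
Qed.

(* The scale [t] is small enough for the smooth part to be negligible at order [beta]. *)
Lemma not_holder_irregular x g : beta < g ->
  (forall r, 0 < r -> exists n y, [/\ lam n <= r,
     forall i, (i <= m)%N -> D01 (y + i%:R * (lam n / p)) /\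
        `|y + i%:R * (lam n / p) - x| <= 5 * lam n,
     cW * (lam n / p) `^ beta <= `|fdiff m (lam n / p) W y| &
     `|fdiff m (lam n / p) T y| <= cW / 2 * (lam n / p) `^ beta]) ->
  ~ pointwise_holder D01 Z g x.
Proof.
move=> bg H; have p1 : 1 <= p by rewrite ler1n.
have b1 : beta < beta + 1 by rewrite ltrDl.
apply: (@not_pointwise_holder R D01 Z g beta x m (5 * p) (cW / 2)).
- by rewrite ltW.
- by rewrite mE ltnS le_truncn// ltW.
- by rewrite divr_gt0.
- by rewrite mulr_gt0.
move=> r r0; have [n [y [nr st hW hT]]] := H r r0.
exists (lam n / p), y; split.
- rewrite divr_gt0//=; apply: le_trans nr; rewrite ler_pdivrMr//.
  by rewrite ler_peMr// ltW.
- move=> i im; have [h1 h2] := st i im; split=> //; apply: le_trans h2 _.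
  by rewrite -mulrA ler_pM2l// mulrC divfK// gt_eqF.
rewrite fdiffD.
have : `|fdiff m (lam n / p) W y| <=
   `|fdiff m (lam n / p) W y + fdiff m (lam n / p) T y| + `|fdiff m (lam n / p) T y|.
  by rewrite -{1}(addrK (fdiff m (lam n / p) T y) (fdiff m (lam n / p) W y)) ler_normB.
by lra.
Qed.

(** [N] is fixed before the scale: the pieces from [N] on are flat at [x] and contribute at most
    [cW / 4 * t ^ beta]. The finitely many others have differences [O(t * t ^ beta)], beaten by a
    small step. *)
Lemma Z_irregular_off x g : D01 x -> ~ zones_limsup x -> (forall j, ~ K j x) ->
  beta < g -> ~ pointwise_holder D01 Z g x.
Proof.
move=> Dx /not_limsup[N0 nz0] nK bg; apply: not_holder_irregular => // r r0.
pose C1 : R := 2 ^+ m * (2 * (5 * p) `^ beta).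
have C10 : 0 < C1 by rewrite !mulr_gt0 ?exprn_gt0 ?powR_gt0 ?mulr_gt0.
have cW0 := cW_gt0.
have [N1 hN1] : exists N1, C1 * 2^-1 ^+ N1 <= cW / 4.
  have [n hn] := geometric_small (2^-1 : R) (cW / 4 / C1) ltac:(lra)
    ltac:(by rewrite !divr_gt0).
  by exists n; rewrite mulrC -ler_pdivlMr.
pose N := (N0 + N1)%N.
have nz j : (N <= j)%N -> ~ zone (q j) (d j) x.
  by move=> Nj; apply: nz0; apply: leq_trans Nj; exact: leq_addr.
have /choice[rC hrC] : forall j, exists rC : R * R, [/\ 0 < rC.1, 0 <= rC.2 &
    forall t y, 0 < t -> (forall i, (i <= m)%N -> `|y + i%:R * t - x| < rC.1) ->
    `|fdiff m t (S j) y| <= rC.2 * t * t `^ beta].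
  by move=> j; have [r' [C [h1 h2 _ h3]]] := piece_local _ _ (nK j); exists (r', C).
pose C2 := 1 + \sum_(j < N) (rC j).2.
have C20 : 0 < C2.
  by apply: ltr_pwDl => //; apply: sumr_ge0 => j _; have [] := hrC j.
have [r' r'0 hr'] : exists2 r', 0 < r' & forall j, (j < N)%N -> r' <= (rC j).1.
  elim: (N) => [|n [r' r'0 IH]]; first by exists 1.
  exists (Num.min r' (rC n).1); first by rewrite lt_min r'0; have [] := hrC n.
  move=> j; rewrite ltnS leq_eqVlt => /predU1P[->|jn].
    by rewrite ge_min lexx orbT.
  by rewrite ge_min IH.
pose r2 := Num.min (Num.min r 4^-1) (Num.min (r' / 6) (cW / 4 / C2)).
have r20 : 0 < r2.
  rewrite !lt_min r0 invr_gt0 !divr_gt0//=.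
  by rewrite ltr0n.
have [n] := lam_small _ r20; rewrite !le_min => /andP[/andP[nr n4] /andP[nr' nC]].
have l0 := lam_gt0 n; have p1 : 1 <= p by rewrite ler1n.
(* The window extends towards the side of [x] where [[0, 1]] leaves room; [lam n <= 1/4]
   suffices. *)
pose a := if x <= 2^-1 then x else x - 2 * lam n.
have [y [st hW]] := W_irregular n a; rewrite -/(lam n) in st hW *.
have st' i : (i <= m)%N -> D01 (y + i%:R * (lam n / p)) /\
    `|y + i%:R * (lam n / p) - x| <= 2 * lam n.
  move=> im; have := st i im; move: Dx; rewrite /D01 /= !in_itv /= /a.
  move: (y + _) => z; case: ifP => [xh|/negbT]; last rewrite -ltNge => xh;
    move=> x01 z01; split; rewrite ?ler_norml; lra.
have t0 : 0 < lam n / p by rewrite divr_gt0.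
have tl : lam n = p * (lam n / p) by rewrite mulrC divfK// gt_eqF.
have tle : lam n / p <= lam n by rewrite ler_pdivrMr// ler_peMr// ltW.
exists n, y; split=> //.
  by move=> i im; have [h1 h2] := st' i im; split=> //; lra.
set t := lam n / p in t0 tl tle hW st st' *.
have -> : T = fun y => T_tail N y + \sum_(j < N) S j y.
  by apply/funext => z; rewrite /T_tail big_mkord subrK.
have tb0 : 0 <= t `^ beta := powR_ge0 _ _.
rewrite fdiffD fdiff_sum; apply: le_trans (ler_normD _ _) _.
have p50 : 0 <= 5 * p by lra.
have p5t0 : 0 <= 5 * p * t by rewrite mulr_ge0 ?p50 ?(ltW t0).
have h1 : `|fdiff m t (T_tail N) y| <= cW / 4 * t `^ beta.
  apply: le_trans (_ : 2 ^+ m * (2 * 2^-1 ^+ N * (5 * p * t) `^ beta) <= _).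
    apply: fdiff_bound => i im; apply: le_trans (T_tail_flat _ _ _ nz) _.
    have h0 : 0 <= 2 * 2^-1 ^+ N :> R by rewrite mulr_ge0 ?exprn_ge0 ?invr_ge0.
    rewrite ler_wpM2l// ge0_ler_powR ?nnegrE ?(ltW beta_gt0) ?p5t0//.
    by have [_ h] := st' i im; rewrite -mulrA -tl; lra.
  rewrite powRM ?p50 ?(ltW t0)//.
  have -> : 2 ^+ m * (2 * 2^-1 ^+ N * ((5 * p) `^ beta * t `^ beta)) =
     C1 * 2^-1 ^+ N * t `^ beta by rewrite /C1; ring.
  rewrite ler_wpM2r//; apply: le_trans hN1; rewrite ler_pM2l//.
  by rewrite ler_wiXn2l ?leq_addl//; lra.
have h2 : `|\sum_(j < N) fdiff m t (S j) y| <= cW / 4 * t `^ beta.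
  apply: le_trans (ler_norm_sum _ _ _) _.
  apply: le_trans (_ : \sum_(j < N) ((rC j).2 * (t * t `^ beta)) <= _).
    apply: ler_sum => j _; rewrite mulrA; have [_ _ h] := hrC j; apply: h => // i im.
    have [_ hi] := st' i im; have := hr' j (ltn_ord j); lra.
  rewrite -mulr_suml mulrA ler_wpM2r//.
  apply: le_trans (_ : C2 * t <= _); first by rewrite ler_pM2r// lerDr.
  by rewrite mulrC -ler_pdivlMr//; lra.
by lra.
Qed.

(** A zone containing [x] supplies the scale [d j] and the free window. There [S j] vanishes, each
    of the [j] earlier pieces contributes at most [cW / (4 * j.+1) * t ^ beta], and a later one is
    at most [d l ^ beta * d l <= d j ^ beta * 2^-l], so that the later ones add up to a small
    multiple of [d j ^ beta]. *)
Lemma Z_irregular_limsup x g : zones_limsup x -> beta < g ->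
  ~ pointwise_holder D01 Z g x.
Proof.
move=> Lx bg; apply: not_holder_irregular => // r r0; have cW0 := cW_gt0.
pose C1 : R := 2 ^+ m * (2 * p `^ beta).
have C10 : 0 < C1 by rewrite !mulr_gt0 ?exprn_gt0 ?powR_gt0.
have e0 : 0 < Num.min r (cW / 4 / C1) by rewrite lt_min r0 !divr_gt0.
have [N hN] := geometric_small (2^-1 : R) _ ltac:(lra) e0.
have [j Nj zj] := Lx N.
have jN : 2^-1 ^+ j <= Num.min r (cW / 4 / C1).
  by apply: le_trans hN; rewrite ler_wiXn2l//; lra.
move: jN; rewrite le_min => /andP[jr jC].
have dj := d_gt0 j; have dle := d_le j.
have p1 : 1 <= p by rewrite ler1n.
have [y [st hW]] := W_irregular (k j) (q j + 2 * d j).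
exists (k j), y; rewrite -/(lam (k j)) in st hW *.
have ld : lam (k j) = d j by []. 
rewrite ld in st hW *.
have stz i : (i <= m)%N -> zone (q j) (d j) (y + i%:R * (d j / p)).
  by move=> im; have := st i im; rewrite /zone; move: (y + _) => z; lra.
have t0 : 0 < d j / p by rewrite divr_gt0.
have tl : d j = p * (d j / p) by rewrite mulrC divfK// gt_eqF.
split=> //; first by lra.
  move=> i im; have z := stz i im; split.
    by rewrite /D01 /= in_itv /=; have /andP[z0 z1] := zone_itv _ _ z; rewrite !ltW.
  by move: z zj; rewrite /zone ler_norml; move: (y + _) => w; lra.
set t := d j / p in t0 tl hW st stz *.
have TE : T = fun y => T_tail j.+1 y + \sum_(i < j.+1) S i y.
  by apply/funext => z; rewrite /T_tail big_mkord subrK.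
have tb0 : 0 <= t `^ beta := powR_ge0 _ _.
rewrite {1}TE fdiffD fdiff_sum; apply: le_trans (ler_normD _ _) _.
have h1 : `|fdiff m t (T_tail j.+1) y| <= cW / 4 * t `^ beta.
  apply: le_trans (_ : 2 ^+ m * (d j `^ beta * (2 * 2^-1 ^+ j.+1)) <= _).
    apply: fdiff_bound => i im.
    apply: (has_sum_bound _ (fun i => d j `^ beta * (if (i < j.+1)%N then 0 else 2^-1 ^+ i))
      _ _ (T_tail_sum j.+1 _)) => [l|n].
      case: ltnP => jl; first by rewrite normr0 mulr0.
      apply: le_trans (S_le l _) _; rewrite eps_split; apply: ler_pM.
      - exact: powR_ge0.
      - exact: ltW.
      - rewrite ge0_ler_powR ?nnegrE ?(ltW beta_gt0) ?(ltW (d_gt0 _))//.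
        by apply: d_mono; exact: ltnW.
      - exact: d_le.
    by rewrite -mulr_sumr ler_wpM2l ?powR_ge0// half_tail_le.
  have -> : d j `^ beta = p `^ beta * t `^ beta by rewrite {1}tl powRM ?(ltW t0)// ltW.
  have -> : 2 ^+ m * (p `^ beta * t `^ beta * (2 * 2^-1 ^+ j.+1)) =
     C1 * 2^-1 ^+ j.+1 * t `^ beta by rewrite /C1; ring.
  rewrite ler_wpM2r// mulrC -ler_pdivlMr//; apply: le_trans jC.
  by rewrite exprS ler_piMl ?exprn_ge0//; lra.
have h2 : `|\sum_(i < j.+1) fdiff m t (S i) y| <= cW / 4 * t `^ beta.
  rewrite big_ord_recr /=.
  have -> : fdiff m t (S j) y = 0.
    rewrite -(fdiff0 m t y); apply: eq_fdiff => i im; apply: S_supp.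
    by have := st i im; move: (y + _) => w; lra.
  rewrite addr0; apply: le_trans (ler_norm_sum _ _ _) _.
  apply: le_trans (_ : \sum_(i < j) (cW / (4 * j.+1%:R) * t `^ beta) <= _).
    by apply: ler_sum => i _; apply: zone_smooth.
  rewrite sumr_const_ord mulrA ler_wpM2r//.
  have j1 : 0 < j.+1%:R :> R by [].
  have -> : j%:R * (cW / (4 * j.+1%:R)) = cW / 4 * (j%:R / j.+1%:R).
    by field; rewrite nat1r gt_eqF.
  rewrite ler_piMr ?divr_ge0 ?(ltW cW0)// ler_pdivrMr// mul1r ler_nat.
  exact: leqnSn.
by lra.
Qed.

Lemma exponent_off x : D01 x -> ~ zones_limsup x -> (forall j, ~ K j x) ->
  holder_exponent D01 Z x = beta%:E.
Proof.
move=> Dx nL nK; apply: holder_exponent_eq => // g; last exact: Z_irregular_off.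
move=> gb; apply: pointwise_holderD; first exact: W_pointwise.
by apply: T_holder_off => //; case/andP: gb => -> /ltW.
Qed.

Lemma exponent_limsup x : zones_limsup x ->
  (hmin%:E <= holder_exponent D01 Z x <= beta%:E)%E.
Proof.
move=> Lx; have /andP[h0 hb] := hmin_itv; apply/andP; split.
  apply: holder_exponent_ge => //; first exact: ltW.
  move=> g /andP[g0 gh]; apply: Z_holder_hmin; last exact: ltW.
  by rewrite g0 (lt_le_trans gh).
by apply: holder_exponent_le => g; exact: Z_irregular_limsup.
Qed.

End Assembly.

(** * Inductive placement of the pieces *)

Section Core.
Context {R : realType}.

(** Dependent choice in which each new choice is constrained by all the previous ones. *)
Lemma prefix_recursion (X : Type) (x0 : X) (P : seq X -> X -> Prop) :
  (forall s, exists x, P s x) -> exists f : nat -> X, forall n, P (mkseq f n) (f n).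
Proof.
move=> /choice[F hF]; pose pre := fix pre n := if n is n'.+1
  then rcons (pre n') (F (pre n')) else [::].
exists (fun n => F (pre n)) => n; have -> : mkseq (fun n => F (pre n)) n = pre n.
  by elim: n => // n IH; rewrite mkseqS IH.
exact: hF.
Qed.

Lemma finite_eventually j (Q : nat -> nat -> Prop) :
  (forall i, (i < j)%N -> exists k0, forall k, (k0 <= k)%N -> Q i k) ->
  exists k0, forall k, (k0 <= k)%N -> forall i, (i < j)%N -> Q i k.
Proof.
elim: j => [|j IH] H; first by exists 0%N.
have [k1 h1] := IH (fun i ij => H i (leqW ij)); have [k2 h2] := H j (ltnSn j).
exists (maxn k1 k2) => k; rewrite geq_max => /andP[kk1 kk2] i.
by rewrite ltnS leq_eqVlt => /predU1P[->|ij]; [exact: h2|exact: h1].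
Qed.

(** A null set for the exponent 1 is Lebesgue negligible, hence does not contain the middle third of
    [[u, v]]. *)
Lemma null_avoid (N : set R) (u v : R) : u < v -> hausdorff_null 1 N ->
  exists2 x, u < x < v & ~ N x.
Proof.
move=> uv N0; apply: contrapT => H.
pose a := (2 * u + v) / 3; pose b := (u + 2 * v) / 3.
apply: (@itv_not_negligible R a b); first by rewrite /a /b; lra.
apply: (hausdorff_null_negligible 1 1 N _ id ler01 N0) => [x|x y _ _].
  rewrite /= in_itv /= /a /b => xab; apply: contrapT => nN; apply: H; exists x => //.
  by lra.
by rewrite powRr1// mul1r.
Qed.

(** Placing every kind in every interval is what will make the function homogeneous. Invalid codes
    fall back on the kind 0 in [[0, 1]]. *)
Lemma target_intervals : exists tgt : nat -> nat * (R * R),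
  (forall j, 0 <= (tgt j).2.1 < (tgt j).2.2 /\ (tgt j).2.2 <= 1) /\
  forall n (u v : R), 0 <= u < v -> v <= 1 -> exists j, [/\ (tgt j).1 = n,
    u <= (tgt j).2.1 & (tgt j).2.2 <= v].
Proof.
pose T : countType := (nat * (rat * rat))%type.
pose val (z : T) : nat * (R * R) := (z.1, (ratr z.2.1, ratr z.2.2)).
pose ok (z : nat * (R * R)) := (0 <= z.2.1 < z.2.2) && (z.2.2 <= 1).
pose tgt j := if @unpickle T j is Some z then
  if ok (val z) then val z else (0%N, (0, 1)) else (0%N, (0, 1)).
exists tgt; split.
  move=> j; rewrite /tgt; case: unpickle => [z|] /=; last by rewrite lexx ltr01.
  by case: ifP => [/andP[]|] //= _; rewrite lexx ltr01.
move=> n u v /andP[u0 uv] v1; pose w := (u + v) / 2.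
have [r] := rat_in_itvoo (ltac:(rewrite /w; lra) : u < w).
have [s] := rat_in_itvoo (ltac:(rewrite /w; lra) : w < v).
rewrite !in_itv /= => /andP[ws sv] /andP[ur rw].
exists (pickle ((n, (r, s)) : T)); rewrite /tgt pickleK /=.
have -> : ok (val (n, (r, s))).
  by rewrite /ok /=; apply/andP; split; [apply/andP; split|]; lra.
by split => //=; exact: ltW.
Qed.

(** The construction with [f] forgotten: only the triples [(A n, B n, c n)] remain, [kind j] is the
    index of the triple realised by the piece [j], and on [L] the exponent is merely bounded. *)
Lemma multifractal_core (beta hmin : R) (A B c : nat -> R) :
  0 < hmin <= beta -> (forall n, hmin <= A n) -> (forall n, 0 <= c n < 1) ->
  (forall n, A n <= B n -> B n < beta) ->
  exists (Z : R -> R) (L : set R) (kind : nat -> nat) (K : nat -> set R)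
         (E : nat -> R -> set R),
  [/\ continuous Z /\ (exists M, forall x, `|Z x| <= M),
      (forall s, 0 < s -> hausdorff_null s L) /\
      (forall j s, c (kind j) < s -> 0 < s -> hausdorff_null s (K j)),
      (forall x, `[0, 1]%classic x -> ~ L x -> (forall j, ~ K j x) ->
        holder_exponent `[0, 1] Z x = beta%:E) /\
      (forall x, L x -> (hmin%:E <= holder_exponent `[0%R, 1%R] Z x <= beta%:E)%E),
      (forall j x, K j x <-> exists h, E j h x) /\
      (forall j h x, E j h x -> A (kind j) <= h <= B (kind j) /\
                                holder_exponent `[0, 1] Z x = h%:E) &
      forall n (u v : R), 0 <= u < v -> v <= 1 -> exists j,
        [/\ kind j = n, forall x, K j x -> u < x < v &
            forall h, A n <= h <= B n -> E j h !=set0 /\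
              forall s, 0 <= s < c n -> ~ hausdorff_null s (E j h)]].
Proof.
move=> hm A_ge c01 B_lt; have /andP[hm0 hmb] := hm.
have beta0 : 0 < beta by apply: lt_le_trans hmb.
pose m := (Num.truncn (beta + 1)).+1; have mE : m = (Num.truncn (beta + 1)).+1 by [].
have [b [W [cW [BW [b1 cW0 W_le W_holder W_irr]]]]] := weierstrass_ex m beta beta0 mE.
pose lam k : R := b%:R^-1 ^+ k.
have b0 : 0 < b%:R :> R by rewrite ltr0n ltnW.
have lam0 k : 0 < lam k by rewrite exprn_gt0// invr_gt0.
have bi : 0 <= (b%:R^-1 : R) < 1 by rewrite invr_ge0 ltW//= invf_lt1// ltr1n.
have lam_mono k k' : (k <= k')%N -> lam k' <= lam k.
  by move=> kk; case/andP: bi => h1 h2; rewrite ler_wiXn2l// ltW.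
have lam1 k : lam k <= 1 by have := lam_mono 0%N k (leq0n k); rewrite {2}/lam expr0.
have lam_ev e : 0 < e -> exists n, forall k, (n <= k)%N -> lam k <= e.
  move=> e0; have [n hn] := geometric_small _ _ bi e0.
  by exists n => k nk; apply: le_trans (lam_mono _ _ nk) hn.
have [tgt [tgt_itv tgt_surj]] := target_intervals.
(* A piece is chosen beforehand for every kind, position and scale, an empty one if it does not fit
   into [[0, 1]]; the recursion then chooses only positions and scales. *)
have /choice[P hP] : forall z : nat * (R * nat), exists KES : set R * (R -> set R) * (R -> R),
    [/\ hausdorff_null 1 KES.1.1,
      forall x, ~ KES.1.1 x -> exists r D, [/\ 0 < r, 0 <= D,
        forall y, `|y - x| < r -> ~ KES.1.1 y &
        forall t y, 0 < t -> (forall i, (i <= m)%N -> `|y + i%:R * t - x| < r) ->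
          `|fdiff m t KES.2 y| <= D * t * t `^ beta] &
      0 <= z.2.1 -> z.2.1 + lam z.2.2 <= 1 ->
      singular_piece m beta (A z.1) (B z.1) (c z.1) z.2.1 (lam z.2.2)
        (lam z.2.2 `^ (beta + 1)) KES.1.1 KES.1.2 KES.2].
  case=> n [q k] /=; have [/andP[q0 q1]|nq] := boolP ((0 <= q) && (q + lam k <= 1)).
    have A0 : 0 <= A n by apply: le_trans (A_ge n); exact: ltW.
    have l01 : 0 < lam k <= 1 by rewrite lam0 lam1.
    have e0 : 0 < lam k `^ (beta + 1) by rewrite powR_gt0.
    have [K [E [S hS]]] := singular_piece_ex m beta (A n) (B n) (c n) q (lam k) _ mE
      beta0 A0 (fun AB => conj (B_lt n AB) (c01 n)) l01 e0 q0 q1.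
    exists (K, E, S); split=> //=.
      by apply: (piece_null _ _ _ _ _ _ _ _ _ _ _ hS) => //; case/andP: (c01 n).
    move=> x nK; have [r [C [f [a [r0 hf Sf]]]]] :=
      piece_smooth _ _ _ _ _ _ _ _ _ _ _ hS x nK.
    have [D D0 hD] := smooth_fdiff _ _ _ _ _ S x r mE beta0 hf
      (fun y yr => (Sf y yr).1).
    by exists r, D; split=> // y yr; have [] := Sf y yr.
  exists (set0, fun=> set0, fun=> 0); split=> /=.
  - exact: hausdorff_null0.
  - move=> x _; exists 1, 0; split=> // [y _ []|t y t0 _].
    by rewrite !fdiff0 subrr normr0 !mul0r.
  - by move=> q0 q1; move: nq; rewrite q0 q1.
pose p : R := m.+1%:R; have p0 : 0 < p by [].
have p1 : 1 <= p by rewrite ler1n.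
pose z0 : R * nat := (0, 0%N).
pose Pn i (z : R * nat) := P ((tgt i).1, z).
pose good (s : seq (R * nat)) (z : R * nat) := let j := size s in
  [/\ (tgt j).2.1 < z.1 - lam z.2, z.1 + 4 * lam z.2 < (tgt j).2.2,
     5 * lam z.2 <= 2^-1 ^+ (j * j) &
     forall i, (i < j)%N -> let zi := nth z0 s i in
       [/\ (zi.2 <= z.2)%N,
         forall y, zone z.1 (lam z.2) y -> ~ (Pn i zi).1.1 y &
         forall y, (forall l, (l <= m)%N ->
             zone z.1 (lam z.2) (y + l%:R * (lam z.2 / p))) ->
           `|fdiff m (lam z.2 / p) (Pn i zi).2 y| <=
             cW / (4 * j.+1%:R) * (lam z.2 / p) `^ beta]].
have good_ex s : exists z, good s z.
  rewrite /good; set j := size s; set u := (tgt j).2.1; set v := (tgt j).2.2.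
  have [/andP[u0 uv] v1] := tgt_itv j.
  pose N := \bigcup_i (if (i < j)%N then (Pn i (nth z0 s i)).1.1 else set0).
  have N0 : hausdorff_null 1 N.
    apply: hausdorff_null_bigcup => i; case: ifP => _; last exact: hausdorff_null0.
    by have [] := hP ((tgt i).1, nth z0 s i).
  (* As [c < 1], the earlier [K i] are null for the exponent 1 and [q] can avoid them all; the
     earlier pieces are smooth near [q], so every fine enough scale meets the requirements. *)
  have [q /andP[uq qv] nN] := null_avoid N u v uv N0.
  have e0 : 0 < Num.min (Num.min ((q - u) / 2) ((v - q) / 5)) (2^-1 ^+ (j * j) / 5).
    rewrite !lt_min !divr_gt0 ?subr_gt0 ?exprn_gt0//=.
  have [k1 hk1] := lam_ev _ e0.
  have cj0 : 0 < cW / (4 * j.+1%:R) by rewrite divr_gt0// mulr_gt0.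
  have [k2 hk2] : exists k2, forall k, (k2 <= k)%N -> forall i, (i < j)%N ->
      [/\ ((nth z0 s i).2 <= k)%N,
         forall y, zone q (lam k) y -> ~ (Pn i (nth z0 s i)).1.1 y &
         forall y, (forall l, (l <= m)%N -> zone q (lam k) (y + l%:R * (lam k / p))) ->
           `|fdiff m (lam k / p) (Pn i (nth z0 s i)).2 y| <=
             cW / (4 * j.+1%:R) * (lam k / p) `^ beta].
    apply: finite_eventually => i ij; set zi := nth _ s i.
    have nK : ~ (Pn i zi).1.1 q by move=> Kq; apply: nN; exists i => //; rewrite ij.
    have [_ /(_ _ nK)[r [D [r0 D0 rK rD]]] _] := hP ((tgt i).1, zi).
    have e'0 : 0 < Num.min (r / 5) (cW / (4 * j.+1%:R) / (D + 1)).
      by rewrite lt_min !divr_gt0//= ltr_wpDl.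
    have [k0 hk0] := lam_ev _ e'0; exists (maxn k0 zi.2) => k.
    rewrite geq_max => /andP[/hk0]; rewrite le_min => /andP[kr kD] zk.
    have lk := lam0 k.
    have near_q y : zone q (lam k) y -> `|y - q| < r.
      by rewrite /zone ltr_norml; lra.
    split=> // [y /near_q|y hy]; first exact: rK.
    have t0 : 0 < lam k / p by rewrite divr_gt0.
    apply: le_trans (rD _ y t0 _) _; first by move=> l /hy/near_q.
    rewrite ler_wpM2r ?powR_ge0//; apply: le_trans (_ : (D + 1) * lam k <= _).
      apply: ler_pM => //; first exact: ltW.
        by rewrite lerDl.
      by rewrite ler_pdivrMr// ler_peMr// ltW.
    by rewrite mulrC -ler_pdivlMr// ltr_wpDl.
  pose k := maxn k1 k2; exists (q, k) => /=.
  have := hk1 k (leq_maxl _ _); rewrite !le_min => /andP[/andP[h1 h2] h3].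
  have lk := lam0 k; split; [lra|lra|lra|].
  exact: hk2 (leq_maxr _ _).
have [z hz] := prefix_recursion _ z0 good good_ex.
have {}hz j : [/\ (tgt j).2.1 < (z j).1 - lam (z j).2,
     (z j).1 + 4 * lam (z j).2 < (tgt j).2.2,
     5 * lam (z j).2 <= 2^-1 ^+ (j * j) &
     forall i, (i < j)%N ->
       [/\ ((z i).2 <= (z j).2)%N,
         forall y, zone (z j).1 (lam (z j).2) y -> ~ (Pn i (z i)).1.1 y &
         forall y, (forall l, (l <= m)%N ->
             zone (z j).1 (lam (z j).2) (y + l%:R * (lam (z j).2 / p))) ->
           `|fdiff m (lam (z j).2 / p) (Pn i (z i)).2 y| <=
             cW / (4 * j.+1%:R) * (lam (z j).2 / p) `^ beta]].
  have := hz j; rewrite /good size_mkseq => -[h1 h2 h3 h4]; split=> // i ij.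
  by have := h4 i ij; rewrite nth_mkseq.
pose kind j := (tgt j).1; pose q j := (z j).1; pose k j := (z j).2.
pose K j := (Pn j (z j)).1.1; pose E j := (Pn j (z j)).1.2; pose S j := (Pn j (z j)).2.
have pieces j : singular_piece m beta (A (kind j)) (B (kind j)) (c (kind j)) (q j)
    (lam (k j)) (lam (k j) `^ (beta + 1)) (K j) (E j) (S j).
  have [_ _ h] := hP ((tgt j).1, z j); have [h1 h2 _ _] := hz j.
  have [/andP[u0 uv] v1] := tgt_itv j; have l0 := lam0 (z j).2.
  by apply: h => /=; lra.
have zone_tgt j x : zone (q j) (lam (k j)) x -> (tgt j).2.1 < x < (tgt j).2.2.
  by have [h1 h2 _ _] := hz j; rewrite /zone /q /k; lra.
have zone01 j x : zone (q j) (lam (k j)) x -> 0 < x < 1.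
  by move=> /zone_tgt; have [/andP[u0 uv] v1] := tgt_itv j; lra.
have d_small j : 5 * lam (k j) <= 2^-1 ^+ (j * j) by have [] := hz j.
have d_mono i j : (i <= j)%N -> lam (k j) <= lam (k i).
  rewrite leq_eqVlt => /predU1P[->//|ij]; apply: lam_mono.
  by have [_ _ _ /(_ i ij)[]] := hz j.
have zfree i j y : (i < j)%N -> zone (q j) (lam (k j)) y -> ~ K i y.
  by move=> ij; have [_ _ _ /(_ i ij)[_ h _]] := hz j; exact: h.
have zsmooth i j y : (i < j)%N ->
    (forall l, (l <= m)%N -> zone (q j) (lam (k j)) (y + l%:R * (lam (k j) / p))) ->
    `|fdiff m (lam (k j) / p) (S i) y| <=
      cW / (4 * j.+1%:R) * (lam (k j) / p) `^ beta.
  by move=> ij; have [_ _ _ /(_ i ij)[_ _ h]] := hz j; exact: h.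
have kA j : hmin <= A (kind j) by exact: A_ge.
have kB j : A (kind j) <= B (kind j) -> B (kind j) < beta by exact: B_lt.
have [T hT] := @piece_sum_ex R m b beta (fun j => A (kind j)) (fun j => B (kind j))
  (fun j => c (kind j)) q k K E S beta0 b1 pieces d_small.
exists (fun x => W x + T x), (@zones_limsup R b q k), kind, K, E; split.
- split.
    by apply: (@Z_continuous R m b beta hmin W (fun j => A (kind j)) (fun j => B (kind j))
      (fun j => c (kind j)) q k K E S).
  exists (BW + 2) => x; apply: le_trans (ler_normD _ _) _; apply: lerD => //.
  by apply: (@T_le2 R m b beta (fun j => A (kind j)) (fun j => B (kind j))
      (fun j => c (kind j)) q k K E S).
- split; first by move=> s s0; apply: zones_limsup_null.
  by move=> j s; exact: piece_null (pieces j) s.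
- split=> [x Dx nL nK|x Lx].
    by apply: (@exponent_off R m b beta cW W (fun j => A (kind j))
      (fun j => B (kind j)) (fun j => c (kind j)) q k K E S).
  by apply: (@exponent_limsup R m b beta hmin cW W (fun j => A (kind j))
      (fun j => B (kind j)) (fun j => c (kind j)) q k K E S).
- split=> [j x|j h x Ex]; first exact: piece_KE (pieces j) x.
  split; first exact: piece_range (pieces j) _ _ Ex.
  by apply: (@exponent_piece R m b beta hmin W (fun j => A (kind j))
      (fun j => B (kind j)) (fun j => c (kind j)) q k K E S) Ex.
- move=> n u v uv v1; have [j [jn ju jv]] := tgt_surj n u v uv v1; exists j.
  split=> // [x Kx|h].
    have /zone_tgt : zone (q j) (lam (k j)) x.
      by have := piece_itv _ _ _ _ _ _ _ _ _ _ _ (pieces j) x Kx; rewrite /zone;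
         have := lam0 (k j); lra.
    by lra.
  by have := piece_big _ _ _ _ _ _ _ _ _ _ _ (pieces j) h; rewrite /kind jn; exact.
Qed.

End Core.

(** * The multifractal spectrum *)

Section FullMeasure.
Context {R : realType}.
Implicit Types (A N : set R).

(** [A] is a Borel subset of [[0, 1]] together with part of a null set; the completed measure is by
    definition the outer measure, so subadditivity gives its value. *)
Lemma full_measure_completed A : A `<=` `[0, 1]%classic ->
  (@lebesgue_measure R).-negligible (`[0, 1]%classic `\` A) ->
  lebesgue_measurable A /\ completed_lebesgue_measure A = 1%E.
Proof.
move=> A01 nA; split.
  rewrite /lebesgue_measurable g_sigma_completed_algebra_genE.
  have [B [mB B0 AB]] := nA; exists (`[0, 1]%classic `\` B).
    by apply: measurableD => //; exact: measurable_itv.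
  exists (A `&` B).
    by exists B; split=> //; exact: subIsetr.
  apply/seteqP; split=> x.
    by move=> [[x01 nB]|[]//]; apply: contrapT => nAx; apply: nB; exact: AB.
  by move=> Ax; have [Bx|nB] := pselect (B x); [right|left; split=> //; exact: A01].
have e01 : (wlength idfun)^*%mu (`[0%R, 1%R]%classic : set R) = 1%E.
  transitivity (lebesgue_measure (`[0, 1]%classic : set R)) => //.
  by rewrite lebesgue_measure_itv /= lte_fin ltr01 oppr0 adde0.
have nE : (wlength idfun)^*%mu (`[0%R, 1%R]%classic `&` ~` A) = 0%E.
  by apply/negligible_outer_measure; rewrite -setDE.
change ((wlength idfun)^*%mu A = 1%E); apply/eqP; rewrite eq_le; apply/andP; split.
  by rewrite -e01; exact: le_outer_measure.
rewrite -e01.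
apply: le_trans (le_outer_measureIC ((wlength idfun)^*)%mu A `[0%R, 1%R]%classic) _.
rewrite [X in (_ + X <= _)%E](_ : _ = 0%E)// adde0.
by apply: le_outer_measure; exact: subIsetr.
Qed.

Lemma hausdorff_null_unit s : 1 < s -> hausdorff_null s (`[0, 1]%classic : set R).
Proof.
move=> s1; have s0 : 0 < s by apply: lt_trans s1.
apply: hausdorff_null_cover => // e e0.
have h2 : 0 < (2^-1 : R) by lra.
have u01 : 0 <= 2 * (2^-1 : R) `^ s < 1.
  rewrite mulr_ge0 ?powR_ge0//=; have : (2^-1 : R) `^ s < 2^-1 `^ 1.
    rewrite /powR gt_eqF// ltr_expR ltr_nM2r// ln_lt0// h2; lra.
  by rewrite powRr1 ?ltW//; lra.
have [n1 hn1] := geometric_small _ e u01 e0.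
have [n2 hn2] := geometric_small (2^-1 : R) e ltac:(lra) e0.
pose n := (n1 + n2)%N; pose d : R := 2^-1 ^+ n; have d0 : 0 < d by rewrite exprn_gt0.
have dn : d * (2 ^ n)%:R = 1 by rewrite /d natrX -exprMn mulVf ?expr1n.
exists (fun k => if (k < 2 ^ n)%N then `[k%:R * d, k.+1%:R * d]%classic else set0).
exists (fun k => if (k < 2 ^ n)%N then d else 0); split.
- move=> x; rewrite /= in_itv /= => /andP[x0 x1].
  (* The end 1 would get the index [2 ^ n], out of range; it belongs to the last closed interval. *)
  have [xe|xne] := eqVneq x 1.
    have p2 : (0 < 2 ^ n)%N by rewrite expn_gt0.
    exists (2 ^ n).-1 => //=; rewrite ltn_predL p2 /= in_itv/= (prednK p2).
    by rewrite ![_ * d]mulrC dn xe lexx andbT -[leRHS]dn ler_pM2l// ler_nat leq_pred.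
  have xl : x < 1 by rewrite lt_neqAle xne.
  have xd0 : 0 <= x / d by rewrite divr_ge0 // ltW.
  have /andP[t1 t2] := truncn_itv xd0.
  exists (Num.truncn (x / d)) => //=; rewrite truncn_lt_nat//.
  have -> : x / d < (2 ^ n)%:R by rewrite ltr_pdivrMr// mulrC dn.
  by rewrite /= in_itv /= -ler_pdivlMr// t1 /= -ler_pdivrMr// ltW.
- move=> k; case: ifP => _; last by rewrite lexx ltW.
  rewrite (ltW d0)/=; apply: le_trans hn2.
  by rewrite ler_wiXn2l ?leq_addl//; lra.
- move=> k; case: ifP => _; apply: ediam_le => // x y.
  by rewrite /= !in_itv /= -natr1 mulrDl mul1r ler_norml; lra.
move=> N; have p0 := powR_ge0 d s.
suff -> : \sum_(0 <= k < N) (if (k < 2 ^ n)%N then d else 0) `^ s =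
    (minn N (2 ^ n))%:R * d `^ s.
  apply: (@le_trans _ _ ((2 ^ n)%:R * d `^ s)).
    by rewrite ler_wpM2r// ler_nat geq_minr.
  rewrite /d powRX ?(ltW h2)// natrX -exprMn; apply: le_trans hn1.
  by case/andP: u01 => h h'; rewrite ler_wiXn2l ?leq_addr// ltW.
elim: N => [|N IH]; first by rewrite big_geq// min0n mul0r.
rewrite big_nat_recr//= IH; case: ifP => [nl|/negbT].
  by rewrite (minn_idPl (ltnW nl)) (minn_idPl nl) -natr1 mulrDl mul1r.
rewrite -leqNgt => ln; rewrite powR0 ?gt_eqF// addr0 (minn_idPr ln).
by rewrite (minn_idPr (leqW ln)).
Qed.

(** For [s < 1], [|x - y| <= |x - y| ^ s] on [[0, 1]], so a null set for [s] is Lebesgue negligible,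
    which full measure in [[a, b]] forbids. *)
Lemma full_measure_dim (U A : set R) (a b : R) : is_interval U ->
  U `<=` `[0, 1]%classic -> U a -> U b -> a < b ->
  (@lebesgue_measure R).-negligible (`[0, 1]%classic `\` A) ->
  hausdorff_dim (U `&` A) = 1%E.
Proof.
move=> iU U01 Ua Ub ab nA.
have key : ~ (@lebesgue_measure R).-negligible (U `&` A).
  move=> nUA; apply: (itv_not_negligible a b ab).
  apply: negligibleS (negligibleU nUA nA) => x; rewrite /= in_itv /= => xab.
  have Ux := iU _ _ Ua Ub x xab.
  by have [Ax|nAx] := pselect (A x); [left|right; split=> //; exact: U01].
apply/eqP; rewrite eq_le; apply/andP; split.
  apply: hausdorff_dim_le => // s s1; apply: hausdorff_null_sub (hausdorff_null_unit s s1).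
  by move=> x [/U01].
apply: hausdorff_dim_ge => [|s /andP[s0 s1] null].
  apply/set0P/eqP => e; apply: key; rewrite e; exact: negligible_set0.
apply: key; apply: (hausdorff_null_negligible s 1 (U `&` A) _ id s0 null) => // x y.
move=> [/U01 + _] [/U01 + _]; rewrite /= !in_itv /= mul1r => x01 y01.
have xy : 0 <= `|x - y| <= 1 by rewrite normr_ge0 ler_norml; lra.
have [->|n0] := eqVneq `|x - y| 0; first exact: powR_ge0.
rewrite -[leLHS]powRr1//; apply: ger_powR; last exact: ltW.
by rewrite lt_def n0.
Qed.

End FullMeasure.

(** The interval [[a k, b k]] may reach 1, which stands for [beta] itself, whereas a singular piece
    needs exponents below [beta]. It is therefore exhausted by intervals cut at [1 - 1/(i+1)]. The
    triples of dimension 0 come from [None] and realise the 0 in the maximum. *)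
Lemma classF_levels (R : realType) (f : R -> \bar R) : classF f ->
  exists (h0 : R) (lo hi dim : nat -> R),
  [/\ 0 < h0 <= 1, forall x, fsupport_star f x <-> h0 <= x <= 1,
      forall n, [/\ h0 <= lo n, 0 <= dim n < 1 & lo n <= hi n -> hi n < 1],
      forall n x, lo n <= x <= hi n -> ((dim n)%:E <= maxe (f x) 0)%E &
      forall x s, h0 <= x < 1 -> (s%:E < maxe (f x) 0)%E ->
        exists n, lo n <= x <= hi n /\ s < dim n].
Proof.
move=> hf.
have [f01 [fn [a [b [fn01 ab h0pos fnc fsup]]]]] := hf.
set h0 := inf (range a) in h0pos.
have ha_inf : has_inf (range a).
  by split; [exists (a 0%N); exists 0%N|exists 0 => _ [n _ <-]; have [] := ab n].
have h0a n : h0 <= a n by apply: ge_inf; [exact: ha_inf.2|exists n].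
have a1 n : a n <= 1 by have [_ h1 h2 _] := ab n; apply: le_trans h1 h2.
have h01 : h0 <= 1 by apply: le_trans (h0a 0%N) (a1 0%N).
have fnE n x : 0 <= x -> (-oo < fn n x%:E)%E <-> a n <= x <= b n.
  move=> x0; have [_ _ _ e] := ab n; split=> [lt|xab].
    have : [set x%:E | x in `[a n, b n]] x%:E by rewrite -e; split.
    by move=> [y + [<-]]; rewrite /= in_itv.
  have : fsupport [set x | (0 <= x)%E] (fn n) x%:E.
    by rewrite e; exists x => //=; rewrite in_itv.
  by case.
pose cn n : R := fine (fn n (a n)%:E).
have cnP n x : a n <= x <= b n -> [/\ fn n x%:E = (cn n)%:E, 0 <= cn n & cn n <= a n].
  move=> xab; have [an0 anb bn1 _] := ab n.
  have aab : a n <= a n <= b n by rewrite lexx.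
  have [[c hc] le] := fnc n.
  have lt : (-oo < fn n (a n)%:E)%E by apply/fnE.
  have fnx : fn n x%:E = fn n (a n)%:E by rewrite !hc.
  have := le _ aab; have := fn01 n (a n)%:E; rewrite lee_fin => /(_ an0).
  rewrite /cn fnx; case: (fn n (a n)%:E) lt => [r _| |]//.
  by rewrite !lee_fin => -[//|/andP[r0 _]] ra; split.
have f_ge n x : a n <= x <= b n -> ((cn n)%:E <= f x)%E.
  move=> xab; have [an0 anb bn1 _] := ab n; have [<- _ _] := cnP n x xab.
  have x01 : 0 <= x <= 1 by lra.
  by rewrite fsup//; apply: ereal_sup_ubound; exists n.
have supE x : fsupport_star f x <-> h0 <= x <= 1.
  split=> [|x01 M [[h ->] hM]].
    move=> /(_ `[h0, 1]%classic); rewrite /= in_itv /=; apply; split; first by exists h0.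
    move=> y [y01 fy]; move: y01; rewrite /= !in_itv /= => y01.
    move: fy; rewrite fsup// => /ereal_sup_gt[_ [n _ <-]] lt.
    have /(fnE n y) : (-oo < fn n y%:E)%E by [].
    by case/andP: y01 => y0 y1 /(_ y0) /andP[any _]; rewrite (le_trans (h0a n) any).
  rewrite /= in_itv /=; case/andP: x01 => h0x ->; rewrite andbT; apply: le_trans h0x.
  apply: lb_le_inf; first exact: ha_inf.1.
  move=> _ [n _ <-]; have [an0 anb bn1 _] := ab n.
  have : `[h, 1]%classic (a n).
    apply: hM; split; first by rewrite /= in_itv /= an0 a1.
    by apply: lt_le_trans (f_ge n _ _); rewrite ?lexx ?anb// ltNyr.
  by rewrite /= in_itv /= => /andP[].
pose level (m : option nat) (i : nat) : R * R * R :=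
  if m is Some k then (a k, Num.min (b k) (1 - i.+1%:R^-1), cn k)
  else (h0, 1 - i.+1%:R^-1, 0).
(* Invalid codes and empty intervals become [(1, 0, 0)], whose lower end exceeds its upper end: an
   empty piece. *)
pose cell n : R * R * R :=
  if @unpickle (option nat * nat)%type n is Some (m, i) then
    if (level m i).1.1 <= (level m i).1.2 then level m i else (1, 0, 0)
  else (1, 0, 0).
have inv_gt0 i : 0 < i.+1%:R^-1 :> R by rewrite invr_gt0.
have levelP m i : (level m i).1.1 <= (level m i).1.2 ->
    [/\ h0 <= (level m i).1.1, 0 <= (level m i).2 < 1, (level m i).1.2 < 1 &
      forall x, (level m i).1.1 <= x <= (level m i).1.2 ->
        ((level m i).2%:E <= maxe (f x) 0)%E].
  case: m => [k|] /=; move: (i.+1%:R^-1) (inv_gt0 i) => e e0; rewrite ?le_min ?gt_min => le.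
    have [_ akb _ _] := ab k; have aab : a k <= a k <= b k by rewrite lexx.
    have [_ c0 ca] := cnP k _ aab; split=> //; first 2 last.
    - by move=> x; rewrite le_min le_max => /and3P[ax xb _]; rewrite f_ge ?ax.
    (* The bound of [fn k] by the identity, taken at [a k], gives [cn k <= a k], and a nonempty cut
       interval has [a k < 1]. *)
    - by rewrite c0; case/andP: le => _; move: (a k) (cn k) ca => ? ? ?; lra.
    - by apply/orP; right; lra.
  by split=> //; rewrite ?lexx ?ltr01 //; [lra|move=> x _; rewrite le_max lexx orbT].
have cell_ex m i x : (level m i).1.1 <= x <= (level m i).1.2 ->
    exists n, (cell n).1.1 <= x <= (cell n).1.2 /\ (cell n).2 = (level m i).2.
  move=> xlv; exists (pickle (m, i)); rewrite /cell pickleK.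
  by case/andP: (xlv) => l1 l2; rewrite (le_trans l1 l2) xlv.
exists h0, (fun n => (cell n).1.1), (fun n => (cell n).1.2), (fun n => (cell n).2); split.
- by rewrite h0pos.
- exact: supE.
- move=> n; rewrite /cell; case: unpickle => [[m i]|]; last by rewrite /= h01 lexx ltr01 ler10.
  have [le|_] := boolP ((level m i).1.1 <= (level m i).1.2); last by rewrite /= h01 lexx ltr01 ler10.
  by have [] := levelP _ _ le.
- move=> n x; rewrite /cell; case: unpickle => [[m i]|]; last first.
    by case/andP=> h /(le_trans h); rewrite ler10.
  have [le|_] := boolP ((level m i).1.1 <= (level m i).1.2); last first.
    by case/andP=> h /(le_trans h); rewrite ler10.
  by have [_ _ _] := levelP _ _ le; exact.
move=> x s /andP[h0x x1].
have [i xi] : exists i, x <= 1 - i.+1%:R^-1.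
  have [i hi] := geometric_small (2^-1 : R) (1 - x) ltac:(lra) ltac:(lra).
  exists (2 ^ i)%N; rewrite lerBrDl -lerBrDr; apply: le_trans hi.
  rewrite exprVn -natrX lef_pV2 ?posrE ?ltr0n ?expn_gt0//.
  by rewrite ler_nat.
rewrite lt_max => /orP[|s0]; last first.
  have [|n [xn dn]] := cell_ex None i x; first by rewrite /= h0x.
  by exists n; rewrite dn -lte_fin.
have x0 : 0 <= x by apply: le_trans h0x; exact: ltW.
rewrite fsup ?x0 ?ltW// => /ereal_sup_gt[_ [k _ <-]] sk.
have akb : a k <= x <= b k by apply/(fnE k x x0); apply: lt_trans sk; rewrite ltNyr.
have [e _ _] := cnP k x akb; move: sk; rewrite e lte_fin => sk.
have [|n [xn dn]] := cell_ex (Some k) i x.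
  by case/andP: akb => h h'; rewrite /= h le_min h' xi.
by exists n; rewrite dn.
Qed.

Theorem theorem1p16 (R : realType) (alpha beta : R) (f : R -> \bar R)
    (halpha : 0 < alpha) (hbeta : alpha < beta) (hf : classF f) :
  exists Z : R -> R,
    [/\ {within `[0, 1], continuous Z},
        forall x, 0 <= x <= 1 -> 0 <= Z x <= 1 &
        homogeneously_multifractal Z] /\
    [/\ forall h,
          (affine_image alpha beta (fsupport_star f) `\` [set beta]) h ->
          spectrum Z h = maxe (f ((h - alpha) / (beta - alpha))) 0%E,
        forall h, 0 <= h ->
          ~ affine_image alpha beta (fsupport_star f) h ->
          spectrum Z h = -oo%E &
        lebesgue_measurable (iso_holder Z beta) /\
        completed_lebesgue_measure (iso_holder Z beta) = 1%E].
Proof.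
have [h0 [lo [hi [dim [/andP[h0pos h01] supE levP lev_le lev_ex]]]]] := classF_levels R f hf.
have ba : 0 < beta - alpha by rewrite subr_gt0.
pose g x := alpha + (beta - alpha) * x.
have g_le x y : (g x <= g y) = (x <= y) by rewrite /g lerD2l ler_pM2l.
have g1 : g 1 = beta by rewrite /g mulr1 addrC subrK.
have gV h : g ((h - alpha) / (beta - alpha)) = h.
  by rewrite /g mulrC divfK ?gt_eqF// addrC subrK.
have gK x : (g x - alpha) / (beta - alpha) = x.
  by rewrite /g addrC addKr mulrC mulKf// gt_eqF.
have g_lt x : (g x < beta) = (x < 1) by rewrite -g1 !ltNge g_le.
have [f01 _] := hf.
have hmin0 : 0 < g h0 <= beta.
  by rewrite -[leRHS]g1 g_le h01 andbT addr_gt0// mulr_gt0.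
have [n|n|n|Z0 [L [kind [K [E [[Z0c [M Z0M]] [nullL nullK] [offK onL] [KE Ehold] core]]]]]] :=
    @multifractal_core R beta (g h0) (g \o lo) (g \o hi) dim hmin0.
- by rewrite /= g_le; have [] := levP n.
- by have [] := levP n.
- by rewrite /= g_le g_lt; have [] := levP n.
(* Ensures [|k * Z0 x| <= 1/2], so that [Z] takes values in [[0, 1]]; an affine change keeps all
   exponents. *)
pose k : R := (2 * (`|M| + 1))^-1.
have k0 : 0 < k by rewrite invr_gt0 mulr_gt0// ltr_wpDl.
pose Z x := 2^-1 + k * Z0 x.
have expZ x : holder_exponent `[0, 1] Z x = holder_exponent `[0, 1] Z0 x.
  by apply: holder_exponent_affine; rewrite gt_eqF.
pose D x : \bar R := maxe (f x) 0.
have DE x : 0 <= x <= 1 -> exists2 d, D x = d%:E & 0 <= d.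
  move=> x01; rewrite /D; case: (f01 x x01) => [->|].
    by exists 0 => //; rewrite maxNye.
  case: (f x) => [r| |] /andP[r0 _] //.
  by exists r; rewrite -?lee_fin // max_l.
have split3 x : `[0, 1]%classic x ->
    [\/ L x, exists j h, E j h x | holder_exponent `[0, 1] Z x = beta%:E].
  move=> x01; have [Lx|nL] := pselect (L x); first by constructor 1.
  have [[j /KE Kj]|nK] := pselect (exists j, K j x).
    by constructor 2; exists j.
  constructor 3; rewrite expZ; apply: offK => // j Kj; by apply: nK; exists j.
have iso_level h x : h != beta -> iso_holder Z h x ->
    L x \/ exists j, [/\ K j x, g (lo (kind j)) <= h & h <= g (hi (kind j))].
  move=> hb [x01 xh]; have [Lx|[j [h' Ex]]|xb] := split3 x x01; first by left.
  - right; exists j; have [/andP[h1 h2] e] := Ehold _ _ _ Ex.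
    move: e; rewrite -expZ xh => -[e]; rewrite e; split=> //.
    by apply/KE; exists h'.
  - by move: xb hb; rewrite xh => -[->]; rewrite eqxx.
have iso_range h x : iso_holder Z h x -> h = beta \/ exists2 y, h0 <= y <= 1 & h = g y.
  move=> isoh; have [->|hb] := eqVneq h beta; first by left.
  right; exists ((h - alpha) / (beta - alpha)); last by rewrite gV.
  rewrite -(g_le h0) -(g_le _ 1) gV g1.
  have [Lx|[j [Kj h1 h2]]] := iso_level h x hb isoh.
    by have := onL x Lx; rewrite -expZ (proj2 isoh) !lee_fin.
  have [a1 _ a3] := levP (kind j).
  rewrite (le_trans _ h1) ?g_le//= (le_trans h2)// ltW// g_lt a3//.
  by rewrite -g_le (le_trans h1).
have iso_null y s : h0 <= y < 1 -> (D y < s%:E)%E -> hausdorff_null s (iso_holder Z (g y)).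
  move=> /andP[y0 y1] Ds.
  have [d Dd d0] : exists2 d, D y = d%:E & 0 <= d.
    by apply: DE; rewrite (ltW y1) andbT (le_trans (ltW h0pos)).
  have s0 : 0 < s by move: Ds; rewrite Dd lte_fin; apply: le_lt_trans.
  (* Besides [L], only pieces whose exponent range contains [g y] meet the level set, and their
     dimensions are at most [D y]. *)
  pose W j := if lo (kind j) <= y <= hi (kind j) then K j else set0.
  apply: (@hausdorff_null_sub _ s _ (L `|` \bigcup_j W j)).
    move=> x isoh; have [|Lx|[j [Kj h1 h2]]] := iso_level (g y) x _ isoh.
    - by rewrite -g1 lt_eqF// g1 g_lt.
    - by left.
    - by right; exists j => //; rewrite /W -g_le h1 -g_le h2.
  apply: hausdorff_nullU => //; first exact: nullL.
  apply: hausdorff_null_bigcup => // j; rewrite /W; case: ifP => [yj|_].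
    apply: nullK => //; rewrite -lte_fin; apply: le_lt_trans Ds; exact: lev_le.
  exact: hausdorff_null0.
have iso_dim (U : set R) u v y : is_interval U -> U `<=` `[0, 1]%classic -> U u -> U v ->
    u < v -> h0 <= y < 1 -> hausdorff_dim (U `&` iso_holder Z (g y)) = D y.
  move=> iU U01 Uu Uv uv y01; have y0 : 0 <= y <= 1 by move: h0pos y01; lra.
  have big s : (s%:E < D y)%E -> U `&` iso_holder Z (g y) !=set0 /\
      (0 <= s -> ~ hausdorff_null s (U `&` iso_holder Z (g y))).
    move=> /(lev_ex y s y01) [n [yn sn]].
    have [j [kj Kuv]] : exists j, [/\ kind j = n, forall x, K j x -> u < x < v &
        forall h, g (lo n) <= h <= g (hi n) -> E j h !=set0 /\
          forall s, 0 <= s < dim n -> ~ hausdorff_null s (E j h)].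
      have := U01 _ Uu; have := U01 _ Uv; rewrite /= !in_itv /= => /andP[_ v1] /andP[u0 _].
      by apply: core; rewrite ?u0.
    move=> /(_ (g y)); rewrite !g_le => /(_ yn) [[x Ex] nullE].
    have sub : E j (g y) `<=` U `&` iso_holder Z (g y).
      move=> z Ez; have [_ ez] := Ehold _ _ _ Ez.
      have /andP[uz zv] : u < z < v by apply: Kuv; apply/KE; exists (g y).
      have Uz : U z by apply: (iU _ _ Uu Uv); rewrite !ltW.
      by split=> //; split; [exact: U01|rewrite expZ].
    split=> [|s0 /(hausdorff_null_sub _ _ _ sub)]; first by exists x; exact: sub.
    by apply: nullE; rewrite s0.
  have [d Dd d0] := DE y y0.
  apply/eqP; rewrite eq_le Dd; apply/andP; split.
    apply: hausdorff_dim_le => // s ds; apply: (@hausdorff_null_sub _ _ _ (iso_holder Z (g y))).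
      exact: subIsetr.
    by apply: iso_null => //; rewrite Dd lte_fin.
  apply: hausdorff_dim_ge => [|s /andP[s0 sd]].
    (* The value [-1] lies below [D y], so [big] yields a point even when [D y = 0]. *)
    by have [] := big (-1) _; rewrite // Dd lte_fin; lra.
  by have [|_] := big s _; [rewrite Dd lte_fin|exact].
(* All dimensions [dim n] are below 1, so [L] and the [K j] are null for the exponent 1, and
   elsewhere the exponent is [beta]. *)
have iso_beta : (@lebesgue_measure R).-negligible (`[0, 1]%classic `\` iso_holder Z beta).
  apply: (hausdorff_null_negligible 1 1 (L `|` \bigcup_j K j) _ id) => //.
  - apply: hausdorff_nullU => //; first exact: nullL.
    apply: hausdorff_null_bigcup => // j; apply: nullK => //.
    by have [_ /andP[_ +] _] := levP (kind j).
  - move=> x [x01 nb]; have [Lx|[j [h Ex]]|xb] := split3 x x01; first by left.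
      by right; exists j => //; apply/KE; exists h.
    by exfalso; apply: nb.
  - by move=> x y _ _; rewrite powRr1// mul1r.
have I01 : is_interval (`[0, 1]%classic : set R) by exact: interval_is_interval.
have I0 : `[0, 1]%classic (0 : R) by rewrite /= in_itv /= lexx ler01.
have I1 : `[0, 1]%classic (1 : R) by rewrite /= in_itv /= lexx ler01.
have isoI h : `[0, 1]%classic `&` iso_holder Z h = iso_holder Z h.
  by apply/setIidPr => x [].
have spec y : h0 <= y < 1 -> spectrum Z (g y) = D y.
  by move=> y01; rewrite /spectrum -isoI; apply: (iso_dim _ 0 1).
have imgP h : affine_image alpha beta (fsupport_star f) h <-> exists2 y, h0 <= y <= 1 & h = g y.
  by split=> [[y /supE y01 <-]|[y y01 ->]]; exists y => //; exact/supE.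
exists Z; split; split.
- apply: continuous_subspaceT => x; apply: cvgD; first exact: cvg_cst.
  by apply: cvgMr; exact: Z0c.
- move=> x _; have : `|k * Z0 x| <= 2^-1.
    rewrite normrM gtr0_norm// /k invfM mulrAC -mulrA ler_piMr//.
    rewrite ler_pdivrMr ?ltr_wpDl// mul1r (le_trans (Z0M x))//.
    by rewrite (le_trans (ler_norm M))// lerDl.
  by rewrite /Z ler_norml; move: (k * Z0 x) => t; lra.
- move=> U iU U01 [u [v [Uu Uv uv]]] h h_ge0.
  (* [iso_dim] stops short of [beta]; there full measure gives dimension 1 on both sides. *)
  have [->|hb] := eqVneq h beta.
    rewrite (full_measure_dim U (iso_holder Z beta) u v)// /spectrum -isoI.
    by rewrite (full_measure_dim `[0, 1]%classic (iso_holder Z beta) 0 1).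
  have [[x isoh]|/nonemptyPn e] := pselect (iso_holder Z h !=set0); last first.
    by rewrite /spectrum e setI0.
  have [hb'|[y /andP[y0 y1] hy]] := iso_range h x isoh; first by rewrite hb' eqxx in hb.
  have y01 : h0 <= y < 1 by rewrite y0 -g_lt -hy lt_neqAle hb hy -g1 g_le.
  by rewrite hy spec// (iso_dim U u v).
- move=> h [/imgP[y /andP[y0 y1] ->] hb].
  have y01 : h0 <= y < 1.
    by rewrite y0 lt_neqAle y1 andbT; apply/eqP => y1'; apply: hb; rewrite /= y1' g1.
  by rewrite spec// gK.
- move=> h h_ge0 nimg; rewrite /spectrum; suff -> : iso_holder Z h = set0.
    exact: hausdorff_dim_set0.
  apply/seteqP; split=> // x isoh; apply: nimg; apply/imgP.
  have [->|//] := iso_range h x isoh.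
  by exists 1; rewrite ?h01 ?lexx// g1.
- by apply: full_measure_completed => // x [].
Qed.
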